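(* Let $d\ge1$ be an integer, and for $k=1,\ldots,d$ let $\beta_k\in(0,\frac\pi2)$ and $\alpha_k\in(0,\beta_k)$. There exist sequences $(\Psi_{k,i})_{i\ge1}$ and $(\tilde\Psi_{k,i})_{i\ge1}$ in $H^\infty_0(B_{\alpha_k})$, $k=1,\ldots,d$, such that: (1) for every real $p>0$ and every $k$, $\sup_{\zeta\in B_{\alpha_k}}\sum_{i\ge1}|\Psi_{k,i}(\zeta)|^p<\infty$ and $\sup_{\zeta\in B_{\alpha_k}}\sum_{i\ge1}|\tilde\Psi_{k,i}(\zeta)|^p<\infty$; (2) there is a constant $C>0$ such that for every bounded holomorphic $h$ on $B_{\beta_1}\times\cdots\times B_{\beta_d}$ there is a family $(a_{i_1,\ldots,i_d})_{i_1,\ldots,i_d\ge1}$ of complex numbers with $|a_{i_1,\ldots,i_d}|\le C\sup_{B_{\beta_1}\times\cdots\times B_{\beta_d}}|h|$ for all indices, and for every $(\zeta_1,\ldots,\zeta_d)\in B_{\alpha_1}\times\cdots\times B_{\alpha_d}$, $h(\zeta_1,\ldots,\zeta_d)=\sum_{i_1,\ldots,i_d\ge1}a_{i_1,\ldots,i_d}\Psi_{1,i_1}(\zeta_1)\tilde\Psi_{1,i_1}(\zeta_1)\cdots\Psi_{d,i_d}(\zeta_d)\tilde\Psi_{d,i_d}(\zeta_d)$.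
   Context: For $\gamma\in(0,\frac\pi2)$, the Stolz domain $B_\gamma$ is the interior of the convex hull of the point $1$ and the disc $D(0,\sin\gamma)$. $H^\infty_0(B_\gamma)$ is the set of bounded holomorphic functions $f$ on $B_\gamma$ such that $|f(\zeta)|\le c|1-\zeta|^s$ on $B_\gamma$ for some constants $c,s>0$. *)

(* Defs.v *)
From HB Require Import structures.
From mathcomp Require Import all_boot all_order all_algebra.
From mathcomp Require Import all_classical all_reals all_analysis.
From mathcomp Require Import complex.
From mathcomp Require Import finmap.
Import Order.TTheory GRing.Theory Num.Theory.
Import numFieldNormedType.Exports.

Set Implicit Arguments. Unset Strict Implicit. Unset Printing Implicit Defensive.

Local Open Scope ring_scope.
Local Open Scope complex_scope.
Local Open Scope classical_set_scope.

Notation normc := Normc.normc.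

(* Convex hull of the point 1 and the open disc D(0, sin g). *)
Definition stolz_hull (R : realType) (g : R) : set (R[i])^o :=
  [set z | exists (t : R) (w : R[i]), 0 <= t <= 1 /\ normc w < sin g /\
           z = t%:C + (1 - t)%:C * w].

Definition stolz (R : realType) (g : R) : set (R[i])^o :=
  interior (stolz_hull g).

Definition holo_on (R : realType) (U : set (R[i])^o) (f : (R[i])^o -> (R[i])^o) :=
  forall z, U z -> differentiable f z.

Definition bounded_on (R : realType) (T : Type) (U : set T) (f : T -> (R[i])^o) :=
  exists M : R, forall z, U z -> normc (f z) <= M.

Definition Hinf0 (R : realType) (g : R) (f : (R[i])^o -> (R[i])^o) :=
  [/\ holo_on (stolz g) f, bounded_on (stolz g) f &
      exists c s : R, [/\ 0 < c, 0 < s &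
        forall z, stolz g z -> normc (f z) <= c * powR (normc (1 - z)) s]].

Definition stolz_prod (R : realType) (d : nat) (b : 'I_d -> R) :
  set 'rV[(R[i])^o]_d :=
  [set z | forall k : 'I_d, stolz (b k) (z ord0 k)].

Definition holo_on_d (R : realType) (d : nat) (U : set 'rV[(R[i])^o]_d)
  (h : 'rV[(R[i])^o]_d -> (R[i])^o) :=
  forall z, U z -> differentiable h z.

Definition has_sum (R : realType) (I : choiceType) (f : I -> (R[i])^o) (s : (R[i])^o) :=
  forall e : R, 0 < e -> exists F0 : {fset I}, forall F : {fset I},
    fsubset F0 F -> normc (s - \sum_(i <- F) f i) < e.

(* Main.v *)
(** Near the vertex, write u = 1 - z and v = 1 - zeta. Applying Cauchy's formula to
h(z) / sqrt(u) on a polygon that lies between B_alpha and B_beta and has a vertex at 1 gives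
h(zeta) as an integral of h(z) against sqrt(v/u) / (z - zeta). Cut the polygon into edges
[q, q'] that are short compared with a = |1 - q|, geometrically near the vertex, and expand
1/(z - zeta) in powers of z - q: the resulting functions of zeta are
O(sqrt(a |v|) / (a + |v|) 4^-j), which is summable over all edges and all j to any power p,
uniformly in zeta. The coefficients are integrals of h over edges. If "integral" means a Banach
limit of Riemann sums, these are bounded linear functionals on all bounded functions, so in
several variables they can be iterated with no holomorphy in the remaining variables, and the
d-dimensional series is the tensor product of the one-dimensional ones. *)

Require Import Defs.
From HB Require Import structures.
From mathcomp Require Import all_boot all_order all_algebra.
From mathcomp Require Import all_classical all_reals all_analysis.
From mathcomp Require Import complex finmap.
From mathcomp Require Import ring lra.
Import Order.TTheory GRing.Theory Num.Theory.
Import numFieldNormedType.Exports.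
Local Open Scope ring_scope.
Local Open Scope complex_scope.
Local Open Scope classical_set_scope.

Set Implicit Arguments. Unset Strict Implicit. Unset Printing Implicit Defensive.

(** The square root weight has two jobs. At the vertex, where [h] is merely bounded, [1 / sqrt u]
    grows more slowly than the distance to 1 shrinks, so the contour can be truncated by a vertical
    edge whose contribution tends to 0; and [sqrt v] supplies the decay at 1 that [Hinf0] demands.
    The size [sqrt (a |v|) / (a + |v|)] depends only on the ratio of [a] and [|v|] and decays on
    both sides, so its powers along a geometric sequence of [a] have sums bounded independently of
    [v]. Each atom is split into two factors that both have the square root of this size.

    Iteration over the variables dictates the form of the one-variable statement. The functionals
    must accept slices that are partial sums in other variables, about which only boundedness is
    known. The number of terms needed for a given precision may depend on the point but not on [h],
    since the slices vary with the remaining coordinates. *)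

Notation ReC := complex.Re.
Notation ImC := complex.Im.

(** * Modulus and complex differentiability at a point *)

Section ComplexModulus.
Variable R : realType.
Implicit Types x y z : R[i].

Lemma modM x y : normc (x * y) = normc x * normc y.
Proof. exact: Normc.normcM. Qed.

Lemma modD x y : normc (x + y) <= normc x + normc y.
Proof. exact: le_normcD. Qed.

Lemma modN x : normc (- x) = normc x.
Proof. exact: normcN. Qed.

Lemma modB x y : normc (x - y) <= normc x + normc y.
Proof. by rewrite -(modN y); exact: modD. Qed.

Lemma modBC x y : normc (x - y) = normc (y - x).
Proof. by rewrite -modN opprB. Qed.

Lemma modV x : normc x^-1 = (normc x)^-1.
Proof. exact: Normc.normcV. Qed.

Lemma mod0 : normc (0 : R[i]) = 0.
Proof. exact: Normc.normc0. Qed.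

Lemma mod1 : normc (1 : R[i]) = 1.
Proof. exact: Normc.normc1. Qed.

Lemma mod_ge0 x : 0 <= normc x.
Proof. by case: x => a b; rewrite /= sqrtr_ge0. Qed.

Lemma mod_real (r : R) : normc r%:C = `|r|.
Proof. by rewrite /= expr0n /= addr0 sqrtr_sqr. Qed.

Lemma mod_eq0 x : (normc x == 0) = (x == 0).
Proof. by apply/eqP/eqP => [/Normc.eq0_normc //|->]; rewrite mod0. Qed.

Lemma mod_gt0 x : (0 < normc x) = (x != 0).
Proof. by rewrite lt_def mod_ge0 andbT mod_eq0. Qed.

Lemma mod_sqr x : normc x ^+ 2 = ReC x ^+ 2 + ImC x ^+ 2.
Proof. by case: x => a b; rewrite /= sqr_sqrtr ?addr_ge0 ?sqr_ge0. Qed.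

Lemma modX x n : normc (x ^+ n) = normc x ^+ n.
Proof. by elim: n => [|n IH]; rewrite ?expr0 ?mod1 // !exprS modM IH. Qed.

Lemma mod_conj x : normc x^*%C = normc x.
Proof. by case: x => a b; rewrite /= sqrrN. Qed.

Lemma ler_abs_Re x : `|ReC x| <= normc x.
Proof. by case: x => a b; rewrite /= -sqrtr_sqr ler_wsqrtr // lerDl sqr_ge0. Qed.

Lemma ler_abs_Im x : `|ImC x| <= normc x.
Proof. by case: x => a b; rewrite /= -sqrtr_sqr ler_wsqrtr // lerDr sqr_ge0. Qed.

Lemma ler_Re x : ReC x <= normc x.
Proof. exact: le_trans (ler_norm _) (ler_abs_Re x). Qed.

Lemma normE x : `|x| = (normc x)%:C.
Proof. by case: x. Qed.

Lemma mod_sum (I : Type) (r : seq I) (P : pred I) (F : I -> R[i]) :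
  normc (\sum_(i <- r | P i) F i) <= \sum_(i <- r | P i) normc (F i).
Proof.
elim/big_ind2 : _ => [|x1 x2 y1 y2 h1 h2|//]; first by rewrite mod0.
by rewrite (le_trans (modD _ _)) // lerD.
Qed.

Lemma mod_prod (I : Type) (r : seq I) (P : pred I) (F : I -> R[i]) :
  normc (\prod_(i <- r | P i) F i) = \prod_(i <- r | P i) normc (F i).
Proof.
apply: (big_morph (@Normc.normc R)); [exact: modM|exact: mod1].
Qed.

Lemma ler_mod_dist x y : normc x - normc y <= normc (x - y).
Proof. by rewrite lerBlDr -{1}(subrK y x) modD. Qed.

Lemma ReD x y : ReC (x + y) = ReC x + ReC y. Proof. by case: x y => [a b] [c d]. Qed.
Lemma ImD x y : ImC (x + y) = ImC x + ImC y. Proof. by case: x y => [a b] [c d]. Qed.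
Lemma ReN x : ReC (- x) = - ReC x. Proof. by case: x. Qed.
Lemma ImN x : ImC (- x) = - ImC x. Proof. by case: x. Qed.
Lemma ReM x y : ReC (x * y) = ReC x * ReC y - ImC x * ImC y.
Proof. by case: x y => [a b] [c d]. Qed.
Lemma ImM x y : ImC (x * y) = ReC x * ImC y + ImC x * ReC y.
Proof. by case: x y => [a b] [c d]. Qed.
Lemma ReJ x : ReC x^*%C = ReC x. Proof. by case: x. Qed.
Lemma ImJ x : ImC x^*%C = - ImC x. Proof. by case: x. Qed.
Lemma ReMr (r : R) x : ReC (r%:C * x) = r * ReC x.
Proof. by rewrite ReM /= mul0r subr0. Qed.
Lemma ImMr (r : R) x : ImC (r%:C * x) = r * ImC x.
Proof. by rewrite ImM /= mul0r addr0. Qed.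

Lemma complex_eqP x y : ReC x = ReC y -> ImC x = ImC y -> x = y.
Proof. by case: x y => [a b] [c d] /= -> ->. Qed.

Lemma Re_sum (I : Type) (r : seq I) (P : pred I) (F : I -> R[i]) :
  ReC (\sum_(i <- r | P i) F i) = \sum_(i <- r | P i) ReC (F i).
Proof. by apply: (big_morph _ ReD). Qed.
Lemma Im_sum (I : Type) (r : seq I) (P : pred I) (F : I -> R[i]) :
  ImC (\sum_(i <- r | P i) F i) = \sum_(i <- r | P i) ImC (F i).
Proof. by apply: (big_morph _ ImD). Qed.

Lemma nbhs_modP (z : (R[i])^o) (A : set (R[i])^o) :
  nbhs z A <-> exists2 e : R, 0 < e & forall w : R[i], normc (w - z) < e -> A w.
Proof.
split.
  move=> /nbhs_ballP [e e0 H].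
  have [er eE] : exists er : R, e = er%:C.
    by move: (gtr0_real e0) => /complex_realP.
  move: e0 H; rewrite eE => e0 H.
  exists er; first by rewrite -ltcR.
  by move=> w hw; apply: H; rewrite /ball /= normE ltcR modBC.
move=> [e e0 H]; apply/nbhs_ballP; exists e%:C; first by rewrite /= ltcR.
move=> w; rewrite /ball /= normE ltcR modBC; exact: H.
Qed.

(** The norm of [R[i]] is itself complex valued; here differentiability over [R[i]] becomes an
    estimate with real radii and real moduli. *)
Lemma differentiable_modP (f : (R[i])^o -> (R[i])^o) (z : (R[i])^o) :
  differentiable f z <->
  exists d : R[i], forall e : R, 0 < e -> exists2 r : R, 0 < r &
    forall w : R[i], normc (w - z) < r ->
      normc (f w - f z - d * (w - z)) <= e * normc (w - z).
Proof.
have -> : differentiable f z <-> derivable f z 1.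
  by rewrite -(@derivable1_diffP R[i] (R[i])^o f z).
split.
  move=> /cvg_ex [d /cvgrPdist_le H]; exists (d : R[i]) => e e0.
  move: (H e%:C); rewrite ltcR => /(_ e0) {H}.
  move=> /nbhs_ballP [r r0 H].
  have [er eE] : exists er : R, r = er%:C.
    by move: (gtr0_real r0) => /complex_realP.
  move: r0 H; rewrite eE => r0 H.
  exists er; first by rewrite -ltcR.
  move=> w hw; have [->|wz] := eqVneq w z.
    by rewrite !subrr mulr0 subrr mod0 mulr0.
  have wz0 : w - z != 0 by rewrite subr_eq0.
  have := H (w - z); rewrite /ball /= sub0r normrN normE ltcR => /(_ hw wz0).
  rewrite normE lecR /GRing.scale /= mulr1 subrK => H2.
  rewrite -ler_pdivrMr ?mod_gt0 // -modV -modM -modN.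
  by move: H2; congr (normc _ <= _); field.
move=> [d H]; apply/cvg_ex; exists (d : (R[i])^o); apply/cvgrPdist_le => e e0.
have [er eE] : exists er : R, e = er%:C.
  by move: (gtr0_real e0) => /complex_realP.
move: e0; rewrite {}eE ltcR => e0.
have [r r0 {}H] := H _ e0.
apply/nbhs_ballP; exists r%:C; first by rewrite /= ltcR.
move=> h; rewrite /ball /= sub0r normrN normE ltcR => hr h0.
have := H (h + z); rewrite addrK => /(_ hr) H2.
rewrite normE lecR /GRing.scale /= mulr1.
rewrite -(ler_pM2r (_ : 0 < normc h)) ?mod_gt0 // -modM -modN.
by move: H2; congr (normc _ <= _); field.
Qed.

End ComplexModulus.

(** * Banach limits *)

Section BanachLimit.
Variable R : realType.

Definition bdd_seq (u : nat -> R) := exists M, forall n, `|u n| <= M.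

Let avg (u : nat -> R) (n : nat) : R := n.+1%:R^-1 * \sum_(k < n.+1) u k.

(** The Cesaro averages of a bounded sequence stay in a compact interval, so they converge along an
    ultrafilter finer than [\oo]. Averaging first is what yields shift invariance: the averages of a
    sequence and of its shift differ by O(1/n). *)
Lemma banach_limit_real : exists m : (nat -> R) -> R,
  [/\ forall u v c, bdd_seq u -> bdd_seq v -> m (fun n => u n + c * v n) = m u + c * m v,
      forall u M, (forall n, `|u n| <= M) -> m u <= M,
      m (fun=> 1) = 1 &
      forall u, bdd_seq u -> m (fun n => u n.+1) = m u].
Proof.
have [G [GU EG]] := ultraFilterLemma (@eventually_filter).
have GF : Filter G by exact: ultra_proper.
pose m (u : nat -> R) : R := lim (avg u @ G).
have avgle (u : nat -> R) (M : R) : (forall n, `|u n| <= M) -> forall n, `|avg u n| <= M.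
  move=> uM n; rewrite /avg normrM ger0_norm ?invr_ge0 //.
  rewrite ler_pdivrMl // (le_trans (ler_norm_sum _ _ _)) //.
  apply: (@le_trans _ _ (\sum_(k < n.+1) M)); first exact: ler_sum.
  by rewrite sumr_const card_ord mulr_natl.
have cvm u : bdd_seq u -> avg u @ G --> m u.
  move=> [M uM].
  have [|p [_ hp]] := @segment_compact _ (- M) M (avg u @ G) _.
    apply: (@filterS _ G _ setT); last exact: filterT.
    by move=> n _ /=; rewrite in_itv /= -ler_norml avgle.
  (* An ultrafilter converges to each of its cluster points. *)
  apply/cvg_ex; exists p => B pB.
  have [//|nB] := in_ultra_setVsetC (avg u @^-1` B) GU.
  by have [q [nBq Bq]] := hp (~` B) B nB pB; case: (nBq Bq).
have limE u (l : R) : avg u @ G --> l -> m u = l by move=> h; apply/cvg_lim.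
exists m; split.
- move=> u v c bu bv; apply: limE.
  have -> : avg (fun n => u n + c * v n) = (fun n => avg u n + c * avg v n).
    apply/funext => n; rewrite /avg big_split /= -mulr_sumr; ring.
  apply: cvgD; first exact: cvm.
  by apply: cvgMr; exact: cvm.
- move=> u M uM; have bu : bdd_seq u by exists M.
  apply: limr_le; first by apply/cvg_ex; exists (m u); exact: cvm.
  apply: (@filterS _ G _ setT); last exact: filterT.
  by move=> n _ /=; apply: le_trans (avgle u M uM n); exact: ler_norm.
- apply: limE.
  have -> : avg (fun=> 1) = fun=> 1; last exact: cvg_cst.
  by apply/funext => n; rewrite /avg sumr_const card_ord mulVf.
- move=> u bu; apply: limE.
  have [M uM] := bu.
  have -> : avg (fun n => u n.+1) = (fun n => avg u n + n.+1%:R^-1 * (u n.+1 - u 0%N)).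
    apply/funext => n; rewrite /avg big_ord_recr /= [in RHS]big_ord_recl /=.
    rewrite (eq_bigr (fun i : 'I_n => u (bump 0 i))) //.
    ring.
  rewrite -[m u]addr0; apply: cvgD; first exact: cvm.
  apply: (@cvg_trans _ ((fun n => n.+1%:R^-1 * (u n.+1 - u 0%N)) @ \oo)).
    by apply: cvg_app => A; exact: EG.
  apply/cvgrPdist_le => e e0.
  have M0 : 0 <= M by apply: le_trans (uM 0%N).
  near=> n.
  rewrite sub0r normrN normrM ger0_norm ?invr_ge0 //.
  rewrite ler_pdivrMl // (le_trans (ler_normB _ _)) //.
  rewrite (le_trans (lerD (uM _) (uM _))) // -ler_pdivrMr //.
  apply: (@le_trans _ _ n%:R); last by rewrite ler_nat.
  by near: n; exact: nbhs_infty_ger.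
Unshelve. all: by end_near.
Qed.

Definition bddc (u : nat -> R[i]) := exists M : R, forall n, normc (u n) <= M.

Lemma banach_limit : exists m : (nat -> R[i]) -> R[i],
  [/\ forall u v c, bddc u -> bddc v -> m (fun n => u n + c * v n) = m u + c * m v,
      forall u k, bddc u -> (forall n, ReC (u n) <= k) -> ReC (m u) <= k &
      forall u, bddc u -> m (fun n => u n.+1) = m u].
Proof.
have [m [mL mM m1 mS]] := banach_limit_real.
have bRe u : bddc u -> bdd_seq (fun n => ReC (u n)).
  by move=> [M h]; exists M => n; exact: le_trans (ler_abs_Re _) (h n).
have bIm u : bddc u -> bdd_seq (fun n => ImC (u n)).
  by move=> [M h]; exists M => n; exact: le_trans (ler_abs_Im _) (h n).
have bL u v c : bdd_seq u -> bdd_seq v -> bdd_seq (fun n => u n + c * v n).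
  move=> [M uM] [N vN]; exists (M + `|c| * N) => n.
  by rewrite (le_trans (ler_normD _ _)) // lerD // normrM ler_wpM2l.
have b1 : bdd_seq (fun=> 1) by exists 1 => n; rewrite normr1.
(* The bound [mM] asks for absolute values; adding [M] plus the absolute value of [k] makes the
   sequence nonnegative, so that an upper bound is enough. *)
have mmono u k : bdd_seq u -> (forall n, u n <= k) -> m u <= k.
  move=> bu uk; have [M uM] := bu.
  have := mL u _ (M + `|k|) bu b1; rewrite m1.
  have : m (fun n => u n + (M + `|k|) * 1) <= k + (M + `|k|).
    apply: mM => n; have := uM n; have := uk n; rewrite ler_norml => h1 /andP[h2 h3].
    by rewrite mulr1 ger0_norm; have := normr_ge0 k; lra.
  lra.
exists (fun u => m (fun n => ReC (u n)) +i* m (fun n => ImC (u n))); split.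
- move=> u v c bu bv; apply: complex_eqP; rewrite ?ReD ?ImD ?ReM ?ImM /=.
    have -> : (fun n => ReC (u n + c * v n)) =
      (fun n => (ReC (u n) + ReC c * ReC (v n)) + (- ImC c) * ImC (v n)).
      by apply/funext => n; rewrite ReD ReM; ring.
    rewrite !mL; [ring|exact: bRe|exact: bRe|apply: bL; exact: bRe|exact: bIm].
  have -> : (fun n => ImC (u n + c * v n)) =
    (fun n => (ImC (u n) + ReC c * ImC (v n)) + ImC c * ReC (v n)).
    by apply/funext => n; rewrite ImD ImM; ring.
  rewrite !mL; [ring|exact: bIm|exact: bIm|apply: bL; exact: bIm|exact: bRe].
- by move=> u k bu uk /=; apply: mmono => //; exact: bRe.
- by move=> u bu; rewrite (mS (fun n => ReC (u n))) ?(mS (fun n => ImC (u n))) //; [exact: bIm|exact: bRe].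
Qed.

Definition blim : (nat -> R[i]) -> R[i] := projT1 (cid banach_limit).

Lemma blimL u v c : bddc u -> bddc v ->
  blim (fun n => u n + c * v n) = blim u + c * blim v.
Proof. by have [h _ _] := projT2 (cid banach_limit); exact: h. Qed.

Lemma blim_le_Re u k : bddc u -> (forall n, ReC (u n) <= k) -> ReC (blim u) <= k.
Proof. by have [_ h _] := projT2 (cid banach_limit); exact: h. Qed.

Lemma blimS u : bddc u -> blim (fun n => u n.+1) = blim u.
Proof. by have [_ _ h] := projT2 (cid banach_limit); exact: h. Qed.

Lemma bddc_cst c : bddc (fun=> c).
Proof. by exists (normc c). Qed.

Lemma blim0 : blim (fun=> 0) = 0.
Proof.
have := blimL 1 (bddc_cst 0) (bddc_cst 0).
have -> : (fun _ : nat => 0 + 1 * 0 : R[i]) = fun=> 0 by apply/funext => n; rewrite mulr0 addr0.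
by rewrite mul1r => h; apply: (addrI (blim (fun=> 0))); rewrite addr0 -h.
Qed.

Lemma blimZ v c : bddc v -> blim (fun n => c * v n) = c * blim v.
Proof.
move=> bv; have := blimL c (bddc_cst 0) bv; rewrite blim0 add0r => <-.
by congr blim; apply/funext => n; rewrite add0r.
Qed.

Lemma blimD u v : bddc u -> bddc v -> blim (fun n => u n + v n) = blim u + blim v.
Proof.
move=> bu bv; have := blimL 1 bu bv; rewrite mul1r => <-.
by congr blim; apply/funext => n; rewrite mul1r.
Qed.

(* Rotating [blim u] onto the positive axis turns the bound on real parts into a bound on moduli. *)
Lemma blim_mod u M : (forall n, normc (u n) <= M) -> normc (blim u) <= M.
Proof.
move=> uM; have bu : bddc u by exists M.
have M0 : 0 <= M := le_trans (mod_ge0 _) (uM 0%N).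
have [->|nz] := eqVneq (blim u) 0; first by rewrite mod0.
have : ReC (blim (fun n => (blim u)^*%C * u n)) <= normc (blim u) * M.
  apply: blim_le_Re => [|n].
    by exists (normc (blim u) * M) => n; rewrite modM mod_conj ler_wpM2l // mod_ge0.
  by rewrite (le_trans (ler_Re _)) // modM mod_conj ler_wpM2l // mod_ge0.
rewrite blimZ // ReM ReJ ImJ.
have -> : ReC (blim u) * ReC (blim u) - - ImC (blim u) * ImC (blim u) = normc (blim u) ^+ 2.
  by rewrite mod_sqr; ring.
by rewrite expr2 ler_pM2l // mod_gt0.
Qed.

(** Shift invariance discards the first [N] terms, and the remaining ones are all at most [e]. *)
Lemma blim_cvg0 u : (forall e, 0 < e -> exists N, forall n, (N <= n)%N -> normc (u n) <= e) ->
  bddc u -> blim u = 0.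
Proof.
move=> u0 bu; apply/eqP; rewrite -mod_eq0; apply/eqP/le_anti; rewrite mod_ge0 andbT.
apply/ler_addgt0Pr => e e0; rewrite add0r.
have [N HN] := u0 e e0.
have -> : blim u = blim (fun n => u (N + n)%N).
  elim: N {HN} => [//|N IH]; rewrite {}IH -[LHS]blimS.
    by congr blim; apply/funext => n; rewrite addnS.
  by have [M uM] := bu; exists M.
by apply: blim_mod => n; apply: HN; rewrite leq_addr.
Qed.

Lemma blim_cst c : blim (fun=> c) = c.
Proof.
have Rle k : ReC (blim (fun=> k)) <= ReC k by apply: blim_le_Re => //; exact: bddc_cst.
have BN k : blim (fun=> - k) = - blim (fun=> k).
  rewrite -[RHS]mulN1r -(blimZ _ (bddc_cst k)).
  by congr blim; apply/funext => n; rewrite mulN1r.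
have Req k : ReC (blim (fun=> k)) = ReC k.
  by apply/le_anti; rewrite Rle /=; have := Rle (- k); rewrite BN !ReN lerN2.
apply: complex_eqP => //.
(* Multiplication by [-i] turns the imaginary part of [c] into a real part. *)
have := Req ((- 'i%C) * c).
have -> : blim (fun=> - 'i%C * c) = - 'i%C * blim (fun=> c).
  by rewrite (blimZ _ (bddc_cst c)).
by rewrite !ReM /=; lra.
Qed.

End BanachLimit.

(** * Integration along segments *)

Section SegmentIntegral.
Variable R : realType.
Implicit Types (f g : R[i] -> R[i]) (a b c d : R[i]) (t M N : R).

Definition pt a b t : R[i] := a + t%:C * (b - a).

Lemma pt0 a b : pt a b 0 = a. Proof. by rewrite /pt mul0r addr0. Qed.
Lemma pt1 a b : pt a b 1 = b. Proof. by rewrite /pt mul1r addrC subrK. Qed.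

Definition bseg f a b M := forall t, 0 <= t <= 1 -> normc (f (pt a b t)) <= M.

(** With left endpoints of dyadic subdivisions, level [n + 1] on a segment is the mean of level [n]
    on its two halves. *)
Definition rsum f a b (n : nat) : R[i] :=
  ((2 ^ n)%:R)^-1 * \sum_(k < 2 ^ n) f (pt a b (k%:R / (2 ^ n)%:R)).

(* The Banach limit makes [sint] linear on all bounded functions, continuous or not, and
   shift invariance makes it exactly additive under halving of the segment. *)
Definition sint f a b : R[i] := (b - a) * blim (rsum f a b).

Lemma pow2_gt0 n : 0 < (2 ^ n)%:R :> R. Proof. by rewrite ltr0n expn_gt0. Qed.
Lemma pow2_neq0 n : (2 ^ n)%:R != 0 :> R[i].
Proof. by rewrite pnatr_eq0 -lt0n expn_gt0. Qed.

Lemma dyadic01 n (k : 'I_(2 ^ n)) : 0 <= (k%:R / (2 ^ n)%:R : R) <= 1.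
Proof.
rewrite divr_ge0 //= ler_pdivrMr ?pow2_gt0 // mul1r ler_nat; exact: ltnW.
Qed.

Lemma natC (n : nat) : n%:R = (n%:R : R)%:C :> R[i].
Proof. by rewrite rmorph_nat. Qed.

Lemma mod_nat (n : nat) : normc (n%:R : R[i]) = n%:R.
Proof. by rewrite natC mod_real ger0_norm. Qed.

Lemma rsum_mod f a b M n : bseg f a b M -> normc (rsum f a b n) <= M.
Proof.
move=> fM; rewrite /rsum modM modV mod_nat ler_pdivrMl ?pow2_gt0 //.
rewrite (le_trans (mod_sum _ _ _)) //.
apply: (@le_trans _ _ (\sum_(k < 2 ^ n) M)).
  by apply: ler_sum => k _; apply: fM; exact: dyadic01.
by rewrite sumr_const card_ord mulr_natl.
Qed.

Lemma rsum_bddc f a b M : bseg f a b M -> bddc (rsum f a b).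
Proof. by move=> fM; exists M => n; exact: rsum_mod. Qed.

Lemma sint_mod f a b M : bseg f a b M -> normc (sint f a b) <= normc (b - a) * M.
Proof.
move=> fM; rewrite /sint modM ler_wpM2l ?mod_ge0 //.
by apply: blim_mod => n; exact: rsum_mod.
Qed.

Lemma sint_eq f g a b : (forall t, 0 <= t <= 1 -> f (pt a b t) = g (pt a b t)) ->
  sint f a b = sint g a b.
Proof.
move=> fg; congr (_ * blim _); apply/funext => n; congr (_ * _).
by apply: eq_bigr => k _; apply: fg; exact: dyadic01.
Qed.

Lemma bsegL f g a b M N c : bseg f a b M -> bseg g a b N ->
  bseg (fun z => f z + c * g z) a b (M + normc c * N).
Proof.
move=> fM gN t t01; rewrite (le_trans (modD _ _)) // lerD ?fM //.
by rewrite modM ler_wpM2l ?mod_ge0 ?gN.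
Qed.

Lemma sintL f g a b M N c : bseg f a b M -> bseg g a b N ->
  sint (fun z => f z + c * g z) a b = sint f a b + c * sint g a b.
Proof.
move=> fM gN; rewrite /sint.
have -> : rsum (fun z => f z + c * g z) a b = fun n => rsum f a b n + c * rsum g a b n.
  apply/funext => n; rewrite /rsum big_split /= -mulr_sumr; ring.
rewrite blimL; [ring|exact: rsum_bddc fM|exact: rsum_bddc gN].
Qed.

Lemma bseg_cst c a b : bseg (fun=> c) a b (normc c).
Proof. by []. Qed.

Lemma sint0 a b : sint (fun=> 0) a b = 0.
Proof.
apply/eqP; rewrite -mod_eq0; apply/eqP/le_anti; rewrite mod_ge0 andbT.
by rewrite (le_trans (sint_mod (@bseg_cst 0 a b))) // mod0 mulr0.
Qed.

Lemma sintZ f a b M c : bseg f a b M -> sint (fun z => c * f z) a b = c * sint f a b.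
Proof.
move=> fM; have := sintL c (@bseg_cst 0 a b) fM; rewrite sint0 add0r => <-.
by apply: sint_eq => t _; rewrite add0r.
Qed.

Lemma sintB f g a b M N : bseg f a b M -> bseg g a b N ->
  sint (fun z => f z - g z) a b = sint f a b - sint g a b.
Proof.
move=> fM gN; have := sintL (-1) fM gN; rewrite mulN1r => <-.
by apply: sint_eq => t _; rewrite mulN1r.
Qed.

Lemma sint_affine f e c a b : sint f (c + e * a) (c + e * b) =
  e * sint (fun z => f (c + e * z)) a b.
Proof.
rewrite /sint mulrA; congr (_ * blim _); first ring.
apply/funext => n; congr (_ * _); apply: eq_bigr => k _; congr f; rewrite /pt; ring.
Qed.

(** Reversal turns left sums into right sums; the two differ by [(f b - f a) / 2 ^ n], a null
    sequence, which the Banach limit sends to 0. *)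
Lemma rsum_rev f a b M : bseg f a b M -> blim (rsum f b a) = blim (rsum f a b).
Proof.
move=> fM.
have -> : rsum f b a = fun n => rsum f a b n + 1 * (((2 ^ n)%:R)^-1 * (f b - f a)).
  apply/funext => n; rewrite /rsum mul1r -mulrDr; congr (_ * _).
  pose G (k : nat) := f (pt a b (k%:R / (2 ^ n)%:R)).
  have -> : f b - f a = \sum_(k < 2 ^ n) (G k.+1 - G k).
    rewrite -(big_mkord xpredT (fun k => G k.+1 - G k)) telescope_sumr //.
    by rewrite /G divff ?pt1 ?mul0r ?pt0 // gt_eqF ?pow2_gt0.
  rewrite -big_split /= (reindex_inj rev_ord_inj) /=; apply: eq_bigr => k _.
  rewrite /G addrC subrK; congr f; rewrite /pt.
  rewrite natrB ?ltn_ord // !rmorphM rmorphB /= !rmorph_nat fmorphV rmorph_nat.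
  by field; exact: pow2_neq0.
have hb t : 0 <= t <= 1 -> normc (f (pt a b t)) <= M by exact: fM.
have fa : normc (f a) <= M by rewrite -(pt0 a b); apply: hb; rewrite lexx ler01.
have fb : normc (f b) <= M by rewrite -(pt1 a b); apply: hb; rewrite lexx ler01.
have M0 := le_trans (mod_ge0 _) fa.
have hn n : normc (((2 ^ n)%:R)^-1 * (f b - f a)) <= (2 ^ n)%:R^-1 * (M + M).
  rewrite modM modV mod_nat ler_wpM2l ?invr_ge0 //.
  by rewrite (le_trans (modB _ _)) // lerD.
have b2 : bddc (fun n => ((2 ^ n)%:R)^-1 * (f b - f a)).
  exists (M + M) => n; rewrite (le_trans (hn n)) // ler_piMl ?addr_ge0 //.
  by rewrite invf_le1 ?pow2_gt0 // ler1n expn_gt0.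
rewrite blimL //; last exact: rsum_bddc fM.
rewrite (blim_cvg0 _ b2) ?mulr0 ?addr0 // => e e0.
exists (Num.truncn ((M + M) / e)).+1 => n nN; rewrite (le_trans (hn n)) //.
rewrite mulrC ler_pdivrMr ?pow2_gt0 // mulrC -ler_pdivrMr //.
apply: le_trans (ltW (truncnS_gt _)) _.
by rewrite ler_nat (leq_trans nN) // ltnW // ltn_expl.
Qed.

Lemma sint_rev f a b M : bseg f a b M -> sint f b a = - sint f a b.
Proof. by move=> fM; rewrite /sint (rsum_rev fM); ring. Qed.

Lemma sint_cst c a b : sint (fun=> c) a b = c * (b - a).
Proof.
rewrite /sint mulrC; congr (_ * _); rewrite -[RHS]blim_cst; congr blim.
apply/funext => n; rewrite /rsum sumr_const card_ord -[X in _ * X]mulr_natl mulKf //; exact: pow2_neq0.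
Qed.

Lemma bseg_id a b : bseg id a b (normc a + normc (b - a)).
Proof.
move=> t /andP[t0 t1]; rewrite (le_trans (modD _ _)) // lerD // modM mod_real.
by rewrite ler_piMl ?mod_ge0 // ger0_norm.
Qed.

(** Sample points at equal parameters on the segment and on its reverse add up to [a + b], and both
    directions have the same Banach limit. *)
Lemma sint_id a b : sint id a b = (b ^+ 2 - a ^+ 2) / 2%:R.
Proof.
have h : blim (rsum id a b) + blim (rsum id b a) = a + b.
  rewrite -blimD; try exact: (rsum_bddc (@bseg_id _ _)).
  rewrite -[RHS]blim_cst; congr blim; apply/funext => n.
  rewrite /rsum -mulrDr -big_split /= (eq_bigr (fun=> a + b)); last first.
    by move=> k _; rewrite /pt; ring.
  rewrite sumr_const card_ord -[X in _ * X]mulr_natl mulKf //; exact: pow2_neq0.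
rewrite (rsum_rev (@bseg_id a b)) in h.
rewrite /sint; have -> : blim (rsum id a b) = (a + b) / 2%:R.
  by rewrite -h; field.
by field.
Qed.

Lemma sint_affine_fun c d a b : sint (fun z => c + d * z) a b =
  c * (b - a) + d * ((b ^+ 2 - a ^+ 2) / 2%:R).
Proof.
by rewrite (sintL d (@bseg_cst c a b) (@bseg_id a b)) sint_cst sint_id.
Qed.

Definition mid a b : R[i] := (a + b) / 2%:R.

Lemma sint_half f a b M : bseg f a b M ->
  sint f a b = sint f a (mid a b) + sint f (mid a b) b.
Proof.
move=> fM.
have b1 : bseg f a (mid a b) M.
  move=> t /andP[t0 t1].
  have -> : pt a (mid a b) t = pt a b (t / 2).
    by rewrite /pt /mid rmorphM fmorphV rmorph_nat; field.
  by apply: fM; lra.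
have b2 : bseg f (mid a b) b M.
  move=> t /andP[t0 t1].
  have -> : pt (mid a b) b t = pt a b ((t + 1) / 2).
    by rewrite /pt /mid rmorphM fmorphV rmorph_nat rmorphD rmorph1; field.
  by apply: fM; lra.
rewrite /sint -(blimS (rsum_bddc fM)).
have -> : (fun n => rsum f a b n.+1) =
   (fun n => 2%:R^-1 * rsum f a (mid a b) n + 2%:R^-1 * rsum f (mid a b) b n).
  apply/funext => n; rewrite /rsum expnS mul2n -addnn big_split_ord /= !mulrDr.
  have e2 : ((2 ^ n + 2 ^ n)%:R : R[i])^-1 = 2%:R^-1 * (2 ^ n)%:R^-1.
    by rewrite natrD; field; rewrite pow2_neq0 -mulr2n mulrn_eq0 pow2_neq0.
  rewrite e2 !mulrA; congr (_ * _ + _ * _); apply: eq_bigr => k _; congr f;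
    rewrite /pt /mid !rmorphM !fmorphV !rmorph_nat ?natrD; field;
    by rewrite pow2_neq0 -mulr2n mulrn_eq0 pow2_neq0.
have bZ u : bddc u -> bddc (fun n => 2%:R^-1 * u n : R[i]).
  move=> [K uK]; exists (normc (2%:R^-1 : R[i]) * K) => n.
  by rewrite modM ler_wpM2l ?mod_ge0.
rewrite blimD; try by apply: bZ; apply: rsum_bddc; eassumption.
rewrite !blimZ; try by apply: rsum_bddc; eassumption.
by rewrite /mid; field.
Qed.

End SegmentIntegral.

(** * Goursat's lemma *)

Section Goursat.
Variable R : realType.

Definition cdiff (f : R[i] -> R[i]) (z : R[i]) :=
  exists d : R[i], forall e : R, 0 < e -> exists2 r : R, 0 < r &
    forall w : R[i], normc (w - z) < r ->
      normc (f w - f z - d * (w - z)) <= e * normc (w - z).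

Definition cvx (U : set R[i]) := forall a b (t : R), U a -> U b -> 0 <= t <= 1 -> U (pt a b t).

Lemma pow2_archi (e K : R) : 0 < e -> exists n, K * 2^-1 ^+ n < e.
Proof.
move=> e0; exists (Num.truncn (`|K| / e)).+1.
rewrite exprVn ltr_pdivrMr ?exprn_gt0 // mulrC -ltr_pdivrMr //.
apply: (@le_lt_trans _ _ (`|K| / e)); first by rewrite ler_wpM2r ?invr_ge0 ?ler_norm // ltW.
apply: lt_trans (truncnS_gt _) _.
by rewrite -natrX ltr_nat ltn_expl.
Qed.

(** The intervals of radius [2^-1 ^+ n] about [x n] are nested; the supremum of their left ends lies
    in all of them. *)
Lemma nested_limit (x : nat -> R) : (forall n, `|x n.+1 - x n| <= 2^-1 ^+ n.+1) ->
  exists l, forall n, `|x n - l| <= 2^-1 ^+ n.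
Proof.
move=> H.
have Hn n : - (2^-1 ^+ n / 2) <= x n.+1 - x n <= 2^-1 ^+ n / 2.
  by rewrite -ler_norml (le_trans (H n)) // exprSr.
pose lo n := x n - 2^-1 ^+ n; pose hi n := x n + 2^-1 ^+ n.
have loS n : lo n <= lo n.+1 by have := Hn n; rewrite /lo exprSr => /andP[]; lra.
have hiS n : hi n.+1 <= hi n by have := Hn n; rewrite /hi exprSr => /andP[]; lra.
have lohi n : lo n <= hi n.
  by have : 0 <= 2^-1 ^+ n :> R by []; rewrite /lo /hi; lra.
have lom n k : lo n <= lo (n + k)%N.
  by elim: k => [|k IH]; rewrite ?addn0 // addnS (le_trans IH).
have him n k : hi (n + k)%N <= hi n.
  by elim: k => [|k IH]; rewrite ?addn0 // addnS (le_trans _ IH).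
have cross n m : lo n <= hi m.
  rewrite (le_trans (lom n m)) // (le_trans (lohi _)) // addnC; exact: him.
have ne : range lo !=set0 by exists (lo 0%N), 0%N.
exists (sup (range lo)) => n.
have h1 : lo n <= sup (range lo).
  by apply: ub_le_sup; [exists (hi 0%N) => _ [m _ <-]|exists n].
have h2 : sup (range lo) <= hi n by apply: ge_sup => // _ [m _ <-].
by rewrite ler_norml; move: h1 h2; rewrite /lo /hi; lra.
Qed.

Lemma le_pow2_le0 (r K : R) : (forall n, r <= K * 2^-1 ^+ n) -> r <= 0.
Proof.
move=> H; rewrite leNgt; apply/negP => r0.
by have [n] := pow2_archi K r0; rewrite ltNge H.
Qed.

(** [U] is convex but need not be closed, so the limit of the nested triangles is located by its
    coordinates: they stay in the closed coordinate simplex, and convexity then puts the limit in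
    [U]. *)
Lemma simplex_limit (x0 y0 : R) : (forall n, exists x y, [/\ 0 <= x, 0 <= y & x + y <= 1] /\
    `|x - x0| <= 2^-1 ^+ n /\ `|y - y0| <= 2^-1 ^+ n) ->
  [/\ 0 <= x0, 0 <= y0 & x0 + y0 <= 1].
Proof.
move=> H; rewrite -(oppr_le0 x0) -(oppr_le0 y0) -(subr_le0 _ (x0 + y0)).
split; apply: (@le_pow2_le0 _ 2) => n; have [x [y [[x1 y1 xy1] []]]] := H n;
  have : 0 <= 2^-1 ^+ n :> R by []; move: (2^-1 ^+ n) => q; rewrite !ler_norml => q0 /andP[h1 h2] /andP[h3 h4]; lra.
Qed.

Lemma shift_bound (k l w s q : R) : `|k| + `|l| <= 1 -> `|w| <= q -> `|s| = q ->
  `|w + k * s| <= 2 * q.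
Proof.
move=> kl wq sq; rewrite (le_trans (ler_normD _ _)) // normrM sq.
have k1 : `|k| <= 1 by have := normr_ge0 l; lra.
have q0 : 0 <= q by rewrite -sq.
have : `|k| * q <= q by apply: ler_piMl.
lra.
Qed.

Variables (U : set R[i]) (f : R[i] -> R[i]) (M : R).
Hypotheses (Ucvx : cvx U) (fM : forall z, U z -> normc (f z) <= M)
  (fd : forall z, U z -> cdiff f z).

Lemma cvx_bseg a b : U a -> U b -> bseg f a b M.
Proof. by move=> Ua Ub t t01; apply: fM; exact: Ucvx. Qed.

Lemma cvx_simplex a b c (x y : R) : U a -> U b -> U c -> 0 <= x -> 0 <= y -> x + y <= 1 ->
  U (a + x%:C * (b - a) + y%:C * (c - a)).
Proof.
move=> Ua Ub Uc x0 y0 xy.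
have [s0|s0] := eqVneq (x + y) 0.
  have [-> ->] : x = 0 /\ y = 0 by split; lra.
  by rewrite !mul0r !addr0.
have sp : 0 < x + y by rewrite lt_def s0 addr_ge0.
have -> : a + x%:C * (b - a) + y%:C * (c - a) = pt a (pt b c (y / (x + y))) (x + y).
  rewrite /pt !rmorphM fmorphV rmorphD /=.
  have : x%:C + y%:C != 0 by rewrite -rmorphD fmorph_eq0.
  by move=> h; field.
apply: Ucvx => //; last by rewrite addr_ge0.
by apply: Ucvx => //; rewrite divr_ge0 ?addr_ge0 //= ler_pdivrMr // mul1r; lra.
Qed.

Let tri a b c := sint f a b + sint f b c + sint f c a.

Lemma tri_split a b c : U a -> U b -> U c ->
  tri a b c = tri a (mid a b) (mid a c) + tri (mid a b) b (mid b c) +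
    tri (mid a c) (mid b c) c + tri (mid b c) (mid a c) (mid a b).
Proof.
move=> Ua Ub Uc.
have Um u v : U u -> U v -> U (mid u v).
  move=> Uu Uv; have -> : mid u v = pt u v (1 / 2).
    by rewrite /pt /mid rmorphM fmorphV rmorph_nat rmorph1; field.
  by apply: Ucvx => //; lra.
have rv u v : U u -> U v -> sint f u v = - sint f v u.
  by move=> Uu Uv; rewrite (sint_rev (cvx_bseg Uv Uu)).
have [U1 U2 U3] := And3 (Um _ _ Ua Ub) (Um _ _ Ub Uc) (Um _ _ Ua Uc).
have midC (u v : R[i]) : mid u v = mid v u by rewrite /mid addrC.
rewrite /tri (sint_half (cvx_bseg Ua Ub)) (sint_half (cvx_bseg Ub Uc))
  (sint_half (cvx_bseg Uc Ua)) (midC c a).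
rewrite (rv (mid a b) (mid a c)) // (rv (mid b c) (mid a b)) // (rv (mid b c) (mid a c)) //.
ring.
Qed.

Section Subdivision.
Variables (a b c : R[i]).
Hypotheses (Ua : U a) (Ub : U b) (Uc : U c).
Let u := b - a.
Let v := c - a.

Let vtx (x y : R) : R[i] := a + x%:C * u + y%:C * v.
Let E (q : R * R * R) := let: (x, y, s) := q in tri (vtx x y) (vtx (x + s) y) (vtx x (y + s)).
Let ok (q : R * R * R) := let: (x, y, s) := q in
  [/\ 0 <= x, 0 <= y & x + y <= 1] /\ [/\ 0 <= x + s, 0 <= y + s & x + y + s <= 1].

Let okU x y : 0 <= x -> 0 <= y -> x + y <= 1 -> U (vtx x y).
Proof. exact: cvx_simplex. Qed.

(* [(x, y, s)] is the triangle [p, p + s u, p + s v] with [p = a + x u + y v]; the middle one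
   of the four subtriangles is reflected, so [s] may be negative. *)
Let child q : ok q -> exists q', [/\ ok q', `|q'.2| = `|q.2| / 2,
  `|q'.1.1 - q.1.1| <= `|q.2| / 2, `|q'.1.2 - q.1.2| <= `|q.2| / 2 &
   normc (E q) <= 4 * normc (E q')].
Proof.
case: q => [[x y] s] okq; have [[x0 y0 xy] [x0' y0' xy']] := okq.
have hE : E (x, y, s) = E (x, y, s / 2) + E (x + s / 2, y, s / 2) + E (x, y + s / 2, s / 2)
   + E (x + s / 2, y + s / 2, - (s / 2)).
  rewrite /E tri_split; try by apply: okU; lra.
  have m1 : mid (vtx x y) (vtx (x + s) y) = vtx (x + s / 2) y.
    by rewrite /mid /vtx !rmorphD rmorphM fmorphV rmorph_nat; field.
  have m2 : mid (vtx x y) (vtx x (y + s)) = vtx x (y + s / 2).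
    by rewrite /mid /vtx !rmorphD rmorphM fmorphV rmorph_nat; field.
  have m3 : mid (vtx (x + s) y) (vtx x (y + s)) = vtx (x + s / 2) (y + s / 2).
    by rewrite /mid /vtx !rmorphD rmorphM fmorphV rmorph_nat; field.
  have e1 (k : R) : k + s / 2 + s / 2 = k + s by field.
  have e2 (k : R) : k + s / 2 + - (s / 2) = k by rewrite addrK.
  by rewrite m1 m2 m3 !e1 !e2.
have s2 : `|s / 2| = `|s| / 2 by rewrite normrM [X in _ * X]ger0_norm.
have s2' : `|s / 2| <= `|s| / 2 by rewrite s2 lexx.
have z2 : `|(0 : R)| <= `|s| / 2 by rewrite normr0 divr_ge0.
have : [\/ normc (E (x, y, s)) <= 4 * normc (E (x, y, s / 2)),
  normc (E (x, y, s)) <= 4 * normc (E (x + s / 2, y, s / 2)),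
  normc (E (x, y, s)) <= 4 * normc (E (x, y + s / 2, s / 2)) |
  normc (E (x, y, s)) <= 4 * normc (E (x + s / 2, y + s / 2, - (s / 2)))].
  have hl : normc (E (x, y, s)) <= normc (E (x, y, s / 2)) + normc (E (x + s / 2, y, s / 2)) +
      normc (E (x, y + s / 2, s / 2)) + normc (E (x + s / 2, y + s / 2, - (s / 2))).
    rewrite hE (le_trans (modD _ _)) // lerD2r (le_trans (modD _ _)) // lerD2r.
    by rewrite (le_trans (modD _ _)).
  case: (lerP (normc (E (x, y, s))) (4 * normc (E (x, y, s / 2)))) => [?|h1]; first by constructor 1.
  case: (lerP (normc (E (x, y, s))) (4 * normc (E (x + s / 2, y, s / 2)))) => [?|h2]; first by constructor 2.
  case: (lerP (normc (E (x, y, s))) (4 * normc (E (x, y + s / 2, s / 2)))) => [?|h3]; first by constructor 3.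
  by constructor 4; lra.
case=> h.
- exists (x, y, s / 2); split => //=; rewrite ?subrr //.
  by split; split; lra.
- exists (x + s / 2, y, s / 2); split => //=; rewrite ?subrr // ?(addrC x) ?addrK //.
  by split; split; lra.
- exists (x, y + s / 2, s / 2); split => //=; rewrite ?subrr // ?(addrC y) ?addrK //.
  by split; split; lra.
- exists (x + s / 2, y + s / 2, - (s / 2)); split => //=; rewrite ?normrN ?(addrC x) ?(addrC y) ?addrK //.
  by split; split; lra.
Qed.

Lemma goursat_tri : tri a b c = 0.
Proof.
have /choice [next nextP] : forall q, exists q', ok q -> [/\ ok q', `|q'.2| = `|q.2| / 2,
  `|q'.1.1 - q.1.1| <= `|q.2| / 2, `|q'.1.2 - q.1.2| <= `|q.2| / 2 &
   normc (E q) <= 4 * normc (E q')].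
  move=> q; have [okq|nq] := pselect (ok q); last by exists q.
  by have [q' h] := child okq; exists q'.
pose st n := iter n next (0, 0, 1).
have st_ok n : ok (st n).
  elim: n => [|n IH]; first by rewrite /st /=; split; split; lra.
  by have [] := nextP _ IH.
have st_s n : `|(st n).2| = 2^-1 ^+ n.
  elim: n => [|n IH]; first by rewrite /st /= normr1 expr0.
  by have [_ -> _ _ _] := nextP _ (st_ok n); rewrite IH exprSr.
have st_E n : normc (E (0, 0, 1)) <= 4 ^+ n * normc (E (st n)).
  elim: n => [|n IH]; first by rewrite expr0 mul1r.
  rewrite (le_trans IH) // exprSr -mulrA ler_wpM2l ?exprn_ge0 //.
  by have [_ _ _ _] := nextP _ (st_ok n).
have [x0 x0P] : exists l, forall n, `|(st n).1.1 - l| <= 2^-1 ^+ n.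
  apply: nested_limit => n; have [_ _ h _ _] := nextP _ (st_ok n).
  by rewrite exprSr -st_s.
have [y0 y0P] : exists l, forall n, `|(st n).1.2 - l| <= 2^-1 ^+ n.
  apply: nested_limit => n; have [_ _ _ h _] := nextP _ (st_ok n).
  by rewrite exprSr -st_s.
have Uz : U (vtx x0 y0).
  have [] := @simplex_limit x0 y0; last exact: okU.
  move=> n; exists (st n).1.1, (st n).1.2; rewrite x0P y0P.
  by have := st_ok n; case: (st n) => [[x y] s] [[]].
have [d dP] := fd Uz.
have EV x y s : E (x, y, s) = tri (vtx x y) (vtx (x + s) y) (vtx x (y + s)) by [].
have -> : tri a b c = E (0, 0, 1).
  by rewrite EV /vtx !add0r !mul0r !addr0 !mul1r /u /v addrC subrK addrC subrK.
set z0 := vtx x0 y0 in Uz d dP *.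
pose D := normc u + normc v.
have D0 : 0 <= D by rewrite addr_ge0 ?mod_ge0.
apply/eqP; rewrite -mod_eq0; apply/eqP/le_anti; rewrite mod_ge0 andbT.
apply/ler_addgt0Pr => e e0; rewrite add0r.
(* Three edges contribute at most [2 * e' * D ^+ 2 * q ^+ 2] each, and [4 ^+ n * q ^+ 2 = 1]. The
   [+ 1] avoids a division by zero for a degenerate triangle. *)
pose e' := e / (6 * D ^+ 2 + 1).
have den0 : 0 < 6 * D ^+ 2 + 1 by rewrite ltr_wpDl ?mulr_ge0 ?exprn_ge0.
have e'0 : 0 < e' by exact: divr_gt0.
have [r r0 rP] := dP e' e'0.
have [n nP] := pow2_archi (2 * D) r0.
apply: (le_trans (st_E n)).
have := st_ok n; have := st_s n; have := x0P n; have := y0P n.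
case: (st n) => [[x y] s] /= hy hx hs okn.
set q := 2^-1 ^+ n in nP hy hx hs *.
have q0 : 0 <= q by rewrite exprn_ge0.
have vtx_near (i j : R) : `|i| + `|j| <= 1 -> normc (vtx (x + i * s) (y + j * s) - z0) <= 2 * D * q.
  move=> ij.
  have -> : vtx (x + i * s) (y + j * s) - z0 =
     ((x - x0) + i * s)%:C * u + ((y - y0) + j * s)%:C * v.
    by rewrite /z0 /vtx !(rmorphD, rmorphN, rmorphM) /=; ring.
  rewrite (le_trans (modD _ _)) // !modM !mod_real.
  have h1 := shift_bound ij hx hs.
  have h2 : `|y - y0 + j * s| <= 2 * q by apply: shift_bound hy hs; rewrite addrC; exact: ij.
  have := ler_wpM2r (mod_ge0 u) h1; have := ler_wpM2r (mod_ge0 v) h2.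
  by rewrite /D; lra.
(* On an edge [f] is compared with its affine approximation at [z0], whose integral is explicit;
   around the triangle these explicit integrals cancel ([A0]). *)
have edge V W : U V -> U W -> normc (V - z0) <= 2 * D * q -> normc (W - z0) <= 2 * D * q ->
   normc (W - V) <= D * q ->
   normc (sint f V W - (f z0 * (W - V) + d * ((W - z0) ^+ 2 - (V - z0) ^+ 2) / 2%:R)) <=
     2 * e' * D ^+ 2 * q ^+ 2.
  move=> UV UW nV nW nVW.
  have -> : f z0 * (W - V) + d * ((W - z0) ^+ 2 - (V - z0) ^+ 2) / 2%:R =
    sint (fun z => (f z0 - d * z0) + d * z) V W by rewrite sint_affine_fun; field.
  have bA : bseg (fun z => (f z0 - d * z0) + d * z) V W
     (normc (f z0 - d * z0) + normc d * (normc V + normc (W - V))).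
    by apply: bsegL => //; exact: bseg_id.
  rewrite -(sintB (cvx_bseg UV UW) bA).
  apply: (@le_trans _ _ (normc (W - V) * (e' * (2 * D * q)))); last first.
    have e2 : 0 <= e' * (2 * D * q) by apply: mulr_ge0; [exact: ltW|rewrite !mulr_ge0].
    by rewrite (le_trans (ler_wpM2r e2 nVW)) //; lra.
  apply: sint_mod => t /andP[t0 t1].
  have nz : normc (pt V W t - z0) <= 2 * D * q.
    have -> : pt V W t - z0 = (1 - t)%:C * (V - z0) + t%:C * (W - z0).
      by rewrite /pt rmorphB rmorph1; ring.
    rewrite (le_trans (modD _ _)) // !modM !mod_real !ger0_norm ?subr_ge0 //.
    by have := ler_wpM2l t0 nW; have := ler_wpM2l (_ : 0 <= 1 - t) nV; rewrite ?subr_ge0 => /(_ t1); lra.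
  have -> : f (pt V W t) - (f z0 - d * z0 + d * pt V W t) =
    f (pt V W t) - f z0 - d * (pt V W t - z0) by ring.
  apply: le_trans (rP _ (le_lt_trans nz nP)) _.
  by rewrite ler_wpM2l // ltW.
have [[h1 h2 h3] [h4 h5 h6]] := okn.
have U1 : U (vtx x y) by exact: okU.
have U2 : U (vtx (x + s) y) by apply: okU => //; lra.
have U3 : U (vtx x (y + s)) by apply: okU => //; lra.
have n1 : normc (vtx x y - z0) <= 2 * D * q.
  by have := @vtx_near 0 0; rewrite !mul0r !addr0 normr0 addr0; apply.
have n2 : normc (vtx (x + s) y - z0) <= 2 * D * q.
  by have := @vtx_near 1 0; rewrite mul0r mul1r addr0 normr0 normr1 addr0; apply.
have n3 : normc (vtx x (y + s) - z0) <= 2 * D * q.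
  by have := @vtx_near 0 1; rewrite mul0r mul1r addr0 normr0 normr1 add0r; apply.
have k1 : normc (vtx (x + s) y - vtx x y) <= D * q.
  have -> : vtx (x + s) y - vtx x y = s%:C * u by rewrite /vtx rmorphD; ring.
  by rewrite modM mod_real hs mulrC ler_wpM2r // lerDl mod_ge0.
have k2 : normc (vtx x (y + s) - vtx (x + s) y) <= D * q.
  have -> : vtx x (y + s) - vtx (x + s) y = s%:C * (v - u) by rewrite /vtx !rmorphD; ring.
  by rewrite modM mod_real hs mulrC ler_wpM2r // (le_trans (modB _ _)) // addrC.
have k3 : normc (vtx x y - vtx x (y + s)) <= D * q.
  have -> : vtx x y - vtx x (y + s) = s%:C * (- v) by rewrite /vtx !rmorphD; ring.
  by rewrite modM mod_real modN hs mulrC ler_wpM2r // lerDr mod_ge0.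
have := edge _ _ U1 U2 n1 n2 k1.
have := edge _ _ U2 U3 n2 n3 k2.
have := edge _ _ U3 U1 n3 n1 k3.
set A1 := f z0 * _ + _; set A2 := f z0 * _ + _; set A3 := f z0 * _ + _ => j1 j2 j3.
have A0 : A1 + A2 + A3 = 0 by rewrite /A1 /A2 /A3; field.
rewrite ?EV; set T := tri _ _ _.
have hT : normc T <= 6 * e' * D ^+ 2 * q ^+ 2.
  have -> : T = (sint f (vtx x (y + s)) (vtx x y) - A1) + (sint f (vtx (x + s) y) (vtx x (y + s)) - A2)
     + (sint f (vtx x y) (vtx (x + s) y) - A3).
    rewrite -[LHS]subr0 -A0 /T /tri; ring.
  rewrite (le_trans (modD _ _)) //.
  have := modD (sint f (vtx x (y + s)) (vtx x y) - A1) (sint f (vtx (x + s) y) (vtx x (y + s)) - A2).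
  lra.
rewrite (le_trans (ler_wpM2l _ hT)) ?exprn_ge0 //.
have q4 : 4 ^+ n * q ^+ 2 = 1.
  by rewrite /q -exprM mulnC exprM -exprMn (_ : 4 * 2^-1 ^+ 2 = 1 :> R) ?expr1n //; field.
have -> : 4 ^+ n * (6 * e' * D ^+ 2 * q ^+ 2) = 6 * e' * D ^+ 2 * (4 ^+ n * q ^+ 2) by ring.
rewrite q4 mulr1 /e'.
have -> : 6 * (e / (6 * D ^+ 2 + 1)) * D ^+ 2 = e * (6 * D ^+ 2) / (6 * D ^+ 2 + 1).
  by field; rewrite gt_eqF.
by rewrite ler_pdivrMr // ler_wpM2l ?ltW //; lra.
Qed.

End Subdivision.

Theorem goursat a b c : U a -> U b -> U c -> sint f a b + sint f b c = sint f a c.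
Proof.
move=> Ua Ub Uc; have := goursat_tri Ua Ub Uc.
by rewrite /tri (sint_rev (cvx_bseg Ua Uc)) => /eqP; rewrite subr_eq0 => /eqP.
Qed.

End Goursat.

(** * Cauchy's formula on polygons *)

Section ComplexDifferentiability.
Variable R : realType.
Implicit Types (f g : R[i] -> R[i]) (z c : R[i]).

Lemma cdiff_differentiable f z :
  cdiff f z <-> differentiable (f : (R[i])^o -> (R[i])^o) (z : (R[i])^o).
Proof. by split => /differentiable_modP. Qed.

Lemma cdiffM f g z : cdiff f z -> cdiff g z -> cdiff (fun x => f x * g x) z.
Proof.
move=> /cdiff_differentiable df /cdiff_differentiable dg; apply/cdiff_differentiable.
exact: (@differentiableM R[i] (R[i])^o f g z df dg).
Qed.

Lemma cdiffD f g z : cdiff f z -> cdiff g z -> cdiff (fun x => f x + g x) z.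
Proof.
move=> /cdiff_differentiable df /cdiff_differentiable dg; apply/cdiff_differentiable.
exact: differentiableD df dg.
Qed.

Lemma cdiff_inv f z : cdiff f z -> f z != 0 -> cdiff (fun x => (f x)^-1) z.
Proof.
move=> /cdiff_differentiable df f0; apply/cdiff_differentiable.
exact: (@differentiableV R[i] (R[i])^o f z df f0).
Qed.

Lemma cdiff_cst c z : cdiff (fun=> c) z.
Proof. by apply/cdiff_differentiable; exact: differentiable_cst. Qed.

Lemma cdiff_id z : cdiff id z.
Proof.
exists 1 => e e0; exists 1 => // w _; rewrite mul1r subrr mod0.
by rewrite mulr_ge0 ?mod_ge0 // ltW.
Qed.

Lemma cdiff_affine c d z : cdiff (fun x => c + d * x) z.
Proof. by apply: cdiffD; [exact: cdiff_cst|apply: cdiffM; [exact: cdiff_cst|exact: cdiff_id]]. Qed.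

Lemma cdiff_eq f g z : (forall w, f w = g w) -> cdiff f z -> cdiff g z.
Proof. by move=> /funext ->. Qed.

Lemma cdiff_subr c z : cdiff (fun x => x - c) z.
Proof. by apply: cdiff_eq (cdiff_affine (- c) 1 z) => w; ring. Qed.

Lemma cdiff_comp f g z : cdiff f z -> cdiff g (f z) -> cdiff (fun x => g (f x)) z.
Proof.
move=> /cdiff_differentiable df /cdiff_differentiable dg; apply/cdiff_differentiable.
exact: (@differentiable_comp _ _ _ _ (f : (R[i])^o -> (R[i])^o) (g : (R[i])^o -> (R[i])^o) _ df dg).
Qed.

Lemma cdiffX f z n : cdiff f z -> cdiff (fun x => f x ^+ n) z.
Proof.
move=> df; elim: n => [|n IH]; first exact: cdiff_cst.
by apply: cdiff_eq (cdiffM df IH) => w; rewrite exprS.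
Qed.

Lemma cdiff_continuous f z (e : R) : cdiff f z -> 0 < e ->
  exists2 r : R, 0 < r & forall w, normc (w - z) < r -> normc (f w - f z) <= e.
Proof.
move=> [d H] e0; have [r r0 rP] := H 1 ltr01.
have k0 : 0 < 1 + normc d by rewrite ltr_pwDl ?mod_ge0.
exists (Num.min r (e / (1 + normc d))); first by rewrite lt_min r0 divr_gt0.
move=> w; rewrite lt_min => /andP[wr we].
have -> : f w - f z = (f w - f z - d * (w - z)) + d * (w - z) by ring.
rewrite (le_trans (modD _ _)) // modM.
rewrite (le_trans (lerD (rP w wr) (lexx _))) // -mulrDl mulrC -ler_pdivlMr //.
exact: ltW.
Qed.

End ComplexDifferentiability.

Section Polygon.
Variable R : realType.
Implicit Types (p q z nu : R[i]) (eta : R).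

Lemma goursat4 (U : set R[i]) f M p q p' q' : cvx U ->
  (forall z, U z -> normc (f z) <= M) -> (forall z, U z -> cdiff f z) ->
  U p -> U q -> U p' -> U q' ->
  sint f p q = sint f p' q' + (sint f p p' - sint f q q').
Proof.
move=> cU fM fd Up Uq Up' Uq'.
have h1 := goursat cU fM fd Up Uq Uq'; have h2 := goursat cU fM fd Up Up' Uq'.
have -> : sint f p q = sint f p q' - sint f q q' by rewrite -h1; ring.
by rewrite -h2; ring.
Qed.

(** A certificate of distance: when [normc nu <= 1], all its points are at least [eta] away from
    [z0], and by convexity a whole edge qualifies as soon as its two ends do. *)
Definition halfplane nu eta z0 : set R[i] := [set z | eta <= ReC (nu * (z - z0))].

Lemma cvx_halfplane nu eta z0 : cvx (halfplane nu eta z0).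
Proof.
move=> a b t /= ha hb /andP[t0 t1]; rewrite /halfplane /=.
have -> : nu * (pt a b t - z0) = (1 - t)%:C * (nu * (a - z0)) + t%:C * (nu * (b - z0)).
  by rewrite /pt rmorphB rmorph1; ring.
rewrite ReD !ReMr; have t1' : 0 <= 1 - t by lra.
by have := ler_wpM2l t0 hb; have := ler_wpM2l t1' ha; lra.
Qed.

Lemma cvxI (A B : set R[i]) : cvx A -> cvx B -> cvx (A `&` B).
Proof. by move=> cA cB a b t [aA aB] [bA bB] t01; split; [exact: cA|exact: cB]. Qed.

Lemma halfplane_far nu eta z0 z : normc nu <= 1 -> halfplane nu eta z0 z -> eta <= normc (z - z0).
Proof.
move=> nu1 h; rewrite (le_trans h) // (le_trans (ler_Re _)) // modM.
by rewrite ler_piMl ?mod_ge0.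
Qed.

Lemma halfplane_neq nu eta z0 z : 0 < eta -> normc nu <= 1 -> halfplane nu eta z0 z -> z - z0 != 0.
Proof. by move=> e0 nu1 /(halfplane_far nu1) h; rewrite -mod_gt0 (lt_le_trans e0). Qed.

Lemma quotient_cdiff g z z0 : cdiff g z -> z - z0 != 0 -> cdiff (fun w => g w / (w - z0)) z.
Proof. by move=> dg nz; apply: cdiffM => //; apply: cdiff_inv => //; exact: cdiff_subr. Qed.

Lemma quotient_bound g (B : R) nu eta z z0 : 0 < eta -> normc nu <= 1 -> normc (g z) <= B ->
  halfplane nu eta z0 z -> normc (g z / (z - z0)) <= B / eta.
Proof.
move=> e0 nu1 gB h; have far := halfplane_far nu1 h.
have B0 := le_trans (mod_ge0 _) gB.
rewrite modM modV ler_pM ?mod_ge0 ?invr_ge0 ?mod_ge0 // lef_pV2 //.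
by rewrite posrE (lt_le_trans e0).
Qed.

Section Cycle.
Variables P Q : nat -> R[i].
Hypothesis PQ0 : P 0%N = Q 0%N.

(* The closed polygon [P 0, ..., P M, Q M, ..., Q 0], where [P 0 = Q 0]. *)
Definition cyc (S : R[i] -> R[i] -> R[i]) (M : nat) : R[i] :=
  \sum_(n < M) (S (P n) (P n.+1) - S (Q n) (Q n.+1)) + S (P M) (Q M).

Variant edge (M : nat) : R[i] -> R[i] -> Prop :=
| edgeP n of (n < M)%N : edge M (P n) (P n.+1)
| edgeQ n of (n < M)%N : edge M (Q n) (Q n.+1)
| edgeC : edge M (P M) (Q M).

(** Corrections of the form [D p - D q] telescope around a closed polygon. In the deformations
    below, [D] is an integral along the segment joining a vertex and its displaced copy. *)
Lemma cyc_deform S S' D M : (forall p q, edge M p q -> S p q = S' p q + (D p - D q)) ->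
  cyc S M = cyc S' M.
Proof.
move=> H; rewrite /cyc H; last exact: edgeC.
have -> : \sum_(n < M) (S (P n) (P n.+1) - S (Q n) (Q n.+1)) =
  \sum_(n < M) (S' (P n) (P n.+1) - S' (Q n) (Q n.+1)) +
  \sum_(n < M) ((D (Q n.+1) - D (P n.+1)) - (D (Q n) - D (P n))).
  rewrite -big_split /=; apply: eq_bigr => n _.
  by rewrite (H _ _ (edgeP (ltn_ord n))) (H _ _ (edgeQ (ltn_ord n))); ring.
rewrite -(big_mkord xpredT (fun n => (D (Q n.+1) - D (P n.+1)) - (D (Q n) - D (P n)))).
rewrite (telescope_sumr (fun n => D (Q n) - D (P n))) // PQ0; ring.
Qed.

Lemma cyc_eq S S' M : (forall p q, edge M p q -> S p q = S' p q) -> cyc S M = cyc S' M.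
Proof. by move=> H; apply: (@cyc_deform _ _ (fun=> 0)) => p q /H ->; rewrite subrr addr0. Qed.

Definition lim0 (F : R -> R[i]) := forall e : R, 0 < e ->
  exists2 r : R, 0 < r & forall t, 0 < t <= r -> normc (F t) <= e.

Lemma lim0D F G : lim0 F -> lim0 G -> lim0 (fun t => F t + G t).
Proof.
move=> hF hG e e0; have e2 : 0 < e / 2 by rewrite divr_gt0.
have [r r0 rP] := hF _ e2; have [s s0 sP] := hG _ e2.
exists (Num.min r s); first by rewrite lt_min r0.
move=> t /andP[t0]; rewrite le_min => /andP[tr ts].
rewrite (le_trans (modD _ _)) //.
have := rP t; have := sP t; rewrite t0 tr ts => /(_ isT) h1 /(_ isT) h2; lra.
Qed.

Lemma lim0N F : lim0 F -> lim0 (fun t => - F t).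
Proof. by move=> hF e /hF [r r0 rP]; exists r => // t /rP; rewrite modN. Qed.

Lemma lim0_cst (c : R[i]) : lim0 (fun=> c) -> c = 0.
Proof.
move=> h; apply/eqP; rewrite -mod_eq0; apply/eqP/le_anti; rewrite mod_ge0 andbT.
apply/ler_addgt0Pr => e e0; rewrite add0r; have [r r0] := h e e0.
by move=> /(_ r); rewrite r0 lexx; apply.
Qed.

Lemma lim0_cyc (S : R -> R[i] -> R[i] -> R[i]) M :
  (forall p q, edge M p q -> lim0 (fun t => S t p q)) -> lim0 (fun t => cyc (S t) M).
Proof.
move=> H; apply: lim0D; last by apply: H; exact: edgeC.
suff L m : (m <= M)%N -> lim0 (fun t => \sum_(n < m) (S t (P n) (P n.+1) - S t (Q n) (Q n.+1))).
  exact: L.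
elim: m => [_|m IH mM].
  by move=> e e0; exists 1 => // t _; rewrite big_ord0 mod0 ltW.
have -> : (fun t => \sum_(n < m.+1) (S t (P n) (P n.+1) - S t (Q n) (Q n.+1))) =
  (fun t => \sum_(n < m) (S t (P n) (P n.+1) - S t (Q n) (Q n.+1)) +
     (S t (P m) (P m.+1) - S t (Q m) (Q m.+1))).
  by apply/funext => t; rewrite big_ord_recr.
apply: lim0D; first by apply: IH; exact: ltnW.
by apply: lim0D; [|apply: lim0N]; apply: H; [exact: edgeP|exact: edgeQ].
Qed.

Lemma cycB S S' c M : cyc (fun p q => S p q - c * S' p q) M = cyc S M - c * cyc S' M.
Proof.
rewrite /cyc mulrDr mulr_sumr opprD addrACA; congr (_ + _).
by rewrite -sumrB; apply: eq_bigr => n _; ring.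
Qed.

Section CauchyFormula.
Variables (U : set R[i]) (g : R[i] -> R[i]) (B eta : R) (z0 : R[i]) (M : nat).
Hypotheses (cU : cvx U) (gB : forall z, U z -> normc (g z) <= B)
  (gd : forall z, U z -> cdiff g z) (Uz0 : U z0) (eta0 : 0 < eta).
Hypothesis edgeU : forall p q, edge M p q -> U p /\ U q.
Hypothesis edgeH : forall p q, edge M p q -> exists2 nu, normc nu <= 1 &
  halfplane nu eta z0 p /\ halfplane nu eta z0 q.

Let f z := g z / (z - z0).

Let dil (t : R) z := pt z0 z t.

(* Shrinking the polygon towards [z0] moves each edge inside a half-plane that avoids [z0]. *)
Lemma cauchy_dilate (t : R) : 0 < t <= 1 ->
  cyc (sint f) M = cyc (sint (fun z => g (dil t z) / (z - z0))) M.
Proof.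
move=> /andP[t0 t1].
apply: (@cyc_deform _ _ (fun p => sint f p (dil t p))) => p q pq.
have [Up Uq] := edgeU pq; have [nu nu1 [hp hq]] := edgeH pq.
have te0 : 0 < t * eta by rewrite mulr_gt0.
pose V := U `&` halfplane nu (t * eta) z0.
have cV : cvx V by apply: cvxI => //; exact: cvx_halfplane.
have fB z : V z -> normc (f z) <= B / (t * eta).
  by move=> [Uz hz]; apply: quotient_bound nu1 _ hz => //; exact: gB.
have fdf z : V z -> cdiff f z.
  move=> [Uz hz]; apply: quotient_cdiff; first exact: gd.
  exact: halfplane_neq te0 nu1 hz.
have inV z : U z -> halfplane nu eta z0 z -> V z /\ V (dil t z).
  move=> Uz hz; split; split => //.
  - by rewrite /halfplane /= (le_trans _ hz) // ler_piMl // ltW.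
  - by apply: cU => //; rewrite (ltW t0).
  - rewrite /halfplane /= /dil /pt.
    have -> : nu * (z0 + t%:C * (z - z0) - z0) = t%:C * (nu * (z - z0)) by ring.
    by rewrite ReMr ler_wpM2l // ltW.
have [Vp Vp'] := inV _ Up hp; have [Vq Vq'] := inV _ Uq hq.
rewrite (goursat4 cV fB fdf Vp Vq Vp' Vq'); congr (_ + _).
have dilE z : dil t z = (z0 - t%:C * z0) + t%:C * z by rewrite /dil /pt; ring.
rewrite !dilE sint_affine.
rewrite -(@sintZ _ _ p q (B / (t * eta))).
  apply: sint_eq => s _; rewrite -dilE /f.
  have -> : dil t (pt p q s) - z0 = t%:C * (pt p q s - z0) by rewrite /dil /pt; ring.
  rewrite invfM mulrCA (mulrA t%:C) divff ?mul1r //.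
  by rewrite fmorph_eq0 gt_eqF.
move=> s s01; rewrite -dilE; apply: fB.
by have [] := inV (pt p q s) (cU Up Uq s01) (cvx_halfplane hp hq s01).
Qed.

(** By [cauchy_dilate] the integral is the same for every dilation factor [t], and as [t] tends to
    0, [g (dil t z)] tends to [g z0] uniformly on each edge. The winding integral is left as it
    is. *)
Lemma cauchy_polygon : cyc (sint f) M = g z0 * cyc (sint (fun z => (z - z0)^-1)) M.
Proof.
apply/eqP; rewrite -subr_eq0; apply/eqP; apply: lim0_cst.
pose S (t : R) p q := sint (fun z => g (dil t z) / (z - z0)) p q - g z0 * sint (fun z => (z - z0)^-1) p q.
have S0 : lim0 (fun t => cyc (S t) M).
  apply: lim0_cyc => p q pq e e0.
  have [Up Uq] := edgeU pq; have [nu nu1 [hp hq]] := edgeH pq.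
  pose K := normc (p - z0) + normc (q - p) + 1.
  have K0 : 0 < K by rewrite ltr_wpDl // addr_ge0 ?mod_ge0.
  have e'0 : 0 < e * eta / K by rewrite !mulr_gt0 ?invr_gt0.
  have [r r0 rP] := cdiff_continuous (gd Uz0) e'0.
  exists (Num.min 1 (r / (2 * K))); first by rewrite lt_min ltr01 divr_gt0 // mulr_gt0.
  move=> t /andP[t0]; rewrite le_min => /andP[t1 tr].
  have hU s : 0 <= s <= 1 -> U (dil t (pt p q s)).
    by move=> s01; apply: cU => //; [exact: cU|rewrite ltW].
  have hH s : 0 <= s <= 1 -> halfplane nu eta z0 (pt p q s).
    by move=> s01; exact: cvx_halfplane.
  have b2 : bseg (fun z => (z - z0)^-1) p q (1 / eta).
    move=> s s01; rewrite -[X in normc X]mul1r.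
    by apply: (@quotient_bound (fun=> 1) 1) nu1 _ (hH _ s01); rewrite ?mod1.
  have b1 : bseg (fun z => g (dil t z) / (z - z0)) p q (B / eta).
    move=> s s01.
    by apply: (@quotient_bound (fun z => g (dil t z))) nu1 _ (hH _ s01) => //; apply: gB; exact: hU.
  have b3 : bseg (fun z => g z0 * (z - z0)^-1) p q (normc (g z0) * (1 / eta)).
    by move=> s s01; rewrite modM ler_wpM2l ?mod_ge0 // b2.
  rewrite /S -(sintZ _ b2) -(sintB b1 b3).
  apply: (@le_trans _ _ (normc (q - p) * (e / K))).
    apply: sint_mod => s s01.
    rewrite -mulrBl.
    have -> : e / K = (e * eta / K) / eta by field; rewrite !gt_eqF.
    apply: (@quotient_bound (fun z => g (dil t z) - g z0)) nu1 _ (hH _ s01) => //.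
    apply: rP; have -> : dil t (pt p q s) - z0 = t%:C * ((p - z0) + s%:C * (q - p)).
      by rewrite /dil /pt; ring.
    rewrite modM mod_real ger0_norm ?(ltW t0) //.
    have [s0 s1] := andP s01.
    have : normc (p - z0 + s%:C * (q - p)) <= K.
      rewrite (le_trans (modD _ _)) // modM mod_real ger0_norm //.
      have := ler_piMl (mod_ge0 (q - p)) s1; rewrite /K; lra.
    move=> /(ler_wpM2l (ltW t0)) h; apply: le_lt_trans h _.
    apply: le_lt_trans (ler_wpM2r (ltW K0) tr) _.
    have -> : r / (2 * K) * K = r / 2 by field; rewrite gt_eqF.
    lra.
  rewrite mulrC -mulrA ler_piMr ?(ltW e0) // mulrC ler_pdivrMr // mul1r.
  by have := mod_ge0 (p - z0); rewrite /K; lra.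
move=> e e0; have [r r0 rP] := S0 e e0.
exists (Num.min 1 r); first by rewrite lt_min ltr01.
move=> t /andP[t0]; rewrite le_min => /andP[t1 tr].
have := rP t; rewrite t0 tr => /(_ isT).
by rewrite cycB -cauchy_dilate ?t0.
Qed.

(** Translating the polygon by [z1 - z0] turns its winding integral about [z0] into one about [z1].
    Each translated edge is then moved back inside a half-plane avoiding [z1], which is why a single
    [nu] has to serve both points. *)
Lemma winding_translate z1 : (forall p q, edge M p q -> exists2 nu, normc nu <= 1 &
  [/\ halfplane nu eta z0 p, halfplane nu eta z0 q, halfplane nu eta z1 p & halfplane nu eta z1 q]) ->
  cyc (sint (fun z => (z - z0)^-1)) M = cyc (sint (fun z => (z - z1)^-1)) M.
Proof.
move=> H; pose tr p := p + (z1 - z0).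
apply: (@cyc_deform _ _ (fun p => sint (fun z => (z - z1)^-1) (tr p) p)) => p q pq.
have [nu nu1 [h1 h2 h3 h4]] := H _ _ pq.
have -> : sint (fun z => (z - z0)^-1) p q = sint (fun z => (z - z1)^-1) (tr p) (tr q).
  have trE z : tr z = (z1 - z0) + 1 * z by rewrite /tr; ring.
  rewrite !trE sint_affine mul1r; apply: sint_eq => s _; congr (_^-1); ring.
apply: (@goursat4 (halfplane nu eta z1) _ (1 / eta)) => //.
- exact: cvx_halfplane.
- by move=> z hz; rewrite -[X in normc X]mul1r; apply: (@quotient_bound (fun=> 1)) hz; rewrite ?mod1.
- move=> z hz; apply: cdiff_inv; first exact: cdiff_subr.
  exact: halfplane_neq hz.
- by rewrite /halfplane /= (_ : tr p - z1 = p - z0) // /tr; ring.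
- by rewrite /halfplane /= (_ : tr q - z1 = q - z0) // /tr; ring.
Qed.

End CauchyFormula.

(** The quadrilateral added between levels [M] and [M + 1] lies in the right half-plane, where
    [z^-1] is holomorphic, so it adds nothing to the integral. *)
Lemma winding_stable eta M : 0 < eta -> eta <= ReC (P M) -> eta <= ReC (Q M) ->
  eta <= ReC (P M.+1) -> eta <= ReC (Q M.+1) ->
  cyc (sint (fun z => z^-1)) M.+1 = cyc (sint (fun z => z^-1)) M.
Proof.
move=> e0 h1 h2 h3 h4.
have hp z : halfplane 1 eta 0 z <-> eta <= ReC z by rewrite /halfplane /= mul1r subr0.
have fB z : halfplane 1 eta 0 z -> normc (z^-1) <= 1 / eta.
  move=> hz; have := @quotient_bound (fun=> 1) 1 1 eta z 0 e0; rewrite mod1 subr0 mul1r.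
  by apply.
have fd z : halfplane 1 eta 0 z -> cdiff (fun w => w^-1) z.
  move=> hz; apply: cdiff_inv; first exact: cdiff_id.
  by have := halfplane_neq e0 _ hz; rewrite subr0 mod1; apply.
have := goursat4 (@cvx_halfplane _ _ _) fB fd ((hp _).2 h1) ((hp _).2 h3) ((hp _).2 h2) ((hp _).2 h4).
move=> h; rewrite /cyc big_ord_recr /= h; ring.
Qed.

(** Monotonicity of [blim] is stated for real parts; the factor [i (b - a)] turns the imaginary part
    of the integral into minus a real part. *)
Lemma sint_Im_ge f a b (k M : R) : bseg f a b M ->
  (forall t, 0 <= t <= 1 -> k <= ImC ((b - a) * f (pt a b t))) -> k <= ImC (sint f a b).
Proof.
move=> fM kf; pose c : R[i] := 'i%C * (b - a).
have -> : ImC (sint f a b) = - ReC (c * blim (rsum f a b)).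
  by rewrite /sint /c -mulrA [in RHS]ReM /= mul0r mul1r sub0r opprK.
rewrite -(blimZ _ (rsum_bddc fM)) lerNr; apply: blim_le_Re.
  have [K hK] := rsum_bddc fM; exists (normc c * K) => n.
  by rewrite modM ler_wpM2l ?mod_ge0.
move=> n; rewrite /rsum mulrCA mulr_sumr natC -fmorphV ReMr Re_sum.
rewrite ler_pdivrMl ?pow2_gt0 //.
apply: (@le_trans _ _ (\sum_(i < 2 ^ n) - k)); last by rewrite sumr_const card_ord mulr_natl.
apply: ler_sum => j _; rewrite /c -mulrA ReM /= mul0r mul1r sub0r lerN2.
by apply: kf; exact: dyadic01.
Qed.

End Cycle.
End Polygon.

(** * Stolz domains and the integration contour *)

Section SquareRoot.
Variable R : realType.
Implicit Types (v w z : R[i]).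

(* Principal square root on the right half-plane; it is [0] on the negative axis. *)
Definition csqrt v : R[i] := (v + (normc v)%:C) / (Num.sqrt (2 * (normc v + ReC v)))%:C.

Lemma csqrt_sqr v : 0 < ReC v -> csqrt v ^+ 2 = v.
Proof.
move=> v0; have n0 := mod_ge0 v.
have p0 : 0 < 2 * (normc v + ReC v) by rewrite mulr_gt0 // ltr_wpDl.
have x2 : (Num.sqrt (2 * (normc v + ReC v)))%:C ^+ 2 = (2 * (normc v + ReC v))%:C :> R[i].
  by rewrite -rmorphXn /= sqr_sqrtr ?ltW.
have xn : (2 * (normc v + ReC v))%:C != 0 :> R[i] by rewrite fmorph_eq0 gt_eqF.
rewrite /csqrt expr_div_n x2; apply: (mulIf xn); rewrite divfK //.
have := mod_sqr v; case: v v0 n0 p0 x2 xn => a b /= a0 n0 p0 x2 xn.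
move: (Num.sqrt _) n0 => n n0 nE.
by apply: complex_eqP; rewrite !expr2 ?ReM ?ImM /= ; nra.
Qed.

Lemma csqrt_Re_gt0 v : 0 < ReC v -> 0 < ReC (csqrt v).
Proof.
move=> v0; have n0 := mod_ge0 v; rewrite /csqrt -fmorphV mulrC ReMr ReD /=.
have h : 0 < normc v + ReC v by rewrite ltr_wpDl.
by rewrite mulr_gt0 ?invr_gt0 ?sqrtr_gt0 ?mulr_gt0 // addrC.
Qed.

Lemma csqrt_mod v : 0 < ReC v -> normc (csqrt v) = Num.sqrt (normc v).
Proof.
move=> v0; rewrite -[in RHS](csqrt_sqr v0) modX sqrtr_sqr ger0_norm //; exact: mod_ge0.
Qed.

Lemma csqrt_neq0 v : 0 < ReC v -> csqrt v != 0.
Proof. by move=> /csqrt_Re_gt0 h; rewrite -mod_gt0 (lt_le_trans h (ler_Re _)). Qed.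

Lemma cdiff_csqrt v : 0 < ReC v -> cdiff csqrt v.
Proof.
move=> v0; set b := csqrt v; have b0 : 0 < ReC b by exact: csqrt_Re_gt0.
have bn : b != 0 by exact: csqrt_neq0.
exists ((2%:R * b)^-1) => e e0.
(* The first radius keeps [w] in the right half-plane. The remainder is, up to sign,
   [(w - v) ^+ 2 / (a + b) ^+ 2 / (2 b)], and both [a + b] and [b] have modulus at least [ReC b];
   hence the second radius. *)
exists (Num.min (ReC v) (e * (2 * ReC b ^+ 3))).
  by rewrite lt_min v0 mulr_gt0 // mulr_gt0 // exprn_gt0.
move=> w; rewrite lt_min => /andP[wv we].
have w0 : 0 < ReC w.
  by have := ler_abs_Re (w - v); rewrite ReD ReN ler_norml => /andP[]; lra.
set a := csqrt w; have a0 : 0 < ReC a by exact: csqrt_Re_gt0.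
have ab : ReC b <= normc (a + b) by rewrite (le_trans _ (ler_Re _)) // ReD lerDr ltW.
have abn : a + b != 0 by rewrite -mod_gt0 (lt_le_trans b0).
have wvE : w - v = (a - b) * (a + b).
  by rewrite -(csqrt_sqr w0) -(csqrt_sqr v0) -/a -/b; ring.
have -> : a - b - (2%:R * b)^-1 * (w - v) = - (w - v) ^+ 2 / (a + b) ^+ 2 / (2%:R * b).
  by rewrite wvE; field; rewrite abn bn.
rewrite !modM modN !modV modX modX modM mod_nat.
have h1 : normc (a + b) ^- 2 <= ReC b ^- 2.
  have ab0 := lt_le_trans b0 ab.
  rewrite lef_pV2 ?posrE ?exprn_gt0 //.
  by rewrite lerXn2r // nnegrE ltW.
have h2 : (2 * normc b)^-1 <= (2 * ReC b)^-1.
  by rewrite lef_pV2 ?posrE ?mulr_gt0 ?mod_gt0 // ler_pM2l // ler_Re.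
have x0 := mod_ge0 (w - v).
apply: (@le_trans _ _ (normc (w - v) ^+ 2 * ReC b ^- 2 * (2 * ReC b)^-1)).
  apply: ler_pM => //.
  - by rewrite mulr_ge0 ?exprn_ge0 // invr_ge0 exprn_ge0 // mod_ge0.
  - by rewrite invr_ge0 mulr_ge0 ?mod_ge0.
  - by apply: ler_wpM2l => //; rewrite exprn_ge0.
have -> : normc (w - v) ^+ 2 * ReC b ^- 2 * (2 * ReC b)^-1 =
   normc (w - v) / (2 * ReC b ^+ 3) * normc (w - v) by field; rewrite gt_eqF.
rewrite ler_wpM2r // ler_pdivrMr ?mulr_gt0 ?exprn_gt0 //; exact: ltW.
Qed.

End SquareRoot.

(** * Stolz domains as unions of discs *)

Section StolzGeometry.
Variable R : realType.
Implicit Types (z w : R[i]) (s t g : R).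

(** The hull of 1 and the disc [D(0, s)], with the vertex removed, swept out by discs that shrink
    towards 1. In this form it is visibly open. *)
Definition cone s : set R[i] := [set z | exists t, 0 <= t < 1 /\ normc (z - t%:C) < (1 - t) * s].

Lemma cvx_cone s : cvx (cone s).
Proof.
move=> a b l [t1 [/andP[t10 t11] h1]] [t2 [/andP[t20 t21] h2]] /andP[l0 l1].
have [->|ln] := eqVneq l 0; first by rewrite pt0; exists t1; rewrite t10.
have lp : 0 < l by rewrite lt_def ln.
have l1' : 0 <= 1 - l by rewrite subr_ge0.
exists ((1 - l) * t1 + l * t2); split.
  rewrite addr_ge0 ?mulr_ge0 //=.
  have := ler_wpM2l l1' (ltW t11); have : l * t2 < l * 1 by rewrite ltr_pM2l.
  lra.
have -> : pt a b l - ((1 - l) * t1 + l * t2)%:C = (1 - l)%:C * (a - t1%:C) + l%:C * (b - t2%:C).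
  by rewrite /pt !(rmorphD, rmorphM, rmorphB, rmorph1) /=; ring.
apply: le_lt_trans (modD _ _) _; rewrite !modM !mod_real !ger0_norm ?subr_ge0 //.
have -> : (1 - ((1 - l) * t1 + l * t2)) * s = (1 - l) * ((1 - t1) * s) + l * ((1 - t2) * s) by ring.
apply: ler_ltD; first by rewrite ler_wpM2l // ltW.
by rewrite ltr_pM2l.
Qed.

Lemma cone_Re z s : s <= 1 -> cone s z -> ReC z < 1.
Proof.
move=> s1 [t [/andP[t0 t1] h]].
have : ReC z - t < 1 - t; last by lra.
have := le_lt_trans (ler_Re (z - t%:C)) h; rewrite ReD ReN /= => h2.
by apply: lt_le_trans h2 _; rewrite ler_piMr // subr_ge0 ltW.
Qed.

Lemma cone_conj z s : cone s z -> cone s z^*%C.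
Proof.
move=> [t [t01 h]]; exists t; split => //.
have -> : z^*%C - t%:C = (z - t%:C)^*%C by apply: complex_eqP; rewrite ?ReD ?ImD ?ReJ ?ImJ ?ReD ?ImD /=; ring.
by rewrite mod_conj.
Qed.

Lemma cone_sub s s' : s <= s' -> cone s `<=` cone s'.
Proof.
move=> ss z [t [/andP[t0 t1] h]]; exists t; split; first exact/andP.
by rewrite (lt_le_trans h) // ler_wpM2l // subr_ge0 ltW.
Qed.

Lemma stolz_cone g : stolz g = cone (sin g).
Proof.
apply/seteqP; split => z.
  rewrite /stolz /interior => /nbhs_modP [r r0 H].
  have hullRe w : stolz_hull g w -> ReC w <= 1.
    move=> [t [x [/andP[t0 t1] [hx ->]]]]; rewrite ReD ReMr /=.
    have := lt_le_trans (le_lt_trans (ler_Re x) hx) (sin_le1 g).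
    nra.
  (* An interior point can be moved to the right by [r / 2] inside the hull; this rules out the
     parameter [t = 1], which [cone] excludes. *)
  have z1 : ReC z < 1.
    have : ReC (z + (r / 2)%:C) <= 1.
      apply: hullRe; apply: H; rewrite addrAC subrr add0r mod_real ger0_norm; lra.
    by rewrite ReD /=; lra.
  have [] := H z; first by rewrite subrr mod0.
  move=> t [w [/andP[t0 t1] [hw zE]]]; exists t.
  have t1' : t < 1.
    rewrite lt_def t1 andbT; apply/eqP => t1E; move: z1.
    by rewrite zE -t1E subrr mul0r addr0 /= ltxx.
  split; first by rewrite t0.
  have -> : z - t%:C = (1 - t)%:C * w by rewrite zE; ring.
  by rewrite modM mod_real ger0_norm ?subr_ge0 // ltr_pM2l // subr_gt0.
move=> [t [/andP[t0 t1] h]]; rewrite /stolz /interior; apply/nbhs_modP.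
exists ((1 - t) * sin g - normc (z - t%:C)); first by rewrite subr_gt0.
move=> w hw; exists t, ((w - t%:C) / (1 - t)%:C); split; first by rewrite t0 ltW.
have t1' : 0 < 1 - t by rewrite subr_gt0.
have tn : (1 - t)%:C != 0 :> R[i] by rewrite fmorph_eq0 gt_eqF.
split; last by rewrite mulrC divfK //; ring.
rewrite modM modV mod_real ger0_norm ?(ltW t1') // ltr_pdivrMr // mulrC.
have -> : w - t%:C = (w - z) + (z - t%:C) by ring.
by apply: le_lt_trans (modD _ _) _; lra.
Qed.

End StolzGeometry.

(** * Construction of the contour *)

Section Contour.
Variable R : realType.
Implicit Types (z w : R[i]).

(* Upper half of the contour: [Q 0, ..., Q K] lie on a circle around 0 and [Q (K + m)] tends
   geometrically to 1. The margin [c0] does not depend on the mesh [eps]. *)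
Record contour (sa sb c0 eps : R) (Q : nat -> R[i]) (K : nat) (rho : R) : Prop := Contour {
  contour_real : ImC (Q 0%N) = 0;
  contour_cone : forall n, cone sb (Q n);
  contour_step : forall n, normc (Q n.+1 - Q n) <= eps * normc (1 - Q n);
  contour_margin : forall n, exists2 nu, normc nu <= 1 & forall z, cone sa z ->
    halfplane nu (c0 * normc (1 - z)) z (Q n) /\ halfplane nu (c0 * normc (1 - z)) z (Q n.+1);
  contour_tail : forall m, 1 - Q (K + m)%N = (rho ^+ m)%:C * (1 - Q K);
  contour_quadrant : 0 < ReC (Q K) /\ 0 < ImC (Q K);
  contour_turn : forall n, (n < K)%N -> 0 <= ImC ((Q n.+1)^*%C * Q n);
  contour_rho : 0 < rho < 1 }.

Lemma cos_near0 (k : R) : 0 < k -> exists2 r : R, 0 < r & forall x, `|x| < r -> 1 - cos x <= k.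
Proof.
move=> k0.
have /cvgrPdist_le /(_ k k0) : cos @ (0 : R) --> cos (0 : R) by exact: continuous_cos.
move=> /nbhs_ballP [r r0 H]; exists r => // x xr.
have := H x; rewrite /ball /= sub0r normrN cos0 => /(_ xr).
exact: le_trans (ler_norm _).
Qed.

Definition expi (x : R) : R[i] := cos x +i* sin x.

Lemma mod_expi x : normc (expi x) = 1.
Proof. by rewrite /= cos2Dsin2 sqrtr1. Qed.

Lemma cone_mod_sub1 (sa : R) z t : sa <= 1 -> t < 1 -> normc (z - t%:C) < (1 - t) * sa ->
  normc (1 - z) <= 2 * (1 - t).
Proof.
move=> s1 t1 h; have -> : 1 - z = (1 - t)%:C - (z - t%:C) by ring.
rewrite (le_trans (modB _ _)) // mod_real ger0_norm ?subr_ge0 ?ltW //.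
have : (1 - t) * sa <= 1 - t by rewrite ler_piMr // subr_ge0 ltW.
lra.
Qed.

(** The condition [ReC nu <= c] keeps the vertex 1 on the inner side of the line [ReC (nu * q) = c].
    The line is then at distance at least [(1 - t) * (c - sa)] from the disc of centre [t], on which
    [normc (1 - z) <= 2 * (1 - t)]. *)
Lemma margin_support (sa s c : R) z nu (t : R) : sa <= s -> 0 <= t < 1 -> sa <= 1 ->
  normc (z - t%:C) < (1 - t) * sa ->
  normc nu <= 1 -> ReC nu <= c -> (s - sa) / 2 <= c - sa ->
  forall q, c <= ReC (nu * q) -> halfplane nu ((s - sa) / 4 * normc (1 - z)) z q.
Proof.
move=> sas /andP[t0 t1] sa1 h nu1 nuc cs q hq; rewrite /halfplane /=.
have -> : nu * (q - z) = nu * q - t%:C * nu - nu * (z - t%:C) by ring.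
rewrite !ReD !ReN ReMr.
have h1 : ReC (nu * (z - t%:C)) <= (1 - t) * sa.
  rewrite (le_trans (ler_Re _)) // modM (le_trans _ (ltW h)) // ler_piMl ?mod_ge0 //.
have h2 := cone_mod_sub1 sa1 t1 h.
have h3 : (1 - t) * ((s - sa) / 2) <= (1 - t) * (c - sa) by rewrite ler_wpM2l // subr_ge0 ltW.
have h4 : t * ReC nu <= t * c by rewrite ler_wpM2l.
have : (s - sa) / 4 * normc (1 - z) <= (s - sa) / 4 * (2 * (1 - t)).
  by rewrite ler_wpM2l // divr_ge0 // subr_ge0.
lra.
Qed.

(** The contour follows the boundary of [cone s], with [s] halfway between [sa] and [sb]: the arc is
    replaced by short chords, and the tangent segment from the circle to 1 is cut geometrically. *)
Lemma contour_exists (sa sb : R) : 0 < sa -> sa < sb -> sb < 1 ->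
  exists2 c0 : R, 0 < c0 & forall eps : R, 0 < eps < 1 -> exists Q K rho, contour sa sb c0 eps Q K rho.
Proof.
move=> sa0 sab sb1; pose s := (sa + sb) / 2.
have [sas ssb] : sa < s /\ s < sb by split; rewrite /s; lra.
have s0 : 0 < s by lra.
have s1 : s < 1 by lra.
have sI : -1 <= s <= 1 by lra.
exists ((s - sa) / 4); first by rewrite divr_gt0 // subr_gt0.
move=> eps /andP[e0 e1].
(* The condition [cos th = s] says that the tangent to the circle at [s * expi th] passes through
   1. *)
pose th := acos s.
have cth : cos th = s by rewrite /th acosK // in_itv /=.
have th0 : 0 < th by apply: acos_gt0; lra.
have thpi : th < pi by apply: acos_ltpi; lra.
have sth : 0 < sin th by apply: sin_gt0_pi; rewrite th0.
(* The first bound on [1 - cos de] keeps the chords, at distance [s * cos de] or more in the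
   direction [nu], clear of [cone sa]; the second makes them shorter than [eps * (1 - s)]. *)
pose k := Num.min ((s - sa) / 2) ((eps * (1 - s)) ^+ 2 / 2).
have k0 : 0 < k.
  rewrite lt_min !divr_gt0 ?exprn_gt0 ?mulr_gt0 ?subr_gt0 //.
have [r r0 rP] := cos_near0 k0.
pose K := (Num.truncn ((pi - th) / r)).+1.
have K0 : 0 < K%:R :> R by rewrite ltr0n.
pose de := (pi - th) / K%:R.
have de0 : 0 < de by rewrite divr_gt0 // subr_gt0.
have de0' := ltW de0; have s0' := ltW s0; have e0' := ltW e0.
have der : de < r.
  by rewrite /de ltr_pdivrMr // mulrC -ltr_pdivrMr //; exact: truncnS_gt.
have deK : de * K%:R = pi - th by rewrite /de divfK // gt_eqF.
have depi : de <= pi - th.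
  by rewrite -deK; apply: ler_peMr; [exact: ltW|rewrite ler1n].
have sde : 0 <= sin de by apply: sin_ge0_pi; lra.
have ck : 1 - cos de <= k by apply: rP; rewrite ger0_norm // ltW.
have [ck1 ck2] : 1 - cos de <= (s - sa) / 2 /\ 1 - cos de <= (eps * (1 - s)) ^+ 2 / 2.
  by move: ck; rewrite /k le_min => /andP[].
have cde1 := cos_le1 de.
pose ph (n : nat) := pi - n%:R * de.
have phS n : ph n = ph n.+1 + de by rewrite /ph -natr1; ring.
have phK : ph K = th by rewrite /ph mulrC deK; ring.
have phge n : (n <= K)%N -> th <= ph n <= pi.
  move=> nK; have : n%:R * de <= K%:R * de by rewrite ler_wpM2r // ler_nat.
  have : 0 <= n%:R * de by rewrite mulr_ge0.
  by rewrite (mulrC K%:R) deK /ph; lra.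
pose T : R[i] := s%:C * expi th.
(* With this ratio each step on the tangent segment is exactly [eps] times the distance to 1. *)
pose rho := 1 - eps.
pose Q n : R[i] := if (n <= K)%N then s%:C * expi (ph n) else 1 + (rho ^+ (n - K))%:C * (T - 1).
have QK m : Q (K + m)%N = 1 + (rho ^+ m)%:C * (T - 1).
  rewrite /Q (addKn K m); case: ifP => [|//].
  rewrite -{2}[K]addn0 leq_add2l leqn0 => /eqP ->.
  by rewrite addn0 phK expr0 /T; ring.
have rho01 : 0 < rho < 1 by rewrite /rho; lra.
have [rho0 rho1] := andP rho01.
have QKT : Q K = T by rewrite -[K]addn0 QK expr0; ring.
have nmod : normc T = s by rewrite modM mod_expi mulr1 mod_real gtr0_norm.
exists Q, K, rho; split => //.
- by rewrite /Q leq0n ImMr /ph mul0r subr0 /= sinpi mulr0.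
- move=> n; have [nK|nK] := leqP n K.
    exists 0; rewrite lexx ltr01; split => //.
    by rewrite /Q nK subr0 modM mod_expi mod_real mulr1 subr0 mul1r gtr0_norm.
  rewrite -(subnKC (ltnW nK)) QK; set m := (n - K)%N.
  have rm0 : 0 < rho ^+ m by rewrite exprn_gt0.
  exists (1 - rho ^+ m); split.
    by rewrite subr_ge0 exprn_ile1 ?(ltW rho0) ?(ltW rho1) //= ltrBlDr ltrDl.
  have -> : 1 + (rho ^+ m)%:C * (T - 1) - (1 - rho ^+ m)%:C = (rho ^+ m)%:C * T by ring.
  by rewrite modM mod_real gtr0_norm // nmod opprB addrC subrK ltr_pM2l.
- move=> n; have [nK|nK] := ltnP n K.
    rewrite /Q nK (ltnW nK).
    have h1 : 1 - s <= normc (1 - s%:C * expi (ph n)).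
      by have := ler_mod_dist 1 (s%:C * expi (ph n)); rewrite mod1 modM mod_expi mod_real mulr1 gtr0_norm.
    apply: (@le_trans _ _ (eps * (1 - s))); last by rewrite ler_wpM2l.
    rewrite -mulrBr modM mod_real gtr0_norm //.
    apply: (@le_trans _ _ (normc (expi (ph n.+1) - expi (ph n)))).
      by rewrite ler_piMl ?mod_ge0 ?(ltW s1).
    have es0 : 0 <= eps * (1 - s) by rewrite mulr_ge0 ?subr_ge0 ?(ltW s1).
    rewrite -(@ler_pXn2r _ 2%N) ?nnegrE ?mod_ge0 // mod_sqr !ReD !ImD !ReN !ImN /=.
    have hc : cos (ph n.+1) * cos (ph n) + sin (ph n.+1) * sin (ph n) = cos de.
      by rewrite -cosB (phS n) -[RHS]cosN; congr cos; ring.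
    have := cos2Dsin2 (ph n); have := cos2Dsin2 (ph n.+1).
    move: hc ck2; clear.
    move: (cos (ph n)) (sin (ph n)) (cos (ph n.+1)) (sin (ph n.+1)) (cos de) => x1 y1 x2 y2 c.
    lra.
  rewrite -(subnKC nK) -addnS !QK; set m := (n - K)%N.
  have -> : 1 + (rho ^+ m.+1)%:C * (T - 1) - (1 + (rho ^+ m)%:C * (T - 1)) =
     (- eps)%:C * ((rho ^+ m)%:C * (T - 1)).
    by rewrite exprS /rho !(rmorphM, rmorphB, rmorphN, rmorph1) /=; ring.
  rewrite modM mod_real normrN gtr0_norm //.
  by rewrite (_ : 1 - (1 + (rho ^+ m)%:C * (T - 1)) = - ((rho ^+ m)%:C * (T - 1))) ?modN //; ring.
- move=> n; have sa1 : sa <= 1 by lra.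
  have [nK|nK] := ltnP n K.
    (* This keeps the vertex 1 on the inner side of the line for [nu]. As [n < K], the angle [ph n]
       is at least [th + de], and [cos (th + de) <= cos th * cos de]. *)
    have c1 : cos (ph n) <= s * cos de.
      have /andP[g1 g2] := phge _ nK; have := phge _ (ltnW nK); rewrite (phS n) => /andP[g3 g4].
      have : cos (ph n.+1 + de) <= cos (th + de).
        rewrite leNgt ltr_cos ?in_itv /=; lra.
      by rewrite -(phS n) cosD cth; have := mulr_ge0 (ltW sth) sde; lra.
    exists (expi (ph n))^*%C; first by rewrite mod_conj mod_expi.
    have cs : (s - sa) / 2 <= s * cos de - sa.
      have : s * (1 - cos de) <= (s - sa) / 2 by rewrite (le_trans _ ck1) // ler_piMl ?subr_ge0 ?(ltW s1).
      lra.
    move=> z [t [t01 hz]].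
    split; apply: (@margin_support sa s (s * cos de) z _ t (ltW sas)) => //; rewrite ?mod_conj ?mod_expi //.
      rewrite /Q (ltnW nK) mulrCA ReMr ler_pM2l // ReM /=.
      by have := cos2Dsin2 (ph n); lra.
    rewrite /Q nK mulrCA ReMr ler_pM2l // ReM /=.
    have -> : cos de = cos (ph n - ph n.+1) by congr cos; rewrite (phS n); ring.
    by rewrite cosB; lra.
  exists (expi th)^*%C; first by rewrite mod_conj mod_expi.
  have onray m : s <= ReC ((expi th)^*%C * Q (K + m)%N).
    rewrite QK /T; set nu := (expi th)^*%C.
    have -> : nu * (1 + (rho ^+ m)%:C * (s%:C * expi th - 1)) =
      nu + (rho ^+ m)%:C * (s%:C * (nu * expi th) - nu) by ring.
    rewrite ReD ReMr ReD ReN ReMr ReM /= cth.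
    have -> : s * s - - sin th * sin th = 1 by rewrite -(cos2Dsin2 th) cth; ring.
    by rewrite mulr1 subrr mulr0 addr0.
  have nu1 : normc (expi th)^*%C <= 1 by rewrite mod_conj mod_expi.
  have nus : ReC (expi th)^*%C <= s by rewrite /= cth.
  have ss2 : (s - sa) / 2 <= s - sa by move: sas; clear; lra.
  move=> z [t [t01 hz]].
  split; apply: (margin_support (ltW sas) t01 sa1 hz nu1 nus ss2).
    by rewrite -(subnKC nK) onray.
  by rewrite -(subnKC nK) -addnS onray.
- by move=> m; rewrite QK QKT; ring.
- rewrite QKT /T ReMr ImMr /= cth; split; exact: mulr_gt0.
- move=> n nK; rewrite /Q nK (ltnW nK).
  have -> : (s%:C * expi (ph n.+1))^*%C * (s%:C * expi (ph n)) =
     (s ^+ 2)%:C * ((expi (ph n.+1))^*%C * expi (ph n)).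
    by apply: complex_eqP; rewrite !(ReM, ImM, ReJ, ImJ) /=; ring.
  rewrite ImMr mulr_ge0 ?sqr_ge0 // ImM /=.
  have -> : cos (ph n.+1) * sin (ph n) + - sin (ph n.+1) * cos (ph n) = sin de.
    have -> : de = ph n - ph n.+1 by rewrite (phS n); ring.
    by rewrite sinB; ring.
  exact: sde.
Qed.
End Contour.

(** * One variable *)

Section ContourFormula.
Variable R : realType.
Variables (sa sb c0 eps : R) (Q : nat -> R[i]) (K : nat) (rho : R).
Hypotheses (sa0 : 0 < sa) (sab : sa <= sb) (sb1 : sb < 1) (c00 : 0 < c0) (eps0 : 0 < eps)
  (eps2 : eps <= 1 / 2).
Hypothesis HQ : contour sa sb c0 eps Q K rho.
Implicit Types (z w : R[i]).

Definition node (b : bool) (n : nat) : R[i] := if b then Q n else (Q n)^*%C.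
Definition gap (n : nat) : R := normc (1 - Q n).

Let P n := (Q n)^*%C.

Lemma mod_conj_sub z w : normc (z^*%C - w^*%C) = normc (z - w).
Proof. by rewrite -[RHS]mod_conj; congr normc; apply: complex_eqP; rewrite !(ReD, ImD, ReN, ImN, ReJ, ImJ) //; ring. Qed.

Lemma conj_real (r : R) : (r%:C)^*%C = r%:C :> R[i].
Proof. by apply: complex_eqP; rewrite ?ReJ ?ImJ //= oppr0. Qed.

Lemma conjB z w : (z - w)^*%C = z^*%C - w^*%C.
Proof. by apply: complex_eqP; rewrite !(ReD, ImD, ReN, ImN, ReJ, ImJ) //; ring. Qed.

Lemma conjM z w : (z * w)^*%C = z^*%C * w^*%C.
Proof. by apply: complex_eqP; rewrite !(ReM, ImM, ReJ, ImJ) //; ring. Qed.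

Lemma mod_one_conj z : normc (1 - z^*%C) = normc (1 - z).
Proof. by rewrite -[RHS]mod_conj conjB (conj_real 1). Qed.

Lemma cone_sa_sb z : cone sa z -> cone sb z.
Proof. exact: cone_sub. Qed.

Lemma node_cone b n : cone sb (node b n).
Proof. by case: b; [|apply: cone_conj]; exact: (contour_cone HQ). Qed.

Lemma cone_Re1 z : cone sb z -> 0 < ReC (1 - z).
Proof. by move=> /(cone_Re (ltW sb1)); rewrite ReD ReN /= subr_gt0. Qed.

Lemma node_gap b n : normc (1 - node b n) = gap n.
Proof. by case: b; rewrite //= mod_one_conj. Qed.

Lemma gap_gt0 n : 0 < gap n.
Proof. by rewrite (lt_le_trans (cone_Re1 (node_cone true n))) // ler_Re. Qed.

Lemma node_step b n : normc (node b n.+1 - node b n) <= eps * gap n.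
Proof. by case: b => /=; rewrite ?mod_conj_sub; exact: (contour_step HQ). Qed.

Lemma node_margin b n : exists2 nu, normc nu <= 1 & forall z, cone sa z ->
    halfplane nu (c0 * normc (1 - z)) z (node b n) /\ halfplane nu (c0 * normc (1 - z)) z (node b n.+1).
Proof.
have [nu nu1 H] := contour_margin HQ n.
case: b => /=; first by exists nu.
exists nu^*%C; first by rewrite mod_conj.
move=> z /cone_conj /H; rewrite mod_one_conj /halfplane /=.
have E w : ReC (nu^*%C * (w^*%C - z)) = ReC (nu * (w - z^*%C)).
  by rewrite -[RHS]ReJ conjM conjB conjcK.
by rewrite !E.
Qed.

(** With [N] the distance from the node to [z], the margin gives [c0 * normc (1 - z) <= N] and the
    triangle inequality gives [gap n <= N + normc (1 - z)]; combining them produces the constant. *)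
Lemma node_far b n z : cone sa z ->
  (c0 / (c0 + 2)) * (gap n + normc (1 - z)) <= normc (node b n - z).
Proof.
move=> cz; have [nu nu1 /(_ z cz) [h _]] := node_margin b n.
have h1 := halfplane_far nu1 h.
have h2 : gap n <= normc (node b n - z) + normc (1 - z).
  rewrite -(node_gap b n) [leRHS]addrC; have -> : 1 - node b n = (1 - z) - (node b n - z) by ring.
  exact: modB.
have k0 : 0 < c0 + 2 by rewrite addr_gt0.
rewrite mulrAC ler_pdivrMr //.
have := ler_wpM2l (ltW c00) h2.
by move: h1; lra.
Qed.

Lemma Re_tail m : ReC (Q K) <= ReC (Q (K + m)%N).
Proof.
have [rho0 rho1] := andP (contour_rho HQ).
have := contour_tail HQ m => /(congr1 (@complex.Re R)).
rewrite ReMr !ReD !ReN /=.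
have : rho ^+ m <= 1 by rewrite exprn_ile1 // ltW.
have := cone_Re1 (node_cone true K); rewrite ReD ReN /= => h1 h2 h3.
have := ler_wpM2r (ltW h1) h2; lra.
Qed.

(** The weight [1 / csqrt (1 - z)] is unbounded near the vertex. Cauchy's formula is therefore
    applied on the part of the cone where [ReC (1 - z)] is bounded below. *)
Lemma kappa_exists M : exists2 k : R, 0 < k & forall n, (n <= M)%N -> k <= ReC (1 - Q n).
Proof.
elim: M => [|M [k k0 H]].
  by exists (ReC (1 - Q 0%N)); [exact: (cone_Re1 (node_cone true 0))|move=> n; rewrite leqn0 => /eqP ->].
exists (Num.min k (ReC (1 - Q M.+1))).
  by rewrite lt_min k0; exact: (cone_Re1 (node_cone true M.+1)).
move=> n; rewrite leq_eqVlt => /orP[/eqP ->|]; first by rewrite ge_min lexx orbT.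
by rewrite ltnS => /H h; rewrite ge_min h.
Qed.

Let PQ0 : P 0%N = Q 0%N.
Proof. by apply: complex_eqP; rewrite ?ReJ ?ImJ // (contour_real HQ) oppr0. Qed.

Lemma edge_halfplane M p q : edge P Q M p q -> (K <= M)%N -> exists2 nu, normc nu <= 1 &
  forall z, cone sa z ->
    halfplane nu (Num.min (c0 * normc (1 - z)) (ReC (Q M) - ReC z)) z p /\
    halfplane nu (Num.min (c0 * normc (1 - z)) (ReC (Q M) - ReC z)) z q.
Proof.
move=> [n nM|n nM|] KM.
- have [nu nu1 H] := node_margin false n; exists nu => // z /H [h1 h2].
  by split; rewrite /halfplane /= ge_min ?h1 ?h2.
- have [nu nu1 H] := node_margin true n; exists nu => // z /H [h1 h2].
  by split; rewrite /halfplane /= ge_min ?h1 ?h2.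
- exists 1; first by rewrite mod1.
  move=> z cz; rewrite /halfplane /= !mul1r !ReD !ReN ReJ.
  by rewrite !ge_min lexx orbT.
Qed.

Lemma edge_node M p q : edge P Q M p q ->
  exists b n c m, [/\ p = node b n, q = node c m, (n <= M)%N & (m <= M)%N].
Proof.
move=> [n nM|n nM|].
- by exists false, n, false, n.+1; split => //; exact: ltnW.
- by exists true, n, true, n.+1; split => //; exact: ltnW.
- by exists false, M, true, M.
Qed.

Definition winding : R[i] := cyc P Q (sint (fun z => z^-1)) K.

Lemma winding_tail m : cyc P Q (sint (fun z => z^-1)) (K + m)%N = winding.
Proof.
elim: m => [|m IH]; first by rewrite addn0.
rewrite -IH addnS; have [k0 _] := contour_quadrant HQ.
by apply: (@winding_stable _ _ _ (ReC (Q K))) => //; rewrite ?ReJ ?Re_tail // -addnS Re_tail.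
Qed.

Lemma cone_mod1 z : cone sb z -> normc z <= 1.
Proof.
move=> [t [/andP[t0 t1] h]]; have -> : z = t%:C + (z - t%:C) by ring.
rewrite (le_trans (modD _ _)) // mod_real ger0_norm //.
have : (1 - t) * sb <= 1 - t by rewrite ler_piMr ?subr_ge0 ?(ltW t1) ?(ltW sb1).
by move: h; lra.
Qed.

(** The rate at which the argument turns along the segment, seen from 0: its sign is that of
    [ImC (p^* q)] throughout. *)
Lemma Im_inv_seg p q (t : R) : ImC ((q - p) * (pt p q t)^-1) =
  ImC (p^*%C * q) / normc (pt p q t) ^+ 2.
Proof.
have [->|nz] := eqVneq (pt p q t) 0.
  by rewrite invr0 mulr0 mod0 expr0n /= invr0 mulr0.
have -> : (pt p q t)^-1 = (normc (pt p q t) ^- 2)%:C * (pt p q t)^*%C.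
  apply: (mulIf nz); rewrite mulVf // -mulrA.
  have -> : (pt p q t)^*%C * pt p q t = (normc (pt p q t) ^+ 2)%:C.
    by rewrite mod_sqr; apply: complex_eqP; rewrite ?ReM ?ImM ?ReJ ?ImJ /=; ring.
  by rewrite -rmorphM /= mulVf // expf_neq0 // mod_eq0.
rewrite mulrCA ImMr mulrC; congr (_ / _).
rewrite /pt !(ReD, ImD, ReM, ImM, ReJ, ImJ, ReN, ImN) /=; ring.
Qed.

Lemma cone0 : cone sa (0 : R[i]).
Proof. by exists 0; rewrite lexx ltr01 subrr mod0 subr0 mul1r. Qed.

Lemma inv_bseg nu (eta : R) p q : 0 < eta -> normc nu <= 1 -> halfplane nu eta 0 p ->
  halfplane nu eta 0 q -> bseg (fun z => z^-1) p q (1 / eta).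
Proof.
move=> e0 nu1 hp hq t t01.
have := @quotient_bound _ (fun=> 1) 1 nu eta (pt p q t) 0 e0 nu1.
by rewrite mod1 subr0 mul1r; apply => //; exact: cvx_halfplane.
Qed.

(** All edges along the arc turn the same way about 0, so their integrals have nonnegative imaginary
    parts, and the closing edge contributes a positive one. Nonvanishing matters because [coef]
    divides by this number. *)
Lemma winding_neq0 : winding != 0.
Proof.
have [k1 k2] := contour_quadrant HQ.
have hb nb n : bseg (fun z => z^-1) (node nb n) (node nb n.+1) (1 / c0) /\
               bseg (fun z => z^-1) (node nb n.+1) (node nb n) (1 / c0).
  have [nu nu1 /(_ 0 cone0)] := node_margin nb n; rewrite subr0 mod1 mulr1 => -[h1 h2].
  by split; apply: inv_bseg nu1 _ _.
have hI : 0 < ImC winding.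
  rewrite /winding /cyc ImD Im_sum ltr_wpDl //.
    apply: sumr_ge0 => n _; rewrite ImD ImN subr_ge0.
    apply: (@le_trans _ _ 0).
      rewrite -oppr_ge0 -ImN -(sint_rev (hb true n).1).
      apply: sint_Im_ge (hb true n).2 _ => t t01.
      by rewrite Im_inv_seg divr_ge0 ?exprn_ge0 ?mod_ge0 // (contour_turn HQ).
    apply: sint_Im_ge (hb false n).1 _ => t t01.
    rewrite Im_inv_seg divr_ge0 ?exprn_ge0 ?mod_ge0 //= conjcK mulrC.
    by rewrite (contour_turn HQ).
  have bC : bseg (fun z => z^-1) (P K) (Q K) (1 / ReC (Q K)).
    by apply: (@inv_bseg 1) => //; rewrite ?mod1 // /halfplane /= mul1r subr0 ?ReJ.
  apply: (@lt_le_trans _ _ (2 * (ReC (Q K) * ImC (Q K)))); first by rewrite !mulr_gt0.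
  apply: sint_Im_ge bC _ => t t01; rewrite Im_inv_seg /P conjcK ImM.
  have cp : cone sb (pt (P K) (Q K) t).
    by apply: cvx_cone => //; [exact: (node_cone false)|exact: (node_cone true)].
  have p0 : 0 < normc (pt (P K) (Q K) t).
    rewrite (lt_le_trans _ (ler_Re _)) // /pt ReD ReMr ReD ReN ReJ; lra.
  rewrite ler_pdivlMr ?exprn_gt0 //.
  have -> : ReC (Q K) * ImC (Q K) + ImC (Q K) * ReC (Q K) = 2 * (ReC (Q K) * ImC (Q K)) by ring.
  by rewrite ler_piMr ?mulr_ge0 ?(ltW k1) ?(ltW k2) // exprn_ile1 ?mod_ge0 // cone_mod1.
by apply/eqP => W0; move: hI; rewrite W0 ltxx.
Qed.

Variables (h : R[i] -> R[i]) (B : R).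
Hypotheses (hd : forall z, cone sb z -> cdiff h z) (hB : forall z, cone sb z -> normc (h z) <= B).

Let g z := h z / csqrt (1 - z).

Lemma weight_bound (k : R) z : cone sb z -> 0 < k -> k <= ReC (1 - z) -> normc (g z) <= B / Num.sqrt k.
Proof.
move=> cz k0 kz; have B0 := le_trans (mod_ge0 _) (hB cz).
rewrite /g modM modV csqrt_mod ?cone_Re1 //.
apply: ler_pM; rewrite ?mod_ge0 ?invr_ge0 ?sqrtr_ge0 ?hB //.
have h1 : k <= normc (1 - z) by rewrite (le_trans kz) // ler_Re.
by rewrite lef_pV2 ?posrE ?sqrtr_gt0 ?(lt_le_trans k0 h1) // ler_wsqrtr.
Qed.

Lemma weight_cdiff z : cone sb z -> cdiff g z.
Proof.
move=> cz; have p0 := cone_Re1 cz; apply: cdiffM; first exact: hd.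
apply: cdiff_inv; last exact: csqrt_neq0.
apply: cdiff_comp; last exact: cdiff_csqrt.
by apply: cdiff_eq (cdiff_affine 1 (-1) z) => w; rewrite mulN1r.
Qed.

Lemma contour_cauchy z M : cone sa z -> (K <= M)%N -> ReC z < ReC (Q M) ->
  cyc P Q (sint (fun w => g w / (w - z))) M = g z * winding.
Proof.
move=> cz KM zM.
have [k1 k10 k1P] := kappa_exists M.
have z1 := cone_Re1 (cone_sa_sb cz).
pose k := Num.min k1 (ReC (1 - z)).
have k0 : 0 < k by rewrite lt_min k10.
pose U := cone sb `&` halfplane (-1) k 1.
have UE w : cone sb w -> k <= ReC (1 - w) -> U w.
  by move=> cw kw; split => //; rewrite /halfplane /= mulN1r opprB.
have Ucone w : U w -> cone sb w by case.
have URe w : U w -> k <= ReC (1 - w) by move=> [_]; rewrite /halfplane /= mulN1r opprB.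
have cU : cvx U by apply: cvxI; [exact: cvx_cone|exact: cvx_halfplane].
have gB w : U w -> normc (g w) <= B / Num.sqrt k.
  by move=> Uw; apply: weight_bound; [exact: Ucone| |exact: URe].
have gd w : U w -> cdiff g w by move=> Uw; apply: weight_cdiff; exact: Ucone.
have Uz : U z by apply: UE; [exact: cone_sa_sb|rewrite ge_min lexx orbT].
have Un b n : (n <= M)%N -> U (node b n).
  move=> nM; apply: UE; first exact: node_cone.
  rewrite ge_min; apply/orP; left; rewrite (le_trans (k1P n nM)) // !ReD !ReN.
  by case: b; rewrite /= ?ReJ.
have nz : 0 < normc (1 - z) by rewrite (lt_le_trans z1) // ler_Re.
have Q0 : 0 < ReC (Q M).
  by have [q0 _] := contour_quadrant HQ; rewrite (lt_le_trans q0) // -(subnKC KM) Re_tail.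
(* The margin is taken about both [z] and 0, because the winding integral about [z] is transported
   to 0 by [winding_translate]. *)
pose eta := Num.min (Num.min (c0 * normc (1 - z)) (ReC (Q M) - ReC z)) (Num.min c0 (ReC (Q M))).
have eta0 : 0 < eta by rewrite !lt_min c00 Q0 subr_gt0 zM mulr_gt0.
have H p q : edge P Q M p q -> exists2 nu, normc nu <= 1 &
  [/\ halfplane nu eta z p, halfplane nu eta z q, halfplane nu eta 0 p & halfplane nu eta 0 q].
  move=> /edge_halfplane /(_ KM) [nu nu1 N]; exists nu => //.
  have [a1 a2] := N z cz; have [a3 a4] := N 0 cone0.
  move: a3 a4; rewrite subr0 mod1 mulr1 subr0 => a3 a4.
  by split; [apply: le_trans a1|apply: le_trans a2|apply: le_trans a3|apply: le_trans a4];
    rewrite /eta ge_min lexx ?orbT.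
rewrite (@cauchy_polygon _ P Q PQ0 U g _ eta z M cU gB gd Uz eta0).
- congr (_ * _); rewrite (@winding_translate _ P Q PQ0 eta z M eta0 0) //.
  rewrite -(winding_tail (M - K)) subnKC //; apply: (cyc_eq PQ0) => p q _.
  by apply: sint_eq => t _; rewrite subr0.
- move=> p q /edge_node [b [n [c [m [-> -> nM mM]]]]].
  by split; exact: Un.
- by move=> p q /H [nu nu1 [? ? _ _]]; exists nu.
Qed.

Lemma expr_small (r e : R) : 0 <= r < 1 -> 0 < e -> exists m, forall n, (m <= n)%N -> r ^+ n <= e.
Proof.
move=> /andP[r0 r1] e0.
have /cvgrPdist_le /(_ e e0) [m _ H] : (fun n => r ^+ n) @ \oo --> (0 : R).
  by apply: cvg_expr; rewrite ger0_norm.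
by exists m => n mn; have := H n mn; rewrite /= sub0r normrN ger0_norm // exprn_ge0.
Qed.

(** The closing edge at level [K + m] has length of order [rho ^+ m], while the weight on it is of
    order [rho ^+ m] to the power -1/2; its integral is thus of the order of the square root of
    [rho ^+ m]. *)
Lemma contour_limit z (e : R) : cone sa z -> 0 < e -> exists M0, forall M, (M0 <= M)%N ->
  normc (\sum_(n < M) (sint (fun w => g w / (w - z)) (P n) (P n.+1)
     - sint (fun w => g w / (w - z)) (Q n) (Q n.+1)) - g z * winding) <= e.
Proof.
move=> cz e0; have [rho0 rho1] := andP (contour_rho HQ).
have z1 := cone_Re1 (cone_sa_sb cz).
have B0 : 0 <= B := le_trans (mod_ge0 _) (hB (cone_sa_sb cz)).
pose k := ReC (1 - Q K).
have k0 : 0 < k by exact: (cone_Re1 (node_cone true K)).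
pose C := 4 * B / Num.sqrt k / ReC (1 - z) + 1.
have C0 : 0 < C by rewrite ltr_wpDl // !mulr_ge0 ?invr_ge0 ?sqrtr_ge0 // ltW.
have rho01 : 0 <= rho < 1 by rewrite (ltW rho0).
(* [m1] makes the square root of [rho ^+ m] at most [e / C]; [m2] places the closing edge to the
   right of [z], at distance at least [ReC (1 - z) / 2]. *)
have [m1 m1P] := expr_small rho01 (exprn_gt0 2 (divr_gt0 e0 C0)).
have [m2 m2P] := expr_small rho01 (divr_gt0 z1 (ltr0n _ 2)).
exists (K + (m1 + m2))%N => M KM.
have [m mE] : exists m, M = (K + m)%N.
  by exists (M - K)%N; rewrite subnKC // (leq_trans _ KM) // leq_addr.
move: KM; rewrite {}mE leq_add2l => mm {M}; set M := (K + m)%N.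
set r := rho ^+ m.
have r0 : 0 < r by rewrite exprn_gt0.
have r1 : r <= (e / C) ^+ 2 by apply: m1P; rewrite (leq_trans _ mm) // leq_addr.
have r2 : r <= ReC (1 - z) / 2 by apply: m2P; rewrite (leq_trans _ mm) // leq_addl.
have QE : 1 - Q M = r%:C * (1 - Q K) by exact: (contour_tail HQ).
have ReQ : ReC (1 - Q M) = r * k by rewrite QE ReMr.
have k1 : k <= 1 by rewrite /k ReD ReN /=; have [? _] := contour_quadrant HQ; lra.
have zM : ReC (1 - z) / 2 <= ReC (Q M) - ReC z.
  move: ReQ r2 z1; rewrite !ReD !ReN /=.
  have : r * k <= r by rewrite ler_piMr // ltW.
  by lra.
have KM : (K <= M)%N by rewrite leq_addr.
have := contour_cauchy cz KM; rewrite -subr_gt0 => /(_ (lt_le_trans (divr_gt0 z1 (ltr0n _ 2)) zM)).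
rewrite /cyc => <-; rewrite opprD addrA subrr sub0r modN.
apply: (@le_trans _ _ (normc (Q M - P M) * (B / Num.sqrt (r * k) / (ReC (1 - z) / 2)))).
  apply: sint_mod => t t01.
  have ce : cone sb (pt (P M) (Q M) t).
    by apply: cvx_cone => //; [exact: (node_cone false)|exact: (node_cone true)].
  have Rp : ReC (pt (P M) (Q M) t) = ReC (Q M).
    by rewrite /pt ReD ReMr ReD ReN ReJ; ring.
  rewrite modM modV; apply: ler_pM; rewrite ?mod_ge0 ?invr_ge0 ?mod_ge0 //.
    apply: weight_bound => //; first by rewrite mulr_gt0.
    by rewrite -ReQ !ReD !ReN Rp.
  have far : ReC (1 - z) / 2 <= normc (pt (P M) (Q M) t - z).
    by rewrite (le_trans zM) // (le_trans _ (ler_Re _)) // ReD ReN Rp.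
  have z20 : 0 < ReC (1 - z) / 2 := divr_gt0 z1 (ltr0n _ 2).
  by rewrite lef_pV2 ?posrE // (lt_le_trans z20 far).
have PQ : normc (Q M - P M) <= 2 * r.
  have -> : Q M - P M = (- r)%:C * ((1 - Q K) - (1 - P K)).
    have QE' : 1 - P M = r%:C * (1 - P K).
      by rewrite -[1]/((1 : R)%:C) -(conj_real 1) -!conjB QE conjM conj_real.
    have -> : Q M - P M = - ((1 - Q M) - (1 - P M)) by ring.
    by rewrite QE QE' rmorphN; ring.
  have -> : (1 - Q K) - (1 - P K) = (0 +i* (- (2 * ImC (Q K)))) :> R[i].
    by apply: complex_eqP; rewrite !(ReD, ImD, ReN, ImN, ReJ, ImJ) /=; ring.
  rewrite modM mod_real normrN gtr0_norm // mulrC ler_wpM2r ?(ltW r0) //.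
  rewrite /= expr0n add0r sqrtr_sqr normrN normrM ger0_norm // ler_piMr //.
  rewrite (le_trans (ler_abs_Im _)) //; exact: cone_mod1 (node_cone true K).
apply: (@le_trans _ _ (2 * r * (B / Num.sqrt (r * k) / (ReC (1 - z) / 2)))).
  by rewrite ler_wpM2r // !mulr_ge0 ?invr_ge0 ?mulr_ge0 ?invr_ge0 ?sqrtr_ge0 ?(ltW z1).
have sr : Num.sqrt r <= e / C.
  rewrite -[leRHS]ger0_norm ?(ltW (divr_gt0 e0 C0)) // -sqrtr_sqr ler_wsqrtr //.
have sr0 : 0 < Num.sqrt r by rewrite sqrtr_gt0.
have sk0 : 0 < Num.sqrt k by rewrite sqrtr_gt0.
have rE : r = Num.sqrt r ^+ 2 by rewrite sqr_sqrtr // ltW.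
rewrite sqrtrM ?(ltW r0) // {1}rE.
have E x y b u : 0 < x -> 0 < y -> 0 < b -> 2 * x ^+ 2 * (u / (x * y) / (b / 2)) = x * (4 * u / y / b) :> R.
  by move=> x0 y0 b0; field; rewrite !gt_eqF.
rewrite E //; have -> : 4 * B / Num.sqrt k / ReC (1 - z) = C - 1 by rewrite /C addrK.
apply: (@le_trans _ _ (e / C * C)); last by rewrite divfK // gt_eqF.
apply: (@le_trans _ _ (Num.sqrt r * C)).
  by rewrite ler_wpM2l ?sqrtr_ge0 // lerBlDr lerDl ler01.
by apply: ler_wpM2r => //; exact: ltW.
Qed.

End ContourFormula.

Section Tends.
Variable R : realType.
Implicit Types (u v : nat -> R[i]) (l : R[i]).

Definition tends u l := forall e : R, 0 < e -> exists N, forall n, (N <= n)%N -> normc (u n - l) <= e.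

Lemma tendsD u v l l' : tends u l -> tends v l' -> tends (fun n => u n + v n) (l + l').
Proof.
move=> hu hv e e0; have e2 : 0 < e / 2 by rewrite divr_gt0.
have [N HN] := hu _ e2; have [N' HN'] := hv _ e2.
exists (maxn N N') => n; rewrite geq_max => /andP[/HN h1 /HN' h2].
have -> : u n + v n - (l + l') = (u n - l) + (v n - l') by ring.
by rewrite (le_trans (modD _ _)) // (splitr e) lerD.
Qed.

Lemma tendsZ c u l : tends u l -> tends (fun n => c * u n) (c * l).
Proof.
move=> hu e e0; have k0 : 0 < 1 + normc c by rewrite ltr_pwDl ?mod_ge0.
have [N HN] := hu (e / (1 + normc c)) (divr_gt0 e0 k0).
exists N => n /HN; rewrite ler_pdivlMr // -mulrBr modM => h.
rewrite mulrC (le_trans _ h) // ler_wpM2l ?mod_ge0 // lerDr ler01 //.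
Qed.

Lemma tends_sum (l : nat -> R[i]) (F : nat -> nat -> R[i]) M :
  (forall n, tends (F n) (l n)) -> tends (fun J => \sum_(n < M) F n J) (\sum_(n < M) l n).
Proof.
move=> H; elim: M => [|M IH].
  by move=> e e0; exists 0%N => n _; rewrite !big_ord0 subrr mod0 ltW.
have -> : (fun J => \sum_(n < M.+1) F n J) = (fun J => \sum_(n < M) F n J + F M J).
  by apply/funext => J; rewrite big_ord_recr.
by rewrite big_ord_recr; apply: tendsD.
Qed.

End Tends.

Definition box_sum (V : nmodType) (F : bool -> nat -> nat -> V) (M J : nat) : V :=
  \sum_(n < M) (\sum_(j < J) F false n j + \sum_(j < J) F true n j).

(** * Coefficient functionals and atoms *)

Section Atoms.
Variable R : realType.
Variables (sa sb c0 eps : R) (Q : nat -> R[i]) (K : nat) (rho : R).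
Hypotheses (sa0 : 0 < sa) (sab : sa <= sb) (sb1 : sb < 1) (c00 : 0 < c0) (eps0 : 0 < eps)
  (eps2 : eps <= 1 / 2) (epsc : eps <= c0 / (c0 + 2) / 4).
Hypothesis HQ : contour sa sb c0 eps Q K rho.
Implicit Types (z w : R[i]) (b : bool) (n j : nat).

Local Notation node := (node Q).
Local Notation gap := (gap Q).
Local Notation W := (winding Q K).

Let gap_gt0 n : 0 < gap n. Proof. exact: (gap_gt0 sb1 HQ). Qed.

Definition radius n : R := eps * gap n.
(** Up to the weight's constant this is the size of the integral of [quad b n j] over its edge;
    dividing by it makes the coefficients bounded uniformly in [b], [n], [j]. *)
Definition scale n j : R := Num.sqrt (gap n) * radius n ^+ j.
(* Expanding [1/(z - zeta)] in powers of [z - node b n] gives the terms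
   [coef b n j h * atom b n j zeta]. *)
Definition quad b n j z : R[i] := (z - node b n) ^+ j / csqrt (1 - z).
(** The sign [(-1) ^+ b] is there because [cyc] traverses the upper nodes backwards; [(-1) ^+ j]
    comes from the geometric series. *)
Definition coef b n j (f : R[i] -> R[i]) : R[i] :=
  (-1) ^+ b * (-1) ^+ j / W / (scale n j)%:C *
    sint (fun z => f z * quad b n j z) (node b n) (node b n.+1).
Definition atom b n j z : R[i] :=
  csqrt (1 - z) * (scale n j)%:C / (node b n - z) ^+ j.+1.

Let radius_gt0 n : 0 < radius n. Proof. by rewrite mulr_gt0. Qed.

Lemma seg_cone b n (t : R) : 0 <= t <= 1 -> cone sb (pt (node b n) (node b n.+1) t).
Proof. by move=> t01; apply: cvx_cone => //; exact: (node_cone HQ). Qed.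

Lemma seg_near b n (t : R) : 0 <= t <= 1 ->
  normc (pt (node b n) (node b n.+1) t - node b n) <= radius n.
Proof.
move=> /andP[t0 t1]; rewrite /pt addrC addKr modM mod_real ger0_norm //.
rewrite (le_trans _ (node_step HQ b n)) // ler_piMl ?mod_ge0 //.
Qed.

Lemma weight_seg b n (t : R) : 0 <= t <= 1 ->
  normc (csqrt (1 - pt (node b n) (node b n.+1) t))^-1 <= 2 / Num.sqrt (gap n).
Proof.
move=> t01; set p := pt _ _ t.
have cp : cone sb p by exact: seg_cone.
rewrite modV csqrt_mod; last exact: (cone_Re1 sb1 cp).
(* A quarter of the gap is convenient because its square root is half that of the gap. *)
have h : gap n / 4 <= normc (1 - p).
  have := seg_near b n t01; rewrite -/p /radius => h1.
  have := ler_mod_dist (1 - node b n) (p - node b n).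
  rewrite node_gap (_ : 1 - node b n - (p - node b n) = 1 - p); last by ring.
  have := gap_gt0 n; have : eps * gap n <= 1 / 2 * gap n by rewrite ler_wpM2r // ltW.
  lra.
have g4 : 0 < gap n / 4 by rewrite divr_gt0.
have -> : 2 / Num.sqrt (gap n) = (Num.sqrt (gap n / 4))^-1.
  rewrite sqrtrM ?(ltW (gap_gt0 n)) // (_ : 4^-1 = (2^-1) ^+ 2); last by field.
  by rewrite sqrtr_sqr ger0_norm // invfM invrK mulrC.
by rewrite lef_pV2 ?posrE ?sqrtr_gt0 // ?(lt_le_trans g4 h) // ler_wsqrtr.
Qed.

Lemma quad_seg b n j (t : R) : 0 <= t <= 1 ->
  normc (quad b n j (pt (node b n) (node b n.+1) t)) <= radius n ^+ j * (2 / Num.sqrt (gap n)).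
Proof.
move=> t01; rewrite /quad modM; apply: ler_pM; rewrite ?mod_ge0 ?weight_seg //.
by rewrite modX lerXn2r ?nnegrE ?mod_ge0 ?(ltW (radius_gt0 n)) // seg_near.
Qed.

Lemma integrand_bseg f (B : R) b n j : (forall z, cone sb z -> normc (f z) <= B) ->
  bseg (fun z => f z * quad b n j z) (node b n) (node b n.+1)
    (B * (radius n ^+ j * (2 / Num.sqrt (gap n)))).
Proof.
move=> fB t t01; rewrite modM; apply: ler_pM; rewrite ?mod_ge0 ?quad_seg //.
by apply: fB; exact: seg_cone.
Qed.

Lemma scale_gt0 n j : 0 < scale n j.
Proof. by rewrite mulr_gt0 ?sqrtr_gt0 ?exprn_gt0. Qed.

Lemma coef_bound f (B : R) b n j : (forall z, cone sb z -> normc (f z) <= B) ->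
  normc (coef b n j f) <= (normc W)^-1 * B.
Proof.
move=> fB; have B0 : 0 <= B by apply: le_trans (fB _ (node_cone HQ true 0)); exact: mod_ge0.
rewrite /coef; have := sint_mod (integrand_bseg b n j fB); move: (sint _ _ _) => I hI.
rewrite !modM !modX modN mod1 !expr1n !mul1r !modV mod_real gtr0_norm ?scale_gt0 //.
rewrite -mulrA ler_wpM2l ?invr_ge0 ?mod_ge0 // ler_pdivrMl ?scale_gt0 //.
rewrite (le_trans hI) //.
have h : normc (node b n.+1 - node b n) <= radius n by exact: (node_step HQ).
have sg : 0 < Num.sqrt (gap n) by rewrite sqrtr_gt0.
have r0 := radius_gt0 n.
have k0 : 0 <= B * (radius n ^+ j * (2 / Num.sqrt (gap n))).
  by rewrite !mulr_ge0 ?exprn_ge0 ?invr_ge0 ?(ltW r0) ?(ltW sg).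
rewrite (le_trans (ler_wpM2r k0 h)) //.
have hh : radius n * (2 / Num.sqrt (gap n)) <= Num.sqrt (gap n).
  rewrite mulrA ler_pdivrMr // -expr2 sqr_sqrtr ?(ltW (gap_gt0 n)) // /radius.
  by have := ler_wpM2r (ltW (gap_gt0 n)) eps2; lra.
have -> : radius n * (B * (radius n ^+ j * (2 / Num.sqrt (gap n)))) =
  B * radius n ^+ j * (radius n * (2 / Num.sqrt (gap n))) by ring.
have -> : scale n j * B = B * radius n ^+ j * Num.sqrt (gap n) by rewrite /scale; ring.
by rewrite ler_wpM2l // mulr_ge0 // exprn_ge0 // ltW.
Qed.

Lemma coefL f g (B C : R) c b n j : (forall z, cone sb z -> normc (f z) <= B) ->
  (forall z, cone sb z -> normc (g z) <= C) ->
  coef b n j (fun z => f z + c * g z) = coef b n j f + c * coef b n j g.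
Proof.
move=> fB gC; rewrite /coef.
have -> : sint (fun z => (f z + c * g z) * quad b n j z) (node b n) (node b n.+1) =
  sint (fun z => f z * quad b n j z + c * (g z * quad b n j z)) (node b n) (node b n.+1).
  by apply: sint_eq => t _; ring.
by rewrite (sintL _ (integrand_bseg b n j fB) (integrand_bseg b n j gC)); ring.
Qed.

Lemma sint_sum (F : nat -> R[i] -> R[i]) (c : nat -> R[i]) (B : nat -> R) a a' J :
  (forall j, bseg (F j) a a' (B j)) ->
  (exists C, bseg (fun z => \sum_(j < J) c j * F j z) a a' C) /\
  sint (fun z => \sum_(j < J) c j * F j z) a a' = \sum_(j < J) c j * sint (F j) a a'.
Proof.
move=> HF; elim: J => [|J [[C HC] IH]].
  split; first by exists 0 => t _; rewrite big_ord0 mod0.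
  rewrite big_ord0 -[RHS](sint0 a a'); apply: sint_eq => t _; by rewrite big_ord0.
have E t : \sum_(j < J.+1) c j * F j (pt a a' t) = \sum_(j < J) c j * F j (pt a a' t) + c J * F J (pt a a' t).
  by rewrite big_ord_recr.
split.
  exists (C + normc (c J) * B J) => t t01; rewrite E.
  exact: (bsegL (c J) HC (HF J)).
rewrite big_ord_recr /= -IH -(sintL _ HC (HF J)).
by apply: sint_eq => t _; rewrite E.
Qed.

Lemma geometric_inv (D x : R[i]) J : D != 0 -> D + x != 0 ->
  \sum_(j < J) (-1) ^+ j / D ^+ j.+1 * x ^+ j - (D + x)^-1 = - ((- x / D) ^+ J / (D + x)).
Proof.
move=> D0 Dx0; elim: J => [|J IH]; first by rewrite big_ord0 expr0 sub0r mul1r.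
rewrite big_ord_recr /= addrAC IH.
have -> : (-1) ^+ J / D ^+ J.+1 * x ^+ J = (- x / D) ^+ J / D.
  rewrite -[- x]mulN1r !exprMn exprVn exprS invfM; ring.
by rewrite exprS; field; rewrite D0 Dx0.
Qed.

Let wt (h : R[i] -> R[i]) z := h z / csqrt (1 - z).

(** The purpose of [epsc]: the expansion about a node has ratio at most 1/4, which leaves a factor
    1/2 for each of [psi] and [psit]. *)
Lemma radius_far b n z : cone sa z -> radius n <= normc (node b n - z) / 4.
Proof.
move=> cz; have far := node_far c00 HQ b n cz.
have cc : 0 < c0 / (c0 + 2) by rewrite divr_gt0 // addr_gt0.
have v0 : 0 <= normc (1 - z) := mod_ge0 _.
rewrite ler_pdivlMr // (le_trans _ far) // /radius.
apply: (@le_trans _ _ (c0 / (c0 + 2) / 4 * gap n * 4)).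
  by rewrite ler_wpM2r // ler_wpM2r // ltW.
rewrite (_ : _ * 4 = c0 / (c0 + 2) * gap n); last by field; rewrite gt_eqF ?addr_gt0.
by rewrite ler_wpM2l ?(ltW cc) // lerDl.
Qed.

(** The geometric remainder is at most [(1 / 4) ^+ J] times a bound that is uniform on the edge, so
    [sint_mod] justifies integrating term by term. *)
Lemma edge_series (h : R[i] -> R[i]) (B : R) b n z :
  (forall z, cone sb z -> normc (h z) <= B) -> cone sa z ->
  tends (fun J => \sum_(j < J) ((-1) ^+ j / (node b n - z) ^+ j.+1) *
     sint (fun w => h w * quad b n j w) (node b n) (node b n.+1))
   (sint (fun w => wt h w / (w - z)) (node b n) (node b n.+1)).
Proof.
move=> hB cz; set q := node b n; set q' := node b n.+1.
have B0 : 0 <= B by apply: le_trans (hB _ (node_cone HQ true 0)); exact: mod_ge0.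
set D := q - z; have far := node_far c00 HQ b n cz.
have cc : 0 < c0 / (c0 + 2) by rewrite divr_gt0 // addr_gt0.
have v0 : 0 <= normc (1 - z) := mod_ge0 _.
have D4 : radius n <= normc D / 4 by exact: radius_far.
have Dp : 0 < normc D.
  by have := radius_gt0 n; move: D4; move: (radius n) (normc D) => x y; lra.
have D0 : D != 0 by rewrite -mod_gt0.
have inv_far t : 0 <= t <= 1 -> normc D / 2 <= normc (pt q q' t - z).
  move=> t01; have := seg_near b n t01; rewrite -/q -/q' => h1.
  have := ler_mod_dist D (q - pt q q' t).
  rewrite (_ : D - (q - pt q q' t) = pt q q' t - z); last by rewrite /D; ring.
  rewrite [normc (q - _)]modBC; move: h1 D4 Dp; move: (normc _) (radius n) (normc D) => x y w; lra.
have G0 : 0 <= B * (2 / Num.sqrt (gap n)).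
  by rewrite !mulr_ge0 // invr_ge0 sqrtr_ge0.
have gB t : 0 <= t <= 1 -> normc (wt h (pt q q' t)) <= B * (2 / Num.sqrt (gap n)).
  move=> t01; rewrite /wt modM; apply: ler_pM; rewrite ?mod_ge0 ?weight_seg //.
  by apply: hB; exact: seg_cone.
have Dinv t : 0 <= t <= 1 -> normc (pt q q' t - z)^-1 <= 2 / normc D.
  move=> t01; rewrite modV -[leRHS]invrK invf_div.
  by rewrite lef_pV2 ?posrE ?inv_far ?divr_gt0 // (lt_le_trans _ (inv_far _ t01)) // divr_gt0.
have bg : bseg (fun w => wt h w / (w - z)) q q' (B * (2 / Num.sqrt (gap n)) * (2 / normc D)).
  by move=> t t01; rewrite modM; apply: ler_pM; rewrite ?mod_ge0 ?gB ?Dinv.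
pose CC := normc (q' - q) * (B * (2 / Num.sqrt (gap n)) * (2 / normc D)) + 1.
have CC0 : 0 < CC.
  rewrite ltr_wpDl // mulr_ge0 ?mod_ge0 // mulr_ge0 //.
  by rewrite divr_ge0 ?mod_ge0.
move=> e e0.
have r01 : 0 <= (1 / 4 : R) < 1 by lra.
have [J0 J0P] := expr_small r01 (divr_gt0 e0 CC0).
exists J0 => J /J0P hJ.
have HF j : bseg (fun w => h w * quad b n j w) q q' (B * (radius n ^+ j * (2 / Num.sqrt (gap n)))).
  exact: integrand_bseg.
have [[C HC] <-] := sint_sum (fun j => (-1) ^+ j / D ^+ j.+1) J HF.
rewrite -(sintB HC bg).
apply: (@le_trans _ _ (normc (q' - q) * ((1 / 4) ^+ J * (B * (2 / Num.sqrt (gap n)) * (2 / normc D))))).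
  apply: sint_mod => t t01; set p := pt q q' t.
  have pz : p - z = D + (p - q) by rewrite /D; ring.
  have pz0 : D + (p - q) != 0.
    by rewrite -pz -mod_gt0 (lt_le_trans _ (inv_far _ t01)) // divr_gt0.
  have -> : \sum_(j < J) (-1) ^+ j / D ^+ j.+1 * (h p * quad b n j p) - wt h p / (p - z) =
    wt h p * (- ((- (p - q) / D) ^+ J / (D + (p - q)))).
    rewrite -geometric_inv // pz mulrBr mulr_sumr; congr (_ - _).
    by apply: eq_bigr => j _; rewrite /quad /wt -/q; ring.
  rewrite (modM (wt h p)) modN (modM (_ ^+ J)) modX (modM (- (p - q))) modN -pz mulrCA (modV D).
  apply: ler_pM; rewrite ?exprn_ge0 ?mulr_ge0 ?invr_ge0 ?mod_ge0 //.
    rewrite lerXn2r ?nnegrE ?divr_ge0 ?mod_ge0 // ler_pdivrMr //.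
    by have := seg_near b n t01; rewrite -/q -/q' -/p => h1; rewrite (le_trans h1) // (le_trans D4) // mulrC mul1r.
  by apply: ler_pM; rewrite ?mod_ge0 ?gB ?Dinv.
rewrite mulrCA (le_trans (ler_wpM2l _ (_ : _ <= CC))) ?exprn_ge0 ?lerDl //.
by rewrite -ler_pdivlMr.
Qed.

Lemma coef_atom (f : R[i] -> R[i]) b n j z :
  coef b n j f * atom b n j z = (-1) ^+ b * (csqrt (1 - z) / W) *
    ((-1) ^+ j / (node b n - z) ^+ j.+1 * sint (fun w => f w * quad b n j w) (node b n) (node b n.+1)).
Proof.
rewrite /coef /atom; move: (sint _ _ _) => I.
have sn : (scale n j)%:C != 0 :> R[i] by rewrite fmorph_eq0 gt_eqF ?scale_gt0.
move: (scale n j)%:C sn => s sn.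
rewrite (_ : (-1) ^+ b * (-1) ^+ j / W / s * I * (csqrt (1 - z) * s / (node b n - z) ^+ j.+1) =
  (s / s) * ((-1) ^+ b * (-1) ^+ j / W * I * (csqrt (1 - z) / (node b n - z) ^+ j.+1))); last by ring.
by rewrite divff // mul1r; ring.
Qed.

(** [M] is chosen first, from the truncation of the contour, then [J] for the finitely many edges
    left. This yields arbitrarily large good boxes; absolute summability turns them into convergence
    in [fm_exists]. *)
Lemma box_limit (h : R[i] -> R[i]) (B : R) z (e : R) (N : nat) :
  (forall w, cone sb w -> cdiff h w) -> (forall w, cone sb w -> normc (h w) <= B) ->
  cone sa z -> 0 < e ->
  exists M J, [/\ (N <= M)%N, (N <= J)%N &
    normc (box_sum (fun b n j => coef b n j h * atom b n j z) M J - h z) <= e].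
Proof.
move=> hd hB cz e0.
have W0 : W != 0 by exact: (winding_neq0 sa0 sb1 c00 HQ).
have v0 : csqrt (1 - z) != 0 by apply: csqrt_neq0; apply: (cone_Re1 sb1); exact: (cone_sub sab).
pose k := csqrt (1 - z) / W.
have kn : k != 0 by rewrite mulf_neq0 // invr_eq0.
have k0 : 0 < normc k by rewrite mod_gt0.
have e2 : 0 < e / 2 / normc k by rewrite !divr_gt0.
have [M0 M0P] := contour_limit sa0 sab sb1 c00 HQ hd hB cz e2.
pose M := maxn N M0; have := M0P M (leq_maxr _ _).
set T := \sum_(n < M) _ => hT.
pose E b n J := \sum_(j < J) ((-1) ^+ j / (node b n - z) ^+ j.+1) *
     sint (fun w => h w * quad b n j w) (node b n) (node b n.+1).
pose I b n := sint (fun w => wt h w / (w - z)) (node b n) (node b n.+1).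
have : tends (fun J => \sum_(n < M) (E false n J + (-1) * E true n J)) T.
  have -> : T = \sum_(n < M) (I false n + (-1) * I true n).
    by apply: eq_bigr => n _; rewrite mulN1r.
  apply: (@tends_sum _ (fun n => I false n + (-1) * I true n) (fun n J => E false n J + (-1) * E true n J)).
  move=> n; apply: tendsD; first exact: edge_series hB cz.
  by apply: tendsZ; exact: edge_series hB cz.
move=> /(_ _ e2) [J0 J0P]; exists M, (maxn N J0).
split; rewrite ?leq_maxl //; have := J0P _ (leq_maxr N J0).
set J := maxn N J0; set S := \sum_(n < M) _ => hS.
have -> : box_sum (fun b n j => coef b n j h * atom b n j z) M J = k * S.
  rewrite /box_sum mulr_sumr; apply: eq_bigr => n _; rewrite mulrDr /E !mulr_sumr.
  by congr (_ + _); apply: eq_bigr => j _; rewrite coef_atom /k ?expr0 ?expr1; ring.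
have -> : k * S - h z = k * (S - T) + k * (T - wt h z * W).
  by rewrite /k /wt; field; rewrite W0 v0.
rewrite (le_trans (modD _ _)) // !(modM k) (splitr e) lerD //.
  by rewrite mulrC -ler_pdivlMr.
by rewrite mulrC -ler_pdivlMr.
Qed.

End Atoms.

(** * Uniform summation of two-sided geometric decay *)

Section Profile.
Variable R : realType.
Implicit Types (a x p r y : R).

(** The square root of [sqrt (a x) / (a + x)], the size of an atom at distance [x] from the vertex:
    the share of each of its two factors. *)
Definition profile a x : R := Num.sqrt (Num.sqrt (a * x) / (a + x)).

Lemma profile_ge0 a x : 0 <= profile a x. Proof. exact: sqrtr_ge0. Qed.

Lemma profileC a x : profile a x = profile x a.
Proof. by rewrite /profile [a * x]mulrC [a + x]addrC. Qed.

Lemma profile_le a x : 0 < a -> 0 < x -> profile a x <= powR (a / x) (1 / 4).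
Proof.
move=> a0 x0; have ax : 0 < a / x by rewrite divr_gt0.
have -> : powR (a / x) (1 / 4) = Num.sqrt (Num.sqrt (a / x)).
  by rewrite -(powR12_sqrt (sqrtr_ge0 _)) -(powR12_sqrt (ltW ax)) -powRrM; congr powR; field.
rewrite /profile ler_wsqrtr //.
have -> : a * x = (a / x) * x ^+ 2 by field; rewrite gt_eqF.
rewrite sqrtrM ?(ltW ax) // sqrtr_sqr gtr0_norm // ler_pdivrMr ?addr_gt0 //.
by rewrite ler_wpM2l ?sqrtr_ge0 // lerDr ltW.
Qed.

Lemma profile_le1 a x : 0 < a -> 0 < x -> profile a x <= 1.
Proof.
move=> a0 x0; have s0 : 0 < a + x by rewrite addr_gt0.
rewrite /profile -[leRHS]sqrtr1 ler_wsqrtr // ler_pdivrMr // mul1r.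
rewrite -[leRHS]gtr0_norm // -sqrtr_sqr ler_wsqrtr //.
have := sqr_ge0 a; have := sqr_ge0 x; have := mulr_gt0 a0 x0; lra.
Qed.

Lemma profile_powR a x p : 0 < a -> 0 < x -> 0 < p ->
  powR (profile a x) p <= powR (a / x) (p / 4) /\ powR (profile a x) p <= (powR (a / x) (p / 4))^-1.
Proof.
move=> a0 x0 p0.
have ax : 0 < a / x by rewrite divr_gt0.
have H b y : 0 < b -> 0 < y -> powR (profile b y) p <= powR (b / y) (p / 4).
  move=> b0 y0; have -> : p / 4 = 1 / 4 * p by field.
  rewrite powRrM ge0_ler_powR ?nnegrE ?profile_ge0 ?powR_ge0 ?profile_le //; exact: ltW.
split; first exact: H.
rewrite profileC -powRN; apply: le_trans (H _ _ x0 a0) _.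
have -> : x / a = powR (a / x) (-1) by rewrite powR_inv1 ?invf_div // ltW.
rewrite -powRrM.
by rewrite mulN1r.
Qed.

(** The terms decay geometrically on both sides of the index where [y * r ^+ m] crosses 1. The bound
    does not involve [y]; this is the source of uniformity in the point. *)
Lemma two_sided_geometric r (M : nat) (t : nat -> R) y : 0 < r < 1 -> 0 < y ->
  (forall m, t m <= y * r ^+ m) -> (forall m, t m <= (y * r ^+ m)^-1) ->
  \sum_(m < M) t m <= 2 / (1 - r).
Proof.
move=> /andP[r0 r1]; have d0 : 0 < 1 - r by rewrite subr_gt0.
have small (u : nat -> R) (z : R) N : 0 < z -> (forall m, u m <= z * r ^+ m) -> \sum_(m < N) u m <= z / (1 - r).
  move=> z0 hu; apply: (@le_trans _ _ (\sum_(m < N) z * r ^+ m)); first by apply: ler_sum.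
  rewrite -mulr_sumr ler_wpM2l ?(ltW z0) // -(ler_pM2r d0) mulVf ?gt_eqF //.
  have := subrX1 r N; have : 0 <= r ^+ N by rewrite exprn_ge0 // ltW.
  by move: (\sum_(i < N) r ^+ i) (r ^+ N) => S q; lra.
have [c1|c1] := lerP y 1.
  move=> y0 h1 _; rewrite (le_trans (small t y M y0 h1)) // ler_wpM2r ?invr_ge0 ?(ltW d0) //.
  lra.
(* The claim is sharpened by [- y^-1] so that the induction passes from [y] to [y * r]: the first
   term is at most [y^-1]. *)
move=> y0; suff : (forall m, t m <= y * r ^+ m) -> (forall m, t m <= (y * r ^+ m)^-1) ->
  \sum_(m < M) t m <= (2 - y^-1) / (1 - r).
  move=> h h1 h2; rewrite (le_trans (h h1 h2)) // ler_wpM2r ?invr_ge0 ?(ltW d0) //.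
  have iy : 0 < y^-1 by rewrite invr_gt0.
  by lra.
elim: M t y c1 y0 => [|M IH] t y c1 y0 h1 h2.
  rewrite big_ord0 divr_ge0 ?(ltW d0) // subr_ge0 (le_trans (_ : _ <= 1)) ?ler1n //.
  by rewrite invf_le1 // ltW.
rewrite big_ord_recl /=.
have t0 : t 0%N <= y^-1 by have := h2 0%N; rewrite expr0 mulr1.
have g1 m : t m.+1 <= y * r * r ^+ m by rewrite -mulrA -exprS.
have g2 m : t m.+1 <= (y * r * r ^+ m)^-1 by rewrite -mulrA -exprS.
have yr0 : 0 < y * r by rewrite mulr_gt0.
rewrite ler_pdivlMr //.
have [c2|c2] := lerP (y * r) 1.
  have := small (fun m => t m.+1) (y * r) M yr0 g1; rewrite ler_pdivlMr // => h3.
  rewrite mulrDl (le_trans (lerD (ler_wpM2r (ltW d0) t0) h3)) //.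
  have yy : y * y^-1 = 1 by rewrite divff // gt_eqF.
  have iy0 : 0 < y^-1 by rewrite invr_gt0.
  rewrite -subr_ge0.
  have -> : 2 - y^-1 - (y^-1 * (1 - r) + y * r) = y^-1 * ((y - 1) * (2 - r - y * r)).
    by field; rewrite gt_eqF.
  apply: mulr_ge0; first exact: ltW.
  by apply: mulr_ge0; lra.
have := IH (fun m => t m.+1) (y * r) c2 yr0 g1 g2; rewrite ler_pdivlMr // => h3.
rewrite mulrDl (le_trans (lerD (ler_wpM2r (ltW d0) t0) h3)) //.
rewrite invfM.
have iy0 : 0 < y^-1 by rewrite invr_gt0.
have ir : 1 <= r^-1 by rewrite invf_ge1 // ltW.
have ir2 : r^-1 * r = 1 by rewrite mulVf // gt_eqF.
rewrite -subr_ge0.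
have -> : 2 - y^-1 - (y^-1 * (1 - r) + (2 - y^-1 / r)) = y^-1 * ((1 - r) ^+ 2 / r).
  by field; rewrite !gt_eqF.
by rewrite mulr_ge0 ?(ltW iy0) // divr_ge0 ?sqr_ge0 ?(ltW r0).
Qed.

End Profile.

Lemma powR_one (R : realType) (p : R) : powR 1 p = 1.
Proof. by rewrite powR1. Qed.

Lemma powR_exp (R : realType) (a p : R) n : 0 <= a -> powR (a ^+ n) p = powR a p ^+ n.
Proof.
by move=> a0; rewrite -(powR_mulrn n a0) -(powR_mulrn n (powR_ge0 a p)) -!powRrM mulrC.
Qed.

(** * Factorization of the atoms *)

Section AtomFactors.
Variable R : realType.
Variables (sa sb c0 eps : R) (Q : nat -> R[i]) (K : nat) (rho : R).
Hypotheses (sa0 : 0 < sa) (sab : sa <= sb) (sb1 : sb < 1) (c00 : 0 < c0) (eps0 : 0 < eps)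
  (eps2 : eps <= 1 / 2) (epsc : eps <= c0 / (c0 + 2) / 4).
Hypothesis HQ : contour sa sb c0 eps Q K rho.
Implicit Types (z w : R[i]) (b : bool) (n j : nat).

Local Notation node := (node Q).
Local Notation gap := (gap Q).

Let gap_gt0 n : 0 < gap n. Proof. exact: (gap_gt0 sb1 HQ). Qed.

Definition root4 n : R := Num.sqrt (Num.sqrt (gap n)).

(* The factor [sqrt (gap + v)] is moved between [psi] and [psit] so that both decay as [v]
   becomes large or small compared with [gap]. *)
Definition psi n j z : R[i] :=
  csqrt (csqrt (1 - z)) * (root4 n * 2^-1 ^+ j)%:C / csqrt ((gap n)%:C + (1 - z)).

(** The factor 2 in the power compensates [2^-1 ^+ j] in [psi]; by [radius_far] the quotient still
    decays like [2^-1 ^+ j]. *)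
Definition psit b n j z : R[i] :=
  csqrt (csqrt (1 - z)) * csqrt ((gap n)%:C + (1 - z)) *
    (root4 n * (2 * radius eps Q n) ^+ j)%:C / (node b n - z) ^+ j.+1.

Section Point.
Variable z : R[i].
Hypothesis cz : cone sa z.

Lemma Re_v : 0 < ReC (1 - z).
Proof. by apply: (cone_Re1 sb1); exact: cone_sub cz. Qed.

Lemma mod_v : 0 < normc (1 - z).
Proof. by rewrite (lt_le_trans Re_v) // ler_Re. Qed.

Lemma Re_gap_v n : 0 < ReC ((gap n)%:C + (1 - z)).
Proof. by rewrite ReD /= addr_gt0 ?Re_v. Qed.

Lemma node_sub_neq0 b n : node b n - z != 0.
Proof.
rewrite -mod_gt0 (lt_le_trans _ (node_far c00 HQ b n cz)) //.
by rewrite mulr_gt0 ?divr_gt0 ?addr_gt0 ?mod_v.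
Qed.

Lemma psi_psit b n j : psi n j z * psit b n j z = atom eps Q b n j z.
Proof.
have e1 : csqrt (1 - z) = csqrt (csqrt (1 - z)) ^+ 2 by rewrite csqrt_sqr // csqrt_Re_gt0 // Re_v.
have gn := csqrt_neq0 (Re_gap_v n).
have r2 : Num.sqrt (gap n) = root4 n ^+ 2 by rewrite sqr_sqrtr // sqrtr_ge0.
have p2 : 2^-1 ^+ j * (2 * radius eps Q n) ^+ j = radius eps Q n ^+ j.
  by rewrite -exprMn mulrA mulVf ?mul1r.
rewrite /psi /psit /atom /scale [in RHS]e1 r2 -p2 !expr2 !rmorphM /=.
move: (csqrt (csqrt (1 - z))) (csqrt ((gap n)%:C + (1 - z))) gn => u g gn.
move: (root4 n)%:C ((2^-1 ^+ j)%:C) (((2 * radius eps Q n) ^+ j)%:C) => r s t.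
move: (((node b n - z) ^+ j.+1)^-1) => d.
by field.
Qed.

Lemma psi_cdiff n j : cdiff (psi n j) z.
Proof.
have dv : cdiff (fun w => 1 - w) z by apply: cdiff_eq (cdiff_affine 1 (-1) z) => w; rewrite mulN1r.
have dg : cdiff (fun w => (gap n)%:C + (1 - w)) z by apply: cdiffD => //; exact: cdiff_cst.
apply: cdiffM; last first.
  apply: cdiff_inv; last by apply: csqrt_neq0; exact: Re_gap_v.
  by apply: cdiff_comp dg _; apply: cdiff_csqrt; exact: Re_gap_v.
apply: cdiffM; last exact: cdiff_cst.
apply: cdiff_comp; last by apply: cdiff_csqrt; apply: csqrt_Re_gt0; exact: Re_v.
by apply: cdiff_comp dv _; apply: cdiff_csqrt; exact: Re_v.
Qed.

Lemma psit_cdiff b n j : cdiff (psit b n j) z.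
Proof.
have dv : cdiff (fun w => 1 - w) z by apply: cdiff_eq (cdiff_affine 1 (-1) z) => w; rewrite mulN1r.
have dg : cdiff (fun w => (gap n)%:C + (1 - w)) z by apply: cdiffD => //; exact: cdiff_cst.
apply: cdiffM; last first.
  apply: cdiff_inv; last by rewrite expf_neq0 // node_sub_neq0.
  by apply: cdiffX; apply: cdiff_eq (cdiff_affine (node b n) (-1) z) => w; rewrite mulN1r.
apply: cdiffM; last exact: cdiff_cst.
apply: cdiffM; last by apply: cdiff_comp dg _; apply: cdiff_csqrt; exact: Re_gap_v.
apply: cdiff_comp; last by apply: cdiff_csqrt; apply: csqrt_Re_gt0; exact: Re_v.
by apply: cdiff_comp dv _; apply: cdiff_csqrt; exact: Re_v.
Qed.

(** One constant for both factors: the 2 comes from [mod_gap_v] and serves [psi], the quotient comes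
    from [node_far] and serves [psit]. *)
Definition factor_bound : R := 2 + (c0 + 2) / c0.

Lemma factor_bound_gt0 : 0 < factor_bound.
Proof. by rewrite /factor_bound addr_gt0 // divr_gt0 // addr_gt0. Qed.

Let x := normc (1 - z).

Lemma mod_root4 n : normc (csqrt (csqrt (1 - z))) * root4 n = Num.sqrt (Num.sqrt (gap n * x)).
Proof.
rewrite csqrt_mod ?csqrt_Re_gt0 ?Re_v // csqrt_mod ?Re_v //.
by rewrite /root4 sqrtrM ?(ltW (gap_gt0 n)) // sqrtrM ?sqrtr_ge0 // mulrC.
Qed.

(** No cancellation can occur, since [gap n] and [1 - z] both lie in the right half-plane. *)
Lemma mod_gap_v n : (gap n + x) / 4 <= normc ((gap n)%:C + (1 - z)) <= gap n + x.
Proof.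
have g0 := gap_gt0 n; have x0 : 0 < x := mod_v.
apply/andP; split; last by rewrite (le_trans (modD _ _)) // mod_real gtr0_norm.
rewrite -(@ler_pXn2r _ 2%N) ?nnegrE ?mod_ge0 ?divr_ge0 ?addr_ge0 ?(ltW g0) ?(ltW x0) //.
have xE : x ^+ 2 = ReC (1 - z) ^+ 2 + ImC (1 - z) ^+ 2 := mod_sqr _.
rewrite (mod_sqr ((gap n)%:C + (1 - z))) (ReD (gap n)%:C) (ImD (gap n)%:C) [ReC _%:C]/= [ImC _%:C]/=.
have := mulr_gt0 g0 Re_v; have := sqr_ge0 (gap n - x); have := sqr_ge0 (gap n).
have := sqr_ge0 x; move: xE.
by move: (ReC (1 - z)) (ImC (1 - z)) (gap n) x => a c g y; lra.
Qed.

Lemma profile_split n : profile (gap n) x = Num.sqrt (Num.sqrt (gap n * x)) / Num.sqrt (gap n + x).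
Proof. by rewrite /profile sqrtrM ?sqrtr_ge0 // sqrtrV // addr_ge0 ?(ltW (gap_gt0 n)) ?mod_ge0. Qed.

Lemma psi_mod n j : normc (psi n j z) <= factor_bound * profile (gap n) x * 2^-1 ^+ j.
Proof.
have [h1 _] := andP (mod_gap_v n).
have s0 : 0 < gap n + x by rewrite addr_gt0 ?mod_v.
have q0 : 0 < 2^-1 ^+ j :> R by rewrite exprn_gt0.
have r0 : 0 <= root4 n := sqrtr_ge0 _.
have -> : normc (psi n j z) = normc (csqrt (csqrt (1 - z))) *
    normc (root4 n * 2^-1 ^+ j)%:C / normc (csqrt ((gap n)%:C + (1 - z))).
  by rewrite -modV -!modM.
rewrite mod_real ger0_norm ?mulr_ge0 ?(ltW q0) //.
rewrite mulrA mod_root4 csqrt_mod ?Re_gap_v // mulrAC ler_wpM2r ?(ltW q0) //.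
rewrite profile_split mulrCA ler_wpM2l ?sqrtr_ge0 //.
have s4 : 0 < (gap n + x) / 4 by rewrite divr_gt0.
apply: (@le_trans _ _ (Num.sqrt ((gap n + x) / 4))^-1).
  by rewrite lef_pV2 ?posrE ?sqrtr_gt0 ?(lt_le_trans s4 h1) // ler_wsqrtr.
have -> : 4^-1 = 2^-1 ^+ 2 :> R by field.
rewrite sqrtrM ?(ltW s0) // sqrtr_sqr ger0_norm // invfM invrK mulrC.
rewrite ler_wpM2r ?invr_ge0 ?sqrtr_ge0 // /factor_bound lerDl.
by rewrite divr_ge0 ?addr_ge0 // ltW.
Qed.

Lemma psit_mod b n j : normc (psit b n j z) <= factor_bound * profile (gap n) x * 2^-1 ^+ j.
Proof.
have [_ h1] := andP (mod_gap_v n).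
have s0 : 0 < gap n + x by rewrite addr_gt0 ?mod_v.
have q0 : 0 < 2^-1 ^+ j :> R by rewrite exprn_gt0.
have r0 : 0 <= root4 n := sqrtr_ge0 _.
have rad0 : 0 < radius eps Q n by rewrite mulr_gt0.
have rad2 : 0 <= 2 * radius eps Q n by rewrite mulr_ge0 // ltW.
have far := node_far c00 HQ b n cz; rewrite -/x in far.
have rf := radius_far sb1 c00 epsc HQ b n cz.
have D0 : 0 < normc (node b n - z) by rewrite mod_gt0 node_sub_neq0.
have -> : normc (psit b n j z) = normc (csqrt (csqrt (1 - z))) * normc (csqrt ((gap n)%:C + (1 - z))) *
    normc (root4 n * (2 * radius eps Q n) ^+ j)%:C / normc ((node b n - z) ^+ j.+1).
  by rewrite -modV -!modM.
rewrite mod_real ger0_norm; last by rewrite mulr_ge0 ?exprn_ge0.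
rewrite (modX (node b n - z) j.+1) (csqrt_mod (Re_gap_v n)) exprS.
set N := normc (node b n - z) in far rf D0 *.
set S := Num.sqrt (normc _).
have -> : normc (csqrt (csqrt (1 - z))) * S * (root4 n * (2 * radius eps Q n) ^+ j) / (N * N ^+ j) =
  (normc (csqrt (csqrt (1 - z))) * root4 n) * (S / N) * ((2 * radius eps Q n) / N) ^+ j.
  by rewrite [(_ / N) ^+ j]exprMn exprVn invfM; ring.
rewrite mod_root4; apply: ler_pM.
- by rewrite !mulr_ge0 ?sqrtr_ge0 // invr_ge0 ltW.
- by rewrite exprn_ge0 // divr_ge0 // ltW.
- rewrite profile_split [leRHS]mulrCA ler_wpM2l ?sqrtr_ge0 //.
  have cc : 0 < c0 / (c0 + 2) by rewrite divr_gt0 // addr_gt0.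
  have sE : (Num.sqrt (gap n + x))^-1 = Num.sqrt (gap n + x) / (gap n + x).
    have sp : 0 < Num.sqrt (gap n + x) by rewrite sqrtr_gt0.
    rewrite -[X in _ / X]sqr_sqrtr ?(ltW s0) //; field; rewrite gt_eqF //.
  apply: (@le_trans _ _ (Num.sqrt (gap n + x) / (c0 / (c0 + 2) * (gap n + x)))).
    apply: ler_pM; rewrite ?sqrtr_ge0 ?invr_ge0 ?(ltW D0) ?ler_wsqrtr //.
    rewrite lef_pV2 ?posrE //; exact: mulr_gt0.
  rewrite sE invfM mulrCA invf_div ler_wpM2r //.
    by rewrite divr_ge0 ?sqrtr_ge0 ?(ltW s0).
  by rewrite /factor_bound lerDr.
- rewrite lerXn2r ?nnegrE ?(divr_ge0 rad2 (ltW D0)) //.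
  rewrite ler_pdivrMr //; move: rf; rewrite -/N; lra.
Qed.

End Point.

Lemma psi_Hinf0_bound (F : R[i] -> R[i]) n j : (forall z, cone sa z ->
    normc (F z) <= factor_bound * profile (gap n) (normc (1 - z)) * 2^-1 ^+ j) ->
  (exists M : R, forall z, cone sa z -> normc (F z) <= M) /\
  exists c s : R, [/\ 0 < c, 0 < s & forall z, cone sa z -> normc (F z) <= c * powR (normc (1 - z)) s].
Proof.
move=> HF; have f0 := factor_bound_gt0; have g0 := gap_gt0 n.
have q1 : 2^-1 ^+ j <= 1 :> R by rewrite exprn_ile1 // invf_le1 // ler1n.
have H z : cone sa z -> normc (F z) <= factor_bound * profile (gap n) (normc (1 - z)).
  move=> cz; rewrite (le_trans (HF z cz)) // ler_piMr // mulr_ge0 ?profile_ge0 //; exact: ltW.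
split.
  exists factor_bound => z cz; rewrite (le_trans (H z cz)) // ler_piMr ?(ltW f0) //.
  by apply: profile_le1 => //; exact: mod_v.
exists (factor_bound * powR (gap n)^-1 (1 / 4)), (1 / 4).
split; [by rewrite mulr_gt0 // powR_gt0 // invr_gt0|by rewrite divr_gt0|].
move=> z cz; rewrite (le_trans (H z cz)) // -mulrA ler_wpM2l ?(ltW f0) //.
have x0 := mod_v cz.
rewrite profileC (le_trans (profile_le x0 g0)) // mulrC powRM ?invr_ge0 ?(ltW g0) ?(ltW x0) //.
Qed.

Lemma gap_tail m : gap (K + m)%N = gap K * rho ^+ m.
Proof.
have [r0 _] := andP (contour_rho HQ).
by rewrite /gap (contour_tail HQ) modM mod_real gtr0_norm ?exprn_gt0 // mulrC.
Qed.

(** The nodes before [K] contribute at most 1 each; from [K] on the gaps form a geometric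
    progression and [two_sided_geometric] applies with ratio [powR rho (p / 4)]. *)
Lemma profile_sum (p : R) : 0 < p -> exists2 S : R, 0 <= S & forall (x : R) M, 0 < x ->
  \sum_(n < M) powR (profile (gap n) x) p <= S.
Proof.
move=> p0; have [r0 r1] := andP (contour_rho HQ).
pose r := powR rho (p / 4).
have rp : 0 < r < 1.
  rewrite powR_gt0 //= /r -[ltRHS](powR_one (p / 4)).
  by rewrite gt0_ltr_powR ?nnegrE ?divr_gt0 // ?(ltW r0).
have d0 : 0 < 1 - r by case/andP: rp => _; rewrite subr_gt0.
exists (K%:R + 2 / (1 - r)); first by rewrite addr_ge0 // divr_ge0 // ltW.
move=> x M x0.
have pos n : 0 <= powR (profile (gap n) x) p by exact: powR_ge0.
apply: (@le_trans _ _ (\sum_(n < K + M) powR (profile (gap n) x) p)).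
  rewrite -!(big_mkord xpredT (fun n => powR (profile (gap n) x) p)).
  rewrite [leRHS](big_cat_nat _ (n := M)) ?leq_addl //= lerDl.
  by apply: sumr_ge0 => n _.
rewrite big_split_ord /= lerD //.
  have -> : K%:R = \sum_(n < K) (1 : R) by rewrite sumr_const card_ord.
  apply: ler_sum => n _; rewrite -[leRHS](powR_one p) ge0_ler_powR ?nnegrE ?profile_ge0 ?(ltW p0) //.
  exact: profile_le1.
have yr m : powR (gap K / x) (p / 4) * r ^+ m = powR (gap (K + m)%N / x) (p / 4).
  have h1 : 0 <= gap K / x := divr_ge0 (ltW (gap_gt0 K)) (ltW x0).
  have h2 : 0 <= rho ^+ m by rewrite exprn_ge0 // ltW.
  by rewrite gap_tail mulrAC (powRM _ h1 h2) (powR_exp _ _ (ltW r0)).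
apply: (@two_sided_geometric _ r M (fun m => powR (profile (gap (K + m)%N) x) p) (powR (gap K / x) (p / 4)) rp).
- by rewrite powR_gt0 // divr_gt0.
- by move=> m; rewrite yr; have [] := @profile_powR _ (gap (K + m)%N) x p (gap_gt0 _) x0 p0.
- by move=> m; rewrite yr; have [] := @profile_powR _ (gap (K + m)%N) x p (gap_gt0 _) x0 p0.
Qed.

Lemma power_box_sum (p : R) : 0 < p -> exists S : R, forall (F : bool -> nat -> nat -> R[i] -> R[i]),
  (forall b n j z, cone sa z ->
    normc (F b n j z) <= factor_bound * profile (gap n) (normc (1 - z)) * 2^-1 ^+ j) ->
  forall z M J, cone sa z -> box_sum (fun b n j => powR (normc (F b n j z)) p) M J <= S.
Proof.
move=> p0; have [S S0 HS] := profile_sum p0.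
have f0 := ltW factor_bound_gt0.
pose r := powR (2^-1 : R) p.
have rp : 0 < r < 1.
  rewrite powR_gt0 ?invr_gt0 //= /r -[ltRHS](powR_one p).
  by rewrite gt0_ltr_powR ?nnegrE // invf_lt1 // ltr1n.
have [rp0 rp1] := andP rp; have d0 : 0 < 1 - r by rewrite subr_gt0.
pose A := powR factor_bound p; have A0 : 0 <= A := powR_ge0 _ _.
exists (2 * (A / (1 - r)) * S) => F HF z M J cz.
have x0 := mod_v cz.
have term b n : \sum_(j < J) powR (normc (F b n j z)) p <= A / (1 - r) * powR (profile (gap n) (normc (1 - z))) p.
  have -> : A / (1 - r) * powR (profile (gap n) (normc (1 - z))) p =
     A * powR (profile (gap n) (normc (1 - z))) p / (1 - r) by ring.
  apply: (@le_trans _ _ (\sum_(j < J) A * powR (profile (gap n) (normc (1 - z))) p * r ^+ j)).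
    apply: ler_sum => j _.
    apply: (@le_trans _ _ (powR (factor_bound * profile (gap n) (normc (1 - z)) * 2^-1 ^+ j) p)).
      rewrite ge0_ler_powR ?nnegrE ?mod_ge0 ?(ltW p0) ?HF //.
      by rewrite !mulr_ge0 ?profile_ge0 ?exprn_ge0.
    rewrite !powRM ?mulr_ge0 ?profile_ge0 ?exprn_ge0 //.
    by rewrite powR_exp ?invr_ge0.
  rewrite -mulr_sumr ler_wpM2l ?mulr_ge0 ?powR_ge0 // -(ler_pM2r d0) mulVf ?gt_eqF //.
  have := subrX1 r J; have : 0 <= r ^+ J by rewrite exprn_ge0 // ltW.
  by move: (\sum_(i < J) r ^+ i) (r ^+ J) => T q; lra.
apply: (@le_trans _ _ (\sum_(n < M) 2 * (A / (1 - r)) * powR (profile (gap n) (normc (1 - z))) p)).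
  apply: ler_sum => n _; have := lerD (term false n) (term true n).
  set P := powR _ p; have -> : 2 * (A / (1 - r)) * P = A / (1 - r) * P + A / (1 - r) * P by ring.
  exact.
by rewrite -mulr_sumr ler_wpM2l ?HS // mulr_ge0 // divr_ge0 // ltW.
Qed.

End AtomFactors.

(** * Enumeration of the triple indices by natural numbers *)

Section Reindexing.

(* [pickle_inv] rather than [unpickle]: no index may be hit twice. *)
Definition decode (i : nat) : option (bool * nat * nat) := pickle_inv i.

(** Numbers that code no triple give 0, which is harmless: the zero function belongs to [Hinf0]. *)
Definition flat (V : nmodType) (F : bool -> nat -> nat -> V) (i : nat) : V :=
  if decode i is Some (b, n, j) then F b n j else 0.

Definition box_seq (M J : nat) : seq (bool * nat * nat) :=
  [seq (x, j) | x <- [seq (b, n) | b <- [:: false; true], n <- iota 0 M], j <- iota 0 J].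

Lemma mem_box_seq M J b n j : ((b, n, j) \in box_seq M J) = (n < M)%N && (j < J)%N.
Proof.
apply/allpairsP/andP => [[x [hx hj [xE jE]]]|[hn hj]].
  move: hx; rewrite -xE => /allpairsP [y [_ hn [_ nE]]].
  by move: hn hj; rewrite !mem_iota !add0n -nE -jE.
exists ((b, n), j); split; rewrite ?mem_iota //.
by apply/allpairsP; exists (b, n); split; rewrite ?mem_iota //; case: b.
Qed.

Lemma uniq_box_seq M J : uniq (box_seq M J).
Proof.
apply: allpairs_uniq; [|exact: iota_uniq|by move=> [? ?] [? ?] _ _ /= [-> ->]].
by apply: allpairs_uniq; [|exact: iota_uniq|move=> [? ?] [? ?] _ _ /= [-> ->]].
Qed.

Lemma box_sum_seq (V : nmodType) (F : bool -> nat -> nat -> V) M J :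
  box_sum F M J = \sum_(i <- map choice.pickle (box_seq M J)) flat F i.
Proof.
rewrite big_map /box_seq big_allpairs_dep big_allpairs_dep /= !big_cons big_nil addr0.
rewrite /box_sum -big_split /=; rewrite -(big_mkord xpredT (fun n => \sum_(j < J) F false n j + \sum_(j < J) F true n j)).
rewrite /index_iota subn0; apply: eq_bigr => n _.
by congr (_ + _); rewrite -(big_mkord xpredT) /index_iota subn0; apply: eq_bigr => j _;
  rewrite /flat /decode pickleK_inv.
Qed.

Lemma index_bound N : exists M0, forall i b n j, (i < N)%N ->
  decode i = Some (b, n, j) -> (n < M0)%N /\ (j < M0)%N.
Proof.
elim: N => [|N [M0 H]]; first by exists 0%N.
case E : (decode N) => [[[b0 n0] j0]|].
  exists (maxn M0 (maxn n0 j0).+1) => i b n j; rewrite ltnS leq_eqVlt => /orP[/eqP ->|/H h].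
    by rewrite E => -[_ <- <-]; rewrite !leq_max !ltnS !leq_max !leqnn ?orbT.
  by move=> /h [h1 h2]; rewrite !leq_max h1 h2.
exists M0 => i b n j; rewrite ltnS leq_eqVlt => /orP[/eqP ->|]; first by rewrite E.
exact: H.
Qed.

(** A large box contains every triple coded below [N], so what remains of it is part of a tail of
    the enumerated series. [N2] and [P] are chosen before [F]. *)
Lemma flat_box N : exists M0, forall M J, (M0 <= M)%N -> (M0 <= J)%N ->
  exists N2 (P : pred nat), (N <= N2)%N /\ forall (V : nmodType) (F : bool -> nat -> nat -> V),
   box_sum F M J = \sum_(i < N) flat F i + \sum_(N <= i < N2 | P i) flat F i.
Proof.
have [M0 HM] := index_bound N; exists M0 => M J MM MJ.
set s := map choice.pickle (box_seq M J).
have us : uniq s by rewrite map_inj_uniq ?uniq_box_seq //; exact: (pcan_inj pickleK).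
pose N2 := maxn N (\max_(i <- s) i).+1.
exists N2, (mem s); split; first exact: leq_maxl.
move=> V F; rewrite box_sum_seq -/s.
have -> : \sum_(i <- s) flat F i = \sum_(i <- iota 0 N2 | i \in s) flat F i.
  rewrite -[RHS]big_filter; apply: perm_big; apply: uniq_perm => //.
    by rewrite filter_uniq ?iota_uniq.
  move=> i; rewrite mem_filter mem_iota add0n /=.
  case: (boolP (i \in s)) => //= iS; apply/esym.
  by rewrite /N2 leq_max ltnS (@leq_bigmax_seq _ s xpredT id i) ?orbT.
have -> : iota 0 N2 = index_iota 0 N2 by rewrite /index_iota subn0.
rewrite (big_cat_nat _ (n := N)) ?leq_maxl //=; congr (_ + _).
rewrite big_mkord big_mkcond /=; apply: eq_bigr => i _.
case: ifP => // /negP h; rewrite /flat; case E : (decode i) => [[[b n] j]|//].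
exfalso; apply: h; have [h1 h2] := HM _ _ _ _ (ltn_ord i) E.
apply/mapP; exists (b, n, j).
  by rewrite mem_box_seq (leq_trans h1) // (leq_trans h2).
by have := @pickle_invK (bool * nat * nat)%type i; rewrite -/(decode i) E.
Qed.

End Reindexing.

Section Tails.
Variable R : realType.

Lemma small_tail (u : nat -> R) (S e : R) : (forall i, 0 <= u i) ->
  (forall N, \sum_(i < N) u i <= S) -> 0 < e ->
  exists n0, forall N N2, (n0 <= N)%N -> (N <= N2)%N -> \sum_(N <= i < N2) u i <= e.
Proof.
move=> u0 uS e0; pose A := range (fun N => \sum_(i < N) u i).
have hA : has_sup A by split; [exists (\sum_(i < 0) u i), 0%N|exists S => _ [N _ <-]].
have [_ [n0 _ <-] h] := sup_adherent e0 hA.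
exists n0 => N N2 nN NN.
have split_sum a b : (a <= b)%N -> \sum_(i < b) u i = \sum_(i < a) u i + \sum_(a <= i < b) u i.
  by move=> ab; rewrite -!(big_mkord xpredT u) -big_cat_nat.
have h2 : \sum_(i < N2) u i <= sup A by apply: ub_le_sup; [exact: hA.2|exists N2].
have h3 : 0 <= \sum_(n0 <= i < N) u i by apply: sumr_ge0 => i _.
by move: h2 h h3; rewrite (split_sum N N2) // (split_sum n0 N) //; lra.
Qed.

End Tails.

(** * The one-variable decomposition *)

Section OneVariable.
Variable R : realType.

(* A one-variable Franks-McIntosh decomposition. *)
Record fm_system (al be : R) (Psi Psit : nat -> R[i] -> R[i]) (L : nat -> (R[i] -> R[i]) -> R[i])
    (C : R) : Prop := FMSystem {
  fm_C : 0 < C;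
  fm_Hinf0 : forall i, Hinf0 al (Psi i) /\ Hinf0 al (Psit i);
  fm_power : forall p : R, 0 < p ->
    (exists M : R, forall z, stolz al z -> forall N, \sum_(i < N) powR (normc (Psi i z)) p <= M) /\
    (exists M : R, forall z, stolz al z -> forall N, \sum_(i < N) powR (normc (Psit i z)) p <= M);
  fm_bound : forall i f (B : R), (forall z, stolz be z -> normc (f z) <= B) -> normc (L i f) <= C * B;
  fm_linear : forall i f g (B D : R) c, (forall z, stolz be z -> normc (f z) <= B) ->
    (forall z, stolz be z -> normc (g z) <= D) ->
    L i (fun z => f z + c * g z) = L i f + c * L i g;
  fm_series : forall z, stolz al z -> forall e : R, 0 < e -> exists n0, forall N, (n0 <= N)%N ->
    forall (h : R[i] -> R[i]) (B : R), (forall w, stolz be w -> cdiff h w) ->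
      (forall w, stolz be w -> normc (h w) <= B) ->
      normc (h z - \sum_(i < N) L i h * (Psi i z * Psit i z)) <= e * B }.

Lemma sum_flat_le (F : bool -> nat -> nat -> R) (S : R) :
  (forall b n j, 0 <= F b n j) -> (forall M J, box_sum F M J <= S) ->
  forall N, \sum_(i < N) flat F i <= S.
Proof.
move=> F0 FS N; have [M0 /(_ M0 M0 (leqnn _) (leqnn _)) [N2 [P [_ H]]]] := flat_box N.
rewrite (le_trans _ (FS M0 M0)) // H lerDl; apply: sumr_ge0 => i _.
by rewrite /flat; case: (decode _) => [[[b n] j]|].
Qed.

Lemma flat_abs_le (V : nmodType) (F : bool -> nat -> nat -> V) (f : V -> R) : f 0 = 0 ->
  forall i, f (flat F i) = flat (fun b n j => f (F b n j)) i.
Proof. by move=> f0 i; rewrite /flat; case: (decode _) => [[[b n] j]|]. Qed.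

Theorem fm_exists (al be : R) : 0 < al -> al < be -> be < pi / 2 ->
  exists Psi Psit L C, fm_system al be Psi Psit L C.
Proof.
move=> al0 albe bepi.
have pi0 : 0 < pi / 2 :> R by rewrite divr_gt0 ?pi_gt0.
have sa0 : 0 < sin al by apply: sin_gt0_pihalf; rewrite al0 (lt_trans albe).
have sab : sin al < sin be by rewrite ltr_sin // in_itv /=; lra.
have sb1 : sin be < 1 by rewrite -[ltRHS]sin_pihalf ltr_sin // in_itv /=; lra.
have sab' := ltW sab.
have [c0 c00 Hc] := contour_exists sa0 sab sb1.
have cc : 0 < c0 / (c0 + 2) by rewrite divr_gt0 // addr_gt0.
pose eps := Num.min (1 / 2) (c0 / (c0 + 2) / 4).
have eps0 : 0 < eps by rewrite lt_min !divr_gt0 ?addr_gt0.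
have eps2 : eps <= 1 / 2 by rewrite ge_min lexx.
have epsc : eps <= c0 / (c0 + 2) / 4 by rewrite ge_min lexx orbT.
have [|Q [K [rho HQ]]] := Hc eps; first by rewrite eps0 /=; lra.
pose W := winding Q K.
have W0 : W != 0 by exact: (winding_neq0 sa0 sb1 c00 HQ).
pose Psi i z := flat (fun _ n j => psi Q n j z) i.
pose Psit i z := flat (fun b n j => psit eps Q b n j z) i.
pose L i f := flat (fun b n j => coef eps Q K b n j f) i.
have Psib (b : bool) n j z : cone (sin al) z ->
    normc (psi Q n j z) <= factor_bound c0 * profile (gap Q n) (normc (1 - z)) * 2^-1 ^+ j.
  by move=> cz; exact: (psi_mod sab' sb1 c00 HQ cz).
have Psitb b n j z : cone (sin al) z ->
    normc (psit eps Q b n j z) <= factor_bound c0 * profile (gap Q n) (normc (1 - z)) * 2^-1 ^+ j.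
  by move=> cz; exact: (psit_mod sab' sb1 c00 eps0 epsc HQ cz).
have Hinf0_flat (F : bool -> nat -> nat -> R[i] -> R[i]) :
   (forall b n j z, cone (sin al) z -> cdiff (F b n j) z) ->
   (forall b n j z, cone (sin al) z ->
    normc (F b n j z) <= factor_bound c0 * profile (gap Q n) (normc (1 - z)) * 2^-1 ^+ j) ->
   forall i, Hinf0 al (fun z => flat (fun b n j => F b n j z) i).
  move=> dF bF i; rewrite /flat /Hinf0 /holo_on stolz_cone; case: (decode _) => [[[b n] j]|]; last first.
    split; first by move=> z _; exact: differentiable_cst.
      by exists 0 => z _; rewrite mod0.
    exists 1, 1; split => // z _; rewrite mod0 mul1r; exact: powR_ge0.
  have [h1 h2] := psi_Hinf0_bound sab' sb1 c00 HQ (bF b n j).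
  by split => //; move=> z cz; apply/cdiff_differentiable; exact: dF.
have power_flat (F : bool -> nat -> nat -> R[i] -> R[i]) :
   (forall b n j z, cone (sin al) z ->
    normc (F b n j z) <= factor_bound c0 * profile (gap Q n) (normc (1 - z)) * 2^-1 ^+ j) ->
   forall p : R, 0 < p -> exists M : R, forall z, stolz al z ->
     forall N, \sum_(i < N) powR (normc (flat (fun b n j => F b n j z) i)) p <= M.
  move=> bF p p0; have [S HS] := power_box_sum sab' sb1 c00 HQ p0.
  exists S => z; rewrite stolz_cone => cz N.
  have f0 : powR (normc (0 : R[i])) p = 0 by rewrite mod0 powR0 // gt_eqF.
  have -> : \sum_(i < N) powR (normc (flat (fun b n j => F b n j z) i)) p =
      \sum_(i < N) flat (fun b n j => powR (normc (F b n j z)) p) i.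
    by apply: eq_bigr => i _; exact: (@flat_abs_le _ _ (fun w => powR (normc w) p) f0).
  apply: sum_flat_le; first by move=> *; exact: powR_ge0.
  by move=> M J; exact: HS.
have C0 : 0 < (normc W)^-1 by rewrite invr_gt0 mod_gt0.
have PP : forall p : R, 0 < p ->
    (exists M : R, forall z, stolz al z -> forall N, \sum_(i < N) powR (normc (Psi i z)) p <= M) /\
    (exists M : R, forall z, stolz al z -> forall N, \sum_(i < N) powR (normc (Psit i z)) p <= M).
  by move=> p p0; split; [exact: (power_flat (fun _ => psi Q) Psib p p0)|exact: (power_flat (psit eps Q) Psitb p p0)].
have LB i f (B : R) : (forall z, stolz be z -> normc (f z) <= B) -> normc (L i f) <= (normc W)^-1 * B.
  rewrite stolz_cone => fB; rewrite /L /flat; case: (decode _) => [[[b n] j]|].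
    exact: (coef_bound sb1 eps0 eps2 HQ).
  have B0 : 0 <= B by apply: le_trans (fB _ (node_cone HQ true 0)); exact: mod_ge0.
  by rewrite mod0 mulr_ge0 // ltW.
exists Psi, Psit, L, (normc W)^-1; split => //.
- move=> i; split; [apply: (Hinf0_flat (fun _ => psi Q) _ Psib)|apply: (Hinf0_flat (psit eps Q) _ Psitb)].
    by move=> _ n j z cz; exact: (psi_cdiff sab' sb1 HQ cz).
  by move=> b n j z cz; exact: (psit_cdiff sab' sb1 c00 HQ cz).
- rewrite stolz_cone => i f g B D c fB gD; rewrite /L /flat; case: (decode _) => [[[b n] j]|].
    exact: (coefL sb1 eps0 eps2 HQ c b n j fB gD).
  by rewrite mulr0 addr0.
move=> z sz e e0.
have cz : cone (sin al) z by rewrite -stolz_cone.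
have Phi i (h : R[i] -> R[i]) : L i h * (Psi i z * Psit i z) =
  flat (fun b n j => coef eps Q K b n j h * atom eps Q b n j z) i.
  rewrite /L /Psi /Psit /flat; case: (decode _) => [[[b n] j]|]; last by rewrite mul0r.
  by rewrite (psi_psit sab' sb1 HQ cz).
pose u i := normc (Psi i z * Psit i z).
(* Absolute summability of the products follows from the case [p = 2], as a product is at most the
   sum of the squares. *)
have [[S1 HS1] [S2 HS2]] := PP 2%:R (ltr0n _ 2).
have uS N : \sum_(i < N) u i <= S1 + S2.
  apply: (@le_trans _ _ (\sum_(i < N) (powR (normc (Psi i z)) 2%:R + powR (normc (Psit i z)) 2%:R))).
    apply: ler_sum => i _; rewrite /u modM !powR_mulrn ?mod_ge0 //.
    have := sqr_ge0 (normc (Psi i z) - normc (Psit i z)).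
    by have := sqr_ge0 (normc (Psi i z)); have := sqr_ge0 (normc (Psit i z)); lra.
  by rewrite big_split /= lerD ?HS1 ?HS2.
(* The factor [normc W] offsets the constant [(normc W)^-1] in the bound [LB]. *)
have eW : 0 < e * normc W by rewrite mulr_gt0 // mod_gt0.
have u0 i : 0 <= u i by exact: mod_ge0.
have [n0 Hn0] := small_tail u0 uS eW.
exists n0 => N nN h B hd hB.
have B0 : 0 <= B.
  by apply: le_trans (hB z _); [exact: mod_ge0|rewrite stolz_cone; exact: cone_sub cz].
(* The box depends on [h] and on the slack [e1], but [n0] was fixed before [h]: the terms of the box
   from [N] on are bounded by [B] times a tail of [u]. *)
apply/ler_addgt0Pr => e1 e10.
rewrite stolz_cone in hd hB.
have [M0 HM0] := flat_box N.
have [M [J [MM MJ Hbox]]] := box_limit sa0 sab' sb1 c00 eps0 eps2 epsc HQ M0 hd hB cz e10.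
have [N2 [P [NN HP]]] := HM0 M J MM MJ.
rewrite HP in Hbox.
have -> : \sum_(i < N) L i h * (Psi i z * Psit i z) =
    \sum_(i < N) flat (fun b n j => coef eps Q K b n j h * atom eps Q b n j z) i.
  by apply: eq_bigr => i _; exact: Phi.
move: Hbox; set X := \sum_(i < N) _; set Y := \sum_(N <= i < N2 | P i) _ => Hbox.
have hY : normc Y <= e * B.
  rewrite (le_trans (mod_sum _ _ _)) //.
  apply: (@le_trans _ _ (\sum_(N <= i < N2 | P i) (normc W)^-1 * B * u i)).
    apply: ler_sum => i _; rewrite -Phi modM ler_wpM2r ?mod_ge0 // LB //.
    by rewrite stolz_cone.
  rewrite -mulr_sumr.
  apply: (@le_trans _ _ ((normc W)^-1 * B * (e * normc W))).
    rewrite ler_wpM2l ?mulr_ge0 ?(ltW C0) // (le_trans _ (Hn0 N N2 nN NN)) //.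
    by rewrite big_mkcond /=; apply: ler_sum => i _; case: ifP => // _; exact: mod_ge0.
  have -> : (normc W)^-1 * B * (e * normc W) = (normc W)^-1 * normc W * (e * B) by ring.
  by rewrite mulVf ?mul1r // mod_eq0.
have -> : h z - X = - (X + Y - h z) + Y by ring.
rewrite (le_trans (modD _ _)) // modN addrC lerD //.
Qed.

End OneVariable.

Lemma sub_big_seq (I : eqType) (V : nmodType) (s1 s2 : seq I) (u : I -> V) :
  uniq s1 -> uniq s2 -> {subset s1 <= s2} ->
  \sum_(i <- s2) u i = \sum_(i <- s1) u i + \sum_(i <- s2 | i \notin s1) u i.
Proof.
move=> u1 u2 s12; rewrite (bigID (mem s1)) /=; congr (_ + _).
rewrite -big_filter; apply: perm_big; apply: uniq_perm => //; first exact: filter_uniq.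
by move=> i; rewrite mem_filter /=; case: (boolP (i \in s1)) => // /s12.
Qed.

Lemma cauchy_nondecreasing (R : realType) (P : nat -> R) (S e : R) :
  (forall n, P n <= S) -> 0 < e ->
  exists n0, forall N, P N <= P n0 + e.
Proof.
move=> PS e0; pose A := range P.
have hA : has_sup A by split; [exists (P 0%N), 0%N|exists S => _ [N _ <-]].
have [_ [n0 _ <-] h] := sup_adherent e0 hA.
exists n0 => N; have : P N <= sup A by apply: ub_le_sup; [exact: hA.2|exists N].
by move: h; lra.
Qed.

(** * Several variables *)

Section IndexBoxes.
Variable d : nat.
Local Notation index := {ffun 'I_d -> nat}.
Implicit Types (ks : seq 'I_d) (j : index).

Definition setf j (k : 'I_d) (i : nat) : index := [ffun l => if l == k then i else j l].

(** The recursion along [ks] matches that of [psum] and [tcoef]; the value 0 off [ks] keeps the list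
    free of duplicates. *)
Fixpoint boxl (n : nat) (ks : seq 'I_d) : seq index :=
  if ks is k :: ks' then [seq setf j k i | i <- iota 0 n, j <- boxl n ks'] else [:: [ffun=> 0%N]].

Lemma mem_boxl n ks j : reflect ((forall l, l \in ks -> (j l < n)%N) /\ (forall l, l \notin ks -> j l = 0%N))
  (j \in boxl n ks).
Proof.
elim: ks j => [|k ks IH] j /=.
  rewrite inE; apply: (iffP eqP) => [->|[_ H]]; last by apply/ffunP => l; rewrite ffunE H.
  by split => // l; rewrite ffunE.
apply: (iffP allpairsP) => [[[i j'] /= [hi hj ->]]|[H1 H2]].
  have /IH [h1 h2] := hj; move: hi; rewrite mem_iota add0n /= => hi.
  split => l; rewrite inE ffunE; case: eqP => //= _; [exact: h1|exact: h2].
exists (j k, if k \in ks then j else setf j k 0) => /=; split.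
- by rewrite mem_iota add0n /= H1 // inE eqxx.
- case: ifP => kks; apply/IH; split => l hl.
  + by apply: H1; rewrite inE hl orbT.
  + by apply: H2; rewrite inE negb_or hl andbT; apply: contraNneq hl => ->.
  + by rewrite ffunE; case: eqP => [lk|_]; [rewrite -lk hl in kks|apply: H1; rewrite inE hl orbT].
  + by rewrite ffunE; case: eqP => // /eqP lk; apply: H2; rewrite inE negb_or lk.
- apply/ffunP => l; rewrite ffunE; case: (eqVneq l k) => [-> //|lk].
  by case: ifP => _ //; rewrite ffunE (negbTE lk).
Qed.

Lemma uniq_boxl n ks : uniq ks -> uniq (boxl n ks).
Proof.
elim: ks => [//|k ks IH] /= /andP[kks uks].
apply: allpairs_uniq; [exact: iota_uniq|exact: IH|].
move=> [i j] [i' j'] /allpairsP [[x y] /= [_ hy [-> ->]]] /allpairsP [[x' y'] /= [_ hy' [-> ->]]] E.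
have E' l : setf y k x l = setf y' k x' l by rewrite E.
congr (_, _); first by have := E' k; rewrite !ffunE eqxx.
apply/ffunP => l; have := E' l; rewrite !ffunE; case: eqP => // -> _.
have /mem_boxl [_ h1] := hy; have /mem_boxl [_ h2] := hy'.
by rewrite h1 // h2.
Qed.

Lemma sum_boxl (R : comPzRingType) n ks (f : 'I_d -> nat -> R) : uniq ks ->
  \sum_(j <- boxl n ks) \prod_(l <- ks) f l (j l) = \prod_(l <- ks) \sum_(i < n) f l i.
Proof.
elim: ks => [_|k ks IH /= /andP[kks uks]]; first by rewrite /= big_seq1 !big_nil.
rewrite big_allpairs_dep big_cons -IH // mulr_suml.
rewrite -(big_mkord xpredT (fun i => f k i * \sum_(j <- boxl n ks) \prod_(l <- ks) f l (j l))) /index_iota subn0.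
apply: eq_bigr => i _; rewrite mulr_sumr; apply: eq_bigr => j _.
rewrite big_cons ffunE eqxx; congr (_ * _).
rewrite !big_seq; apply: eq_bigr => l lks; rewrite ffunE; case: eqP => // lk.
by rewrite -lk lks in kks.
Qed.

End IndexBoxes.

(** * Tensor products of one-variable decompositions *)

Section Tensor.
Variables (R : realType) (d : nat) (al be : 'I_d -> R).
Variables (Psi Psit : 'I_d -> nat -> R[i] -> R[i])
  (L : 'I_d -> nat -> (R[i] -> R[i]) -> R[i]) (C : 'I_d -> R).
Hypothesis HS : forall k, fm_system (al k) (be k) (Psi k) (Psit k) (L k) (C k).
Hypothesis ab : forall k, stolz (al k) `<=` stolz (be k).
Local Notation V := 'rV[(R[i])^o]_d.
Local Notation index := {ffun 'I_d -> nat}.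
Implicit Types (z : V) (k : 'I_d) (w : R[i]) (F G : V -> R[i]) (j : index).

Definition upd z k w : V := \row_l (if l == k then w else z ord0 l).

Local Notation D := (stolz_prod be).

Lemma upd_in z k w : D z -> stolz (be k) w -> D (upd z k w).
Proof. by move=> Dz sw l; rewrite mxE; case: eqP => [->|_]. Qed.

Lemma updC z k k' w w' : k != k' -> upd (upd z k w) k' w' = upd (upd z k' w') k w.
Proof.
move=> kk; apply/rowP => l; rewrite !mxE.
by case: eqP => [->|]; case: eqP => // lk; rewrite ?lk eqxx // in kk *.
Qed.

Lemma upd_upd z k w w' : upd (upd z k w) k w' = upd z k w'.
Proof. by apply/rowP => l; rewrite !mxE; case: eqP. Qed.

(** Separate holomorphy, the form of the hypothesis that is passed on when coordinates are
    frozen. *)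
Definition slice_holo F := forall k z w, D z -> stolz (be k) w -> cdiff (fun x => F (upd z k x)) w.

Lemma holo_slice F : holo_on_d D F -> slice_holo F.
Proof.
move=> hF k z w Dz sw; apply/cdiff_differentiable.
have -> : (fun x => F (upd z k x)) =
   F \o (fun x : (R[i])^o => upd z k 0 + x *: (delta_mx ord0 k : V)).
  apply/funext => x /=; congr F; apply/rowP => l; rewrite !mxE /=.
  by case: eqP => _; rewrite ?mulr1 ?mulr0 ?add0r ?addr0.
apply: differentiable_comp.
  apply: differentiableD; first exact: differentiable_cst.
  exact: differentiableZl.
apply: hF.
have -> : upd z k 0 + w *: (delta_mx ord0 k : V) = upd z k w.
  apply/rowP => l; rewrite !mxE /=.
  by case: eqP => _; rewrite ?mulr1 ?mulr0 ?add0r ?addr0.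
exact: upd_in.
Qed.

Variable zeta : V.
Hypothesis Hzeta : stolz_prod al zeta.

Let Phi k (i : nat) : R[i] := Psi k i (zeta ord0 k) * Psit k i (zeta ord0 k).

Fixpoint freeze (ks : seq 'I_d) F z : R[i] :=
  if ks is k :: ks' then freeze ks' F (upd z k (zeta ord0 k)) else F z.

(* [freeze] evaluates at [zeta], [psum] uses partial sums of the series instead. *)
Fixpoint psum (n : nat) (ks : seq 'I_d) F z : R[i] :=
  if ks is k :: ks' then \sum_(i < n) L k i (fun w => psum n ks' F (upd z k w)) * Phi k i else F z.

Fixpoint tcoef (ks : seq 'I_d) j F z : R[i] :=
  if ks is k :: ks' then L k (j k) (fun w => tcoef ks' j F (upd z k w)) else F z.

Lemma zeta_be k : stolz (be k) (zeta ord0 k).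
Proof. by apply: ab; exact: Hzeta. Qed.

Lemma freezeE ks F z : freeze ks F z = F (\row_l (if l \in ks then zeta ord0 l else z ord0 l)).
Proof.
elim: ks z => [|k ks IH] z /=; first by congr F; apply/rowP => l; rewrite mxE.
rewrite IH; congr F; apply/rowP => l; rewrite !mxE inE.
by case: eqP => [->|_] /=; case: ifP.
Qed.

Lemma freeze_bound ks F (B : R) : (forall z, D z -> normc (F z) <= B) ->
  forall z, D z -> normc (freeze ks F z) <= B.
Proof.
move=> FB z Dz; rewrite freezeE; apply: FB => l; rewrite mxE.
by case: ifP => _ //; exact: zeta_be.
Qed.

Lemma freeze_slice ks F : slice_holo F -> slice_holo (freeze ks F).
Proof.
move=> hF; elim: ks => [//|k ks IH] k' z w Dz sw /=.
have [->|kk] := eqVneq k' k.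
  by apply: cdiff_eq (cdiff_cst (freeze ks F (upd z k (zeta ord0 k))) w) => x; rewrite upd_upd.
apply: cdiff_eq (IH k' (upd z k (zeta ord0 k)) w _ sw); last by apply: upd_in => //; exact: zeta_be.
by move=> x; rewrite updC // eq_sym.
Qed.

Lemma phi_abs_sum k : exists2 S : R, 0 <= S & forall N, \sum_(i < N) normc (Phi k i) <= S.
Proof.
have [[S1 H1] [S2 H2]] := fm_power (HS k) (ltr0n R 2).
have N0 (S : R) (f : 'I_d -> nat -> R[i] -> R[i]) :
  (forall w, stolz (al k) w -> forall N, \sum_(i < N) powR (normc (f k i w)) 2%:R <= S) -> 0 <= S.
  by move=> H; have := H _ (Hzeta k) 0%N; rewrite big_ord0.
exists (S1 + S2); first by rewrite addr_ge0 ?(N0 S1 Psi) ?(N0 S2 Psit).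
move=> N; apply: (@le_trans _ _ (\sum_(i < N) (powR (normc (Psi k i (zeta ord0 k))) 2%:R
   + powR (normc (Psit k i (zeta ord0 k))) 2%:R))).
  apply: ler_sum => i _; rewrite /Phi modM !powR_mulrn ?mod_ge0 //.
  have := sqr_ge0 (normc (Psi k i (zeta ord0 k)) - normc (Psit k i (zeta ord0 k))).
  have := sqr_ge0 (normc (Psi k i (zeta ord0 k))).
  by have := sqr_ge0 (normc (Psit k i (zeta ord0 k))); lra.
by rewrite big_split /= lerD ?H1 ?H2.
Qed.

Lemma tcoef_bound ks j F (B : R) : (forall z, D z -> normc (F z) <= B) ->
  forall z, D z -> normc (tcoef ks j F z) <= (\prod_(k <- ks) C k) * B.
Proof.
move=> FB; elim: ks => [|k ks IH] z Dz /=; first by rewrite big_nil mul1r FB.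
rewrite big_cons -mulrA; apply: (fm_bound (HS k)) => w sw; apply: IH; exact: upd_in.
Qed.

Lemma L_sum k i (I : Type) (s : seq I) (c : I -> R[i]) (f : I -> R[i] -> R[i]) (B : R) :
  (forall x w, stolz (be k) w -> normc (f x w) <= B) ->
  (exists K, forall w, stolz (be k) w -> normc (\sum_(x <- s) c x * f x w) <= K) /\
  L k i (fun w => \sum_(x <- s) c x * f x w) = \sum_(x <- s) c x * L k i (f x).
Proof.
move=> fB; elim: s => [|x s [[K HK] IH]].
  have z0 w : stolz (be k) w -> normc ((fun=> 0 : R[i]) w) <= 0 by rewrite mod0.
  split; first by exists 0 => w _; rewrite big_nil mod0.
  rewrite big_nil; have -> : (fun w => \sum_(x <- [::]) c x * f x w) = fun=> 0.
    by apply/funext => w; rewrite big_nil.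
  apply/eqP; rewrite -mod_eq0; apply/eqP/le_anti; rewrite mod_ge0 andbT.
  by have := fm_bound (HS k) i z0; rewrite mulr0.
have E : (fun w => \sum_(y <- x :: s) c y * f y w) = fun w => \sum_(y <- s) c y * f y w + c x * f x w.
  by apply/funext => w; rewrite big_cons addrC.
split.
  exists (K + normc (c x) * B) => w sw; rewrite big_cons addrC (le_trans (modD _ _)) // lerD ?HK //.
  by rewrite modM ler_wpM2l ?mod_ge0 ?fB.
rewrite E (fm_linear (HS k) i (c x) HK (fB x)) IH big_cons addrC //.
Qed.

Lemma tcoef_ext ks j j' F z : (forall l, l \in ks -> j l = j' l) -> tcoef ks j F z = tcoef ks j' F z.
Proof.
elim: ks z => [//|k ks IH] z H /=; rewrite (H k) ?inE ?eqxx //; congr (L k _ _).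
by apply/funext => w; apply: IH => l lk; apply: H; rewrite inE lk orbT.
Qed.

(** Linearity and the bound with constant 0 show that a functional sees only the values on the
    domain. *)
Lemma L_ext k i (f g : R[i] -> R[i]) (B : R) : (forall w, stolz (be k) w -> normc (f w) <= B) ->
  (forall w, stolz (be k) w -> f w = g w) -> L k i f = L k i g.
Proof.
move=> fB fg; have gB w : stolz (be k) w -> normc (g w) <= B by move=> sw; rewrite -fg ?fB.
have := fm_linear (HS k) i (-1) fB gB; rewrite mulN1r => h.
apply/eqP; rewrite -subr_eq0 -h -mod_eq0; apply/eqP/le_anti; rewrite mod_ge0 andbT.
rewrite -[leRHS](mulr0 (C k)); apply: (fm_bound (HS k)) => w sw.
by rewrite fg // mulN1r subrr mod0.
Qed.

Lemma psum_boxl n ks F (B : R) : uniq ks -> (forall z, D z -> normc (F z) <= B) ->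
  forall z, D z ->
  psum n ks F z = \sum_(j <- boxl n ks) (\prod_(l <- ks) Phi l (j l)) * tcoef ks j F z.
Proof.
move=> uks FB; elim: ks uks => [_|k ks IH /= /andP[kks uks]] z Dz.
  by rewrite /= big_seq1 big_nil mul1r.
rewrite big_allpairs_dep /=.
rewrite -(big_mkord xpredT (fun i => L k i (fun w => psum n ks F (upd z k w)) * Phi k i)) /index_iota subn0.
apply: eq_bigr => i _.
have tB j w : stolz (be k) w -> normc (tcoef ks j F (upd z k w)) <= (\prod_(k <- ks) C k) * B.
  move=> sw; exact: (tcoef_bound ks j FB (upd_in Dz sw)).
have [[K HK] E] := L_sum i (boxl n ks) (fun j => \prod_(l <- ks) Phi l (j l)) tB.
have -> : L k i (fun w => psum n ks F (upd z k w)) =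
  \sum_(j <- boxl n ks) (\prod_(l <- ks) Phi l (j l)) * L k i (fun w => tcoef ks j F (upd z k w)).
  rewrite -E; apply/esym; apply: L_ext HK _ => w sw; exact: (esym (IH uks _ (upd_in Dz sw))).
rewrite mulr_suml; apply: eq_bigr => j _.
rewrite big_cons ffunE eqxx.
have -> : \prod_(l <- ks) Phi l (setf j k i l) = \prod_(l <- ks) Phi l (j l).
  rewrite !big_seq; apply: eq_bigr => l lks; rewrite ffunE; case: eqP => // lk.
  by rewrite -lk lks in kks.
have -> : (fun w => tcoef ks (setf j k i) F (upd z k w)) = (fun w => tcoef ks j F (upd z k w)).
  apply/funext => w; apply: tcoef_ext => l lks; rewrite ffunE; case: eqP => // lk.
  by rewrite -lk lks in kks.
ring.
Qed.

Lemma psum_freeze ks F (B : R) : slice_holo F -> (forall z, D z -> normc (F z) <= B) ->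
  forall e : R, 0 < e -> exists n0, forall n, (n0 <= n)%N ->
  forall z, D z -> normc (freeze ks F z - psum n ks F z) <= e * B.
Proof.
move=> hF FB; elim: ks => [|k ks IH] e e0 /=.
  exists 0%N => n _ z Dz; rewrite subrr mod0 mulr_ge0 ?(ltW e0) //.
  by rewrite (le_trans _ (FB z Dz)) ?mod_ge0.
have [S S0 HPhi] := phi_abs_sum k; have C0 := fm_C (HS k).
have den1 : 0 < C k * S + 1 by rewrite ltr_wpDl // mulr_ge0 // ltW.
have den : 0 < 2 * (C k * S + 1) by rewrite mulr_gt0.
have e2 : 0 < e / 2 by rewrite divr_gt0.
(* Summing against [Phi k] multiplies the inner error by at most [C k * S], so this precision leaves
   at most [e / 2]. *)
have e3 : 0 < e / (2 * (C k * S + 1)) by rewrite divr_gt0.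
have [n1 H1] := IH _ e3.
have [n2 H2] := fm_series (HS k) (Hzeta k) e2.
exists (maxn n1 n2) => n; rewrite geq_max => /andP[n1n n2n] z Dz.
have B0 : 0 <= B by rewrite (le_trans _ (FB z Dz)) ?mod_ge0.
have Du w : stolz (be k) w -> D (upd z k w) by exact: upd_in.
pose G w := freeze ks F (upd z k w); pose H w := psum n ks F (upd z k w).
have GB w : stolz (be k) w -> normc (G w) <= B by move=> sw; exact: (freeze_bound ks FB (Du w sw)).
have Gd w : stolz (be k) w -> cdiff G w by move=> sw; apply: (freeze_slice ks hF).
have GH w : stolz (be k) w -> normc (G w + (-1) * H w) <= e / (2 * (C k * S + 1)) * B.
  by move=> sw; rewrite mulN1r; exact: (H1 n n1n _ (Du w sw)).
have HB w : stolz (be k) w -> normc (H w) <= B + e / (2 * (C k * S + 1)) * B.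
  move=> sw; have -> : H w = G w - (G w + (-1) * H w) by ring.
  by rewrite (le_trans (modB _ _)) // lerD ?GB ?GH.
have E : \sum_(i < n) L k i (fun w => G w + (-1) * H w) * Phi k i =
    \sum_(i < n) L k i G * Phi k i - \sum_(i < n) L k i H * Phi k i.
  rewrite -sumrB; apply: eq_bigr => i _.
  by rewrite (fm_linear (HS k) i (-1) GB HB) mulN1r mulrBl.
have -> : freeze ks F (upd z k (zeta ord0 k)) - \sum_(i < n) L k i H * Phi k i =
  (G (zeta ord0 k) - \sum_(i < n) L k i G * Phi k i) +
  \sum_(i < n) L k i (fun w => G w + (-1) * H w) * Phi k i.
  by rewrite E addrA subrK.
rewrite (le_trans (modD _ _)) //.
have -> : e * B = e / 2 * B + e / 2 * B by rewrite -mulrDl -splitr.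
rewrite lerD //; first exact: H2.
rewrite (le_trans (mod_sum _ _ _)) //.
apply: (@le_trans _ _ (\sum_(i < n) C k * (e / (2 * (C k * S + 1)) * B) * normc (Phi k i))).
  by apply: ler_sum => i _; rewrite modM ler_wpM2r ?mod_ge0 // (fm_bound (HS k)).
rewrite -mulr_sumr.
apply: (@le_trans _ _ (C k * (e / (2 * (C k * S + 1)) * B) * S)).
  by apply: ler_wpM2l => //; rewrite mulr_ge0 ?(ltW C0) // mulr_ge0 // ltW.
have -> : C k * (e / (2 * (C k * S + 1)) * B) * S = (e / 2 * B) * ((C k * S) / (C k * S + 1)).
  by field; rewrite gt_eqF.
apply: ler_piMr; first by rewrite mulr_ge0 // ltW.
by rewrite ler_pdivrMr // mul1r lerDl.
Qed.

Lemma zero_stolz (g : R) : 0 < sin g -> stolz g 0.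
Proof. by move=> g0; rewrite stolz_cone; exact: cone0. Qed.

(** Convergence along boxes comes from [psum_freeze]; the bounded increasing sums [P n] of moduli
    upgrade it to unconditional convergence. *)
Lemma tensor_sum (F : V -> R[i]) (B : R) (z0 : V) : slice_holo F -> (forall z, D z -> normc (F z) <= B) ->
  D z0 -> has_sum (fun j : index => tcoef (enum 'I_d) j F z0 *
      \prod_(k < d) (Psi k (j k) (zeta ord0 k) * Psit k (j k) (zeta ord0 k))) (F zeta).
Proof.
move=> hF FB Dz0.
pose T j : R[i] := tcoef (enum 'I_d) j F z0 *
  \prod_(k < d) (Psi k (j k) (zeta ord0 k) * Psit k (j k) (zeta ord0 k)).
change (has_sum (T : index -> (R[i])^o) (F zeta)) => e e0.
have B0 : 0 <= B by rewrite (le_trans _ (FB z0 Dz0)) ?mod_ge0.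
have TE j : T j = (\prod_(l <- enum 'I_d) Phi l (j l)) * tcoef (enum 'I_d) j F z0.
  by rewrite /T mulrC big_enum.
have un n := uniq_boxl n (enum_uniq 'I_d).
pose P n := \sum_(j <- boxl n (enum 'I_d)) normc (T j).
have /choice [S HS'] : forall k, exists S : R, 0 <= S /\ forall N, \sum_(i < N) normc (Phi k i) <= S.
  by move=> k; have [S S0 H] := phi_abs_sum k; exists S.
pose CB := (\prod_(k <- enum 'I_d) C k) * B.
have CB0 : 0 <= CB by rewrite mulr_ge0 // prodr_ge0 // => k _; exact: ltW (fm_C (HS k)).
have PS n : P n <= CB * \prod_(l <- enum 'I_d) S l.
  apply: (@le_trans _ _ (\sum_(j <- boxl n (enum 'I_d)) CB * \prod_(l <- enum 'I_d) normc (Phi l (j l)))).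
    apply: ler_sum => j _; rewrite TE modM mod_prod mulrC ler_wpM2r //.
      by apply: prodr_ge0 => l _; exact: mod_ge0.
    exact: tcoef_bound.
  rewrite -mulr_sumr ler_wpM2l // (sum_boxl _ (fun l i => normc (Phi l i))) ?enum_uniq //.
  apply: ler_prod => l _; rewrite (HS' l).2 andbT.
  by apply: sumr_ge0 => i _; exact: mod_ge0.
have e4 : 0 < e / 4 by rewrite divr_gt0.
have B1 : 0 < B + 1 by rewrite ltr_wpDl.
have [n1 H1] := psum_freeze (enum 'I_d) hF FB (divr_gt0 e4 B1).
have [n2 H2] := cauchy_nondecreasing PS e4.
have subbox n N : (n <= N)%N -> {subset boxl n (enum 'I_d) <= boxl N (enum 'I_d)}.
  move=> nN j /mem_boxl [h1 h2]; apply/mem_boxl; split => // l hl.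
  exact: leq_trans (h1 l hl) nN.
have Pmono n N : (n <= N)%N -> P n <= P N.
  move=> nN; rewrite /P (sub_big_seq _ (un n) (un N) (subbox _ _ nN)) lerDl.
  by apply: sumr_ge0 => j _; exact: mod_ge0.
pose n := maxn n1 n2.
exists (seq_fset tt (boxl n (enum 'I_d))) => X /fsubsetP HX.
have sX : {subset boxl n (enum 'I_d) <= (X : seq index)}.
  by move=> j hj; apply: HX; rewrite seq_fsetE.
(* The finite set [X] is squeezed between two boxes, so its terms outside the box of side [n] have
   moduli adding up to at most [P N - P n]. *)
pose N := maxn n (\max_(j <- (X : seq index)) \max_(l < d) j l).+1.
have XN : {subset (X : seq index) <= boxl N (enum 'I_d)}.
  move=> j jX; apply/mem_boxl; split => l; last by rewrite mem_enum.
  move=> _; rewrite /N leq_max ltnS; apply/orP; right.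
  apply: (@leq_trans (\max_(l < d) j l)); first exact: (@leq_bigmax _ (fun l => j l) l).
  exact: (@leq_bigmax_seq _ (X : seq index) xpredT (fun j => \max_(l < d) j l)%N j jX).
have uX : uniq (X : seq index) by exact: fset_uniq.
have hx1 := sub_big_seq T (un n) uX sX.
have hx2 := sub_big_seq (fun j => normc (T j)) (un n) uX sX.
have hx3 := sub_big_seq (fun j => normc (T j)) uX (un N) XN.
have h3 : 0 <= \sum_(j <- boxl N (enum 'I_d) | j \notin (X : seq index)) normc (T j).
  by apply: sumr_ge0 => j _; exact: mod_ge0.
have PN := H2 N; have Pn : P n2 <= P n by apply: Pmono; exact: leq_maxr.
have tail : normc (\sum_(j <- X | j \notin boxl n (enum 'I_d)) T j) <= e / 4.
  rewrite (le_trans (mod_sum _ _ _)) //.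
  by move: hx2 hx3 h3 PN Pn; rewrite /P => -> ->; lra.
have main : normc (F zeta - \sum_(j <- boxl n (enum 'I_d)) T j) <= e / 4.
  have := H1 n (leq_maxl _ _) z0 Dz0.
  rewrite (psum_boxl n (enum_uniq 'I_d) FB Dz0) freezeE.
  have -> : \row_l (if l \in enum 'I_d then zeta ord0 l else z0 ord0 l) = zeta.
    by apply/rowP => l; rewrite mxE mem_enum.
  rewrite (eq_bigr T) => [h|j _]; last by rewrite TE.
  rewrite (le_trans h) // mulrAC ler_pdivrMr // ler_wpM2l ?(ltW e4) // lerDl //.
rewrite hx1 opprD addrA.
by apply: le_lt_trans (modB _ _) _; move: tail main e0; lra.
Qed.

End Tensor.

Theorem theorem6p1 (R : realType) (d : nat) (hd : (0 < d)%N)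
  (alpha beta : 'I_d -> R)
  (hbeta : forall k, 0 < beta k < pi / 2)
  (halpha : forall k, 0 < alpha k < beta k) :
  exists Psi Psit : 'I_d -> nat -> (R[i])^o -> (R[i])^o,
    [/\ (forall k i, Hinf0 (alpha k) (Psi k i) /\ Hinf0 (alpha k) (Psit k i)),
        (forall (p : R), 0 < p -> forall k,
           (exists M : R, forall z, stolz (alpha k) z -> forall N : nat,
              \sum_(i < N) powR (normc (Psi k i z)) p <= M) /\
           (exists M : R, forall z, stolz (alpha k) z -> forall N : nat,
              \sum_(i < N) powR (normc (Psit k i z)) p <= M)) &
        exists C : R, 0 < C /\
          forall h : 'rV[(R[i])^o]_d -> (R[i])^o,
            holo_on_d (stolz_prod beta) h -> bounded_on (stolz_prod beta) h ->
            exists a : {ffun 'I_d -> nat} -> (R[i])^o,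
              (forall (j : {ffun 'I_d -> nat}) (M : R),
                 (forall z, stolz_prod beta z -> normc (h z) <= M) ->
                 normc (a j) <= C * M) /\
              (forall z, stolz_prod alpha z ->
                 has_sum (fun j : {ffun 'I_d -> nat} =>
                   a j * \prod_(k < d)
                     (Psi k (j k) (z ord0 k) * Psit k (j k) (z ord0 k)))
                   (h z))].
Proof.
pose T := ((nat -> R[i] -> R[i]) * (nat -> R[i] -> R[i]) * (nat -> (R[i] -> R[i]) -> R[i]) * R)%type.
have /choice [q qP] : forall k, exists q : T,
   fm_system (alpha k) (beta k) q.1.1.1 q.1.1.2 q.1.2 q.2.
  move=> k; have /andP[a0 ab] := halpha k; have /andP[_ bpi] := hbeta k.
  by have [Psi [Psit [L [C H]]]] := fm_exists a0 ab bpi; exists (Psi, Psit, L, C).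
have ab k : stolz (alpha k) `<=` stolz (beta k).
  have /andP[a0 ab] := halpha k; have /andP[_ bpi] := hbeta k.
  rewrite !stolz_cone; apply: cone_sub; rewrite ltW // ltr_sin // in_itv /=; lra.
exists (fun k => (q k).1.1.1), (fun k => (q k).1.1.2).
split; [by move=> k i; exact: (fm_Hinf0 (qP k))|by move=> p p0 k; exact: (fm_power (qP k))|].
exists (\prod_(k <- enum 'I_d) (q k).2); split.
  by apply: prodr_gt0 => k _; exact: (fm_C (qP k)).
move=> h hh [B hB].
have D0 : stolz_prod beta (0 : 'rV[(R[i])^o]_d).
  move=> k; rewrite mxE; apply: zero_stolz; apply: sin_gt0_pihalf; exact: hbeta.
(* Every coordinate of the base point 0 is overwritten; it only has to lie in the domain. It is
   independent of [z], hence so are the coefficients. *)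
exists (fun j => tcoef (fun k => (q k).1.2) (enum 'I_d) j h 0); split.
  move=> j M hM; exact: (tcoef_bound qP).
move=> z sz; exact: (tensor_sum qP ab sz (holo_slice hh) hB D0).
Qed.
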